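(* Assume that each $f_i:\mathbb{R}^d\to\mathbb{R}$ ($i=1,\dots,N$) is three times continuously differentiable with bounded third derivative and is $L$-smooth, and that $\sigma_*^2:=\sup_{x\in\mathbb{R}^d}\|\sigma_{\mathrm{MB}}(x)\sigma_{\mathrm{MB}}(x)^T\|_S<\infty$. Assume also that $f$ satisfies the Polyak-Lojasiewicz inequality: there is $\mu>0$ such that $\|\nabla f(x)\|^2\ge 2\mu(f(x)-f(x^\star))$ for all $x\in\mathbb{R}^d$. Let $\{X(t)\}_{t\ge 0}$ be the solution to the MB-PGF equation $$dX(t)=-\psi(t)\nabla f(X(t))\,dt+\psi(t)\sqrt{h/b(t)}\,\sigma_{\mathrm{MB}}(X(t))\,dB(t),\qquad X(0)=x_0 .$$ Then for all $t\ge 0$, $$\mathbb{E}[f(X(t))-f(x^\star)]\le e^{-2\mu\varphi(t)}(f(x_0)-f(x^\star))+\frac{h\,d\,L\,\sigma_*^2}{2}\int_0^t\frac{\psi(s)^2}{b(s)}e^{-2\mu(\varphi(t)-\varphi(s))}\,ds .$$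
   Context: $f_1,\dots,f_N:\mathbb{R}^d\to\mathbb{R}$, $f:=\frac1N\sum_{i=1}^N f_i$, and $x^\star\in\mathbb{R}^d$ is a global minimizer of $f$. A differentiable function $g$ is $L$-smooth if $\|\nabla g(x)-\nabla g(y)\|\le L\|x-y\|$ for all $x,y$. $\|\cdot\|$ is the Euclidean norm and $\|\cdot\|_S$ the spectral norm. The constant $h>0$ is the discretization stepsize. The adjustment function $\psi:[0,\infty)\to[0,1]$ is continuously differentiable, non-increasing, with $\psi(0)=1$; $\varphi(t):=\int_0^t\psi(s)\,ds$. The mini-batch size function $b:[0,\infty)\to(0,\infty)$ is continuously differentiable with $b(t)\ge 1$. The volatility $\sigma_{\mathrm{MB}}(x):=\Sigma_{\mathrm{MB}}(x)^{1/2}$ is the principal (positive semidefinite) square root of $$\Sigma_{\mathrm{MB}}(x):=\frac1N\sum_{i=1}^N(\nabla f(x)-\nabla f_i(x))(\nabla f(x)-\nabla f_i(x))^T .$$ $\{B(t)\}_{t\ge0}$ is a $d$-dimensional Brownian motion on a filtered probability space, and $x_0\in\mathbb{R}^d$ is a deterministic initial condition. *)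

(* Defs.v *)
From mathcomp Require Import all_boot all_order all_algebra.
From mathcomp Require Import all_classical all_reals all_analysis.
Set Implicit Arguments.
Unset Strict Implicit.
Unset Printing Implicit Defensive.
Import Order.TTheory GRing.Theory Num.Theory.
Import numFieldNormedType.Exports.
Local Open Scope classical_set_scope.
Local Open Scope ring_scope.

Section Euclidean.
Context {R : realType} {d : nat}.
Implicit Types (g : 'cV[R]_d -> R) (x v : 'cV[R]_d) (A S : 'M[R]_d).

(* The library norm `|v| on matrices is the sup norm, hence this definition. *)
Definition enorm v : R := Num.sqrt (\sum_i v i 0 ^+ 2).

Definition spectral_norm A : R :=
  sup [set enorm (A *m v) | v in [set v | enorm v <= 1]].

Definition partial (i : 'I_d) g x : R := 'D_(delta_mx i 0) g x.

Definition grad g x : 'cV[R]_d := \col_i partial i g x.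

Fixpoint Ck (k : nat) g : Prop :=
  if k is k'.+1 then
    (forall x, differentiable g x) /\ (forall i, Ck k' (partial i g))
  else continuous g.

Definition bounded_third_derivative g : Prop :=
  exists M : R, forall (i j k : 'I_d) x,
    `|partial i (partial j (partial k g)) x| <= M.

Definition L_smooth (L : R) g : Prop :=
  (forall x, differentiable g x) /\
  (forall x y, enorm (grad g x - grad g y) <= L * enorm (x - y)).

Definition global_minimizer g x : Prop := forall y, g x <= g y.

Definition polyak_lojasiewicz (mu : R) g (xstar : 'cV[R]_d) : Prop :=
  forall x, enorm (grad g x) ^+ 2 >= 2 * mu * (g x - g xstar).

Definition psd A : Prop := A^T = A /\ forall v, 0 <= (v^T *m A *m v) 0 0.

(* S is unique, and exists whenever A is positive semidefinite. *)
Definition principal_sqrt A S : Prop := psd S /\ S *m S = A.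

End Euclidean.

Section Minibatch.
Context {R : realType} {d N : nat}.
Variable fs : 'I_N -> 'cV[R]_d -> R.

Definition favg (x : 'cV[R]_d) : R := N%:R^-1 * \sum_i fs i x.

Definition Sigma_MB (x : 'cV[R]_d) : 'M[R]_d :=
  N%:R^-1 *: \sum_i ((grad favg x - grad (fs i) x) *m
                     (grad favg x - grad (fs i) x)^T).

Definition is_sigma_MB (sigma : 'cV[R]_d -> 'M[R]_d) : Prop :=
  forall x, principal_sqrt (Sigma_MB x) (sigma x).

End Minibatch.

Section Volatility.
Context {R : realType} {d : nat}.
Variable sigma : 'cV[R]_d -> 'M[R]_d.

Definition volatility_norms : set R :=
  range (fun x => spectral_norm (sigma x *m (sigma x)^T)).

Definition sigma_star2 : R := sup volatility_norms.

End Volatility.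

(* Functions on [0, oo) are represented by total functions on R whose values
   at negative arguments are irrelevant: the derivative at 0 is one-sided. *)
Section HalfLine.
Context {R : realType}.

Definition C1_nonneg (g : R -> R) : Prop :=
  exists g' : R -> R, {within `[0, +oo[, continuous g'} /\
    forall t : R, 0 <= t ->
      (g s - g t) / (s - t) @[s --> within `[0, +oo[ t^'] --> g' t.

Definition adjustment_function (psi : R -> R) : Prop :=
  [/\ C1_nonneg psi,
      forall t : R, 0 <= t -> 0 <= psi t <= 1,
      forall s t : R, 0 <= s -> s <= t -> psi t <= psi s
    & psi 0 = 1].

Definition batch_size_function (b : R -> R) : Prop :=
  C1_nonneg b /\ forall t : R, 0 <= t -> 1 <= b t.

Definition phi (psi : R -> R) (t : R) : R :=
  \int[lebesgue_measure]_(s in `[0, t]) psi s.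

End HalfLine.

Section Stochastic.
Context {R : realType} {dT : measure_display} {T : measurableType dT}.
Variable P : probability T R.

Definition filtration (F : R -> set_system T) : Prop :=
  [/\ forall t : R, 0 <= t -> sigma_algebra setT (F t),
      forall t : R, 0 <= t -> F t `<=` measurable
    & forall s t : R, 0 <= s -> s <= t -> F s `<=` F t].

Definition measurable_wrt (G : set_system T) (Y : T -> R) : Prop :=
  forall E : set R, measurable E -> G (Y @^-1` E).

Definition adapted d (F : R -> set_system T) (X : R -> T -> 'cV[R]_d) : Prop :=
  forall t : R, 0 <= t -> forall i, measurable_wrt (F t) (fun w => X t w i 0).

Definition ae_continuous_paths d (X : R -> T -> 'cV[R]_d) : Prop :=
  {ae P, forall w, {within `[0, +oo[, continuous (X ^~ w)}}.

(* The product rule over boxes says at once that B t - B s is independent of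
   F s and has law N(0, (t - s) I_d); the second parameter of normal_prob is
   the standard deviation. *)
Definition brownian_motion d (F : R -> set_system T)
    (B : R -> T -> 'cV[R]_d) : Prop :=
  [/\ adapted F B,
      {ae P, forall w, B 0 w = 0},
      ae_continuous_paths B
    & forall s t : R, 0 <= s -> s < t ->
      forall (A : set T) (E : 'I_d -> set R),
        F s A -> (forall i, measurable (E i)) ->
        P (A `&` [set w | forall i, E i (B t w i 0 - B s w i 0)]) =
        (P A * \prod_(i < d) normal_prob 0 (Num.sqrt (t - s)) (E i))%E].

Definition cvg_in_probability0 (Y : nat -> T -> \bar R) : Prop :=
  forall e : R, 0 < e ->
    P [set w | (e%:E <= `|Y n w|)%E] @[n --> \oo] --> 0%E.

(* The elementary integrands sum_k xi_k 1_]t_k, t_k+1] on [0, t]. *)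
Record simple_process (F : R -> set_system T) (t : R) := SimpleProcess {
  sp_size : nat ;
  sp_time : nat -> R ;
  sp_coef : nat -> T -> R ;
  sp_time_ge0 : 0 <= sp_time 0%N ;
  sp_time_mono : forall k, (k < sp_size)%N -> sp_time k <= sp_time k.+1 ;
  sp_time_le : sp_time sp_size <= t ;
  sp_coef_meas : forall k, (k < sp_size)%N ->
    measurable_wrt (F (sp_time k)) (sp_coef k) ;
  sp_coef_bounded : exists M : R, forall k w, (k < sp_size)%N ->
    `|sp_coef k w| <= M }.

Definition sp_eval F t (H : simple_process F t) (s : R) (w : T) : R :=
  \sum_(k < sp_size H)
    sp_coef H k w * \1_(`]sp_time H k, sp_time H k.+1] : set R) s.

Definition sp_integral F t (H : simple_process F t) (B : R -> T -> R)
    (w : T) : R :=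
  \sum_(k < sp_size H)
    sp_coef H k w * (B (sp_time H k.+1) w - B (sp_time H k) w).

Definition progressively_measurable (F : R -> set_system T)
    (H : R -> T -> R) : Prop :=
  forall t : R, 0 <= t -> forall E : set R, measurable E ->
    <<s [set A `*` C | A in (measurable : set (set R)) & C in F t] >>
      [set z : R * T | 0 <= z.1 <= t /\ E (H z.1 z.2)].

(* I is (a version of) the Ito integral of H against the real Brownian motion
   B over [0, t]: the limit in probability of the integrals of simple
   processes approximating H. *)
Definition is_ito_integral (F : R -> set_system T) (B H : R -> T -> R) (t : R)
    (I : T -> R) : Prop :=
  [/\ progressively_measurable F H,
      {ae P, forall w,
        (\int[lebesgue_measure]_(s in `[0%R, t]) ((H s w) ^+ 2)%:E < +oo)%E},
      measurable_fun setT I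
    & exists Hn : nat -> simple_process F t,
      cvg_in_probability0 (fun n w =>
        \int[lebesgue_measure]_(s in `[0%R, t])
          ((sp_eval (Hn n) s w - H s w) ^+ 2)%:E)%E /\
      cvg_in_probability0 (fun n w => (sp_integral (Hn n) B w - I w)%:E)].

(* dX = drift(t, X) dt + vol(t, X) dB with X(0) = x0; I i j t stands for the
   integral of vol_ij(s, X(s)) against dB_j(s) over [0, t]. *)
Definition sde_solution d (F : R -> set_system T) (B : R -> T -> 'cV[R]_d)
    (drift : R -> 'cV[R]_d -> 'cV[R]_d) (vol : R -> 'cV[R]_d -> 'M[R]_d)
    (x0 : 'cV[R]_d) (X : R -> T -> 'cV[R]_d) : Prop :=
  [/\ adapted F X,
      ae_continuous_paths X,
      {ae P, forall w, X 0 w = x0},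
      forall t : R, 0 <= t -> forall i, {ae P, forall w,
        (lebesgue_measure).-integrable `[0, t]
          (fun s => (drift s (X s w) i 0)%:E)}
    & exists I : 'I_d -> 'I_d -> R -> T -> R,
      (forall (i j : 'I_d) (t : R), 0 <= t ->
         is_ito_integral F (fun s w => B s w j 0)
           (fun s w => vol s (X s w) i j) t (I i j t)) /\
      (forall t : R, 0 <= t -> forall i, {ae P, forall w,
         X t w i 0 = x0 i 0
           + \int[lebesgue_measure]_(s in `[0, t]) drift s (X s w) i 0
           + \sum_j I i j t w})].

Definition mb_pgf_solution d N (fs : 'I_N -> 'cV[R]_d -> R)
    (sigma : 'cV[R]_d -> 'M[R]_d) (psi b : R -> R) (h : R)
    (F : R -> set_system T) (B : R -> T -> 'cV[R]_d) (x0 : 'cV[R]_d)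
    (X : R -> T -> 'cV[R]_d) : Prop :=
  sde_solution F B
    (fun t x => - (psi t *: grad (favg fs) x))
    (fun t x => (psi t * Num.sqrt (h / b t)) *: sigma x)
    x0 X.

End Stochastic.

(* Main.v *)
Require Import Defs.
From mathcomp Require Import all_boot all_order all_algebra.
From mathcomp Require Import all_classical all_reals all_analysis.
From mathcomp Require Import measurable_realfun ring lra.
Set Implicit Arguments.
Unset Strict Implicit.
Unset Printing Implicit Defensive.
Import Order.TTheory GRing.Theory Num.Theory.
Import numFieldNormedType.Exports.
Local Open Scope classical_set_scope.
Local Open Scope ring_scope.

(** Formally the bound is the Ito formula for f(X(t)) followed by Gronwall's
    lemma. The drift contributes - psi |grad f|^2, which the
    Polyak-Lojasiewicz inequality bounds by - 2 mu psi (f - f star). The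
    second-order term is at most L / 2 times the squared Frobenius norm
    h psi^2 / b |sigma|^2 of the volatility, and |sigma|^2 is the trace of
    sigma sigma^T, at most d times its spectral norm.

    The proof works with finite time steps. Over a short step from s to r, the
    quadratic upper bound [descent] plays the part of the second-order
    expansion:
    f(X r) <= f(X s) + <grad f(X s), X r - X s> + L / 2 |X r - X s|^2.
    The increment X r - X s is a drift plus an increment of Ito integrals. In
    expectation the latter is orthogonal to grad f(X s) ([ito_orth]) and its
    square is controlled by the isometry ([ito_energy]); replacing the drift
    by its value at time s costs only O((r - s)^(3/2)). This is [one_step].
    Along a partition of [0, t] into n equal steps, the integrating factor
    e^(2 mu phi) makes the one-step bounds telescope, and the n errors of order
    n^(-3/2) disappear as n grows ([gronwall_limit]).

    Three points need care. The Ito integrals are only given as limits in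
    probability of integrals of simple processes. The volatility being
    bounded, these processes may be clipped at its bound, and then the
    approximations converge in mean square; that the clipped part has a small
    integral follows by stopping it when its energy becomes large ([grid_tail],
    [ito_approx]). The isometry and the orthogonality thus come from those of
    step integrands ([step_isometry], [step_orth]), hence from the first two
    moments of Brownian increments and their independence of the past. Second,
    the second moment of X must be finite on [0, t]: this is obtained over
    short time steps by an argument along each path, where all quantities are
    finite ([moment_step]). Third, the statement speaks of paths that are
    continuous almost surely; a modification on a null event makes all of them
    continuous ([regular_version]), whence joint measurability. *)

(** * Expectations of integrable and square-integrable variables *)

Lemma le_of_eq (disp : Order.disp_t) (V : porderType disp) (x y : V) :
  x = y -> (x <= y)%O.
Proof. by move=> ->. Qed.

Lemma memitvE (R : realType) (I : interval R) r : (r \in [set` I]) = (r \in I).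
Proof. by apply/idP/idP => [/set_mem|h]; [|exact: mem_set]. Qed.

Lemma sqrD_young (R : realType) (e x y : R) : 0 < e ->
  (x + y) ^+ 2 <= (1 + e) * x ^+ 2 + (1 + e^-1) * y ^+ 2.
Proof.
move=> e0; rewrite -subr_ge0.
have -> : (1 + e) * x ^+ 2 + (1 + e^-1) * y ^+ 2 - (x + y) ^+ 2 =
  e^-1 * (e * x - y) ^+ 2 by field; rewrite gt_eqF.
by apply: mulr_ge0; rewrite ?sqr_ge0 // invr_ge0 ltW.
Qed.

Section Expectation.
Context {R : realType} {dT : measure_display} {T : measurableType dT}.
Variable P : probability T R.
Implicit Types (f g X Y Z : T -> R).

Definition integ f := P.-integrable setT (EFin \o f).
Definition Ex f : R := \int[P]_w f w.
Definition sqint f := measurable_fun setT f /\ integ (fun w => f w ^+ 2).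

Lemma integ_meas f : integ f -> measurable_fun setT f.
Proof. by move=> /measurable_int /measurable_EFinP. Qed.

Lemma integ_le g f : measurable_fun setT f -> (forall w, `|f w| <= g w) ->
  integ g -> integ f.
Proof.
move=> mf fg; apply: le_integrable => //; first exact/measurable_EFinP.
by move=> w _ /=; rewrite lee_fin (le_trans (fg w)) // ler_norm.
Qed.

Lemma integD f g : integ f -> integ g -> integ (fun w => f w + g w).
Proof. by move=> hf hg; have := integrableD measurableT hf hg. Qed.

Lemma integZ c f : integ f -> integ (fun w => c * f w).
Proof. by move=> hf; have := integrableZl measurableT c hf. Qed.

Lemma integ_cst c : integ (fun=> c).
Proof. exact: finite_measure_integrable_cst. Qed.

Lemma integ_sum (I : Type) (r : seq I) (F : I -> T -> R) :
  (forall i, integ (F i)) -> integ (fun w => \sum_(i <- r) F i w).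
Proof.
move=> hF; elim: r => [|i r IH].
  by under eq_fun do rewrite big_nil; exact: integ_cst.
by under eq_fun do rewrite big_cons; exact: integD.
Qed.

Lemma integ_bounded M f : measurable_fun setT f -> (forall w, `|f w| <= M) ->
  integ f.
Proof. by move=> mf fM; apply: integ_le mf fM _; exact: integ_cst. Qed.

Lemma ExD f g : integ f -> integ g -> Ex (fun w => f w + g w) = Ex f + Ex g.
Proof. by move=> hf hg; rewrite /Ex RintegralD. Qed.

Lemma ExB f g : integ f -> integ g -> Ex (fun w => f w - g w) = Ex f - Ex g.
Proof. by move=> hf hg; rewrite /Ex RintegralB. Qed.

Lemma ExZ c f : integ f -> Ex (fun w => c * f w) = c * Ex f.
Proof. by move=> hf; rewrite /Ex RintegralZl. Qed.

Lemma Ex_cst c : Ex (fun=> c) = c.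
Proof. by rewrite /Ex Rintegral_cst //= probability_setT mulr1. Qed.

Lemma Ex_sum (I : Type) (r : seq I) (F : I -> T -> R) :
  (forall i, integ (F i)) ->
  Ex (fun w => \sum_(i <- r) F i w) = \sum_(i <- r) Ex (F i).
Proof.
move=> hF; elim: r => [|i r IH].
  by rewrite big_nil; under eq_fun do rewrite big_nil; exact: Ex_cst.
rewrite big_cons -IH -ExD //; last exact: integ_sum.
by congr Ex; apply/funext => w; rewrite big_cons.
Qed.

Lemma Ex_le f g : integ f -> integ g -> (forall w, f w <= g w) -> Ex f <= Ex g.
Proof. by move=> hf hg fg; apply: le_Rintegral. Qed.

Lemma Ex_ge0 f : (forall w, 0 <= f w) -> 0 <= Ex f.
Proof. by move=> f0; apply: Rintegral_ge0. Qed.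

Lemma EFin_Ex f : integ f -> ((Ex f)%:E = \int[P]_w (f w)%:E)%E.
Proof. by move=> hf; rewrite /Ex /Rintegral fineK //; exact: integrable_fin_num. Qed.

Lemma integ_ae f g : measurable_fun setT g -> {ae P, forall w, f w = g w} ->
  integ f -> integ g.
Proof.
move=> mg fg hf; apply/integrableP; split; first exact/measurable_EFinP.
move/integrableP : hf => [mf]; congr (_ < _)%E.
apply: ae_eq_integral => //.
- exact: measurableT_comp.
- by apply: measurableT_comp => //; exact/measurable_EFinP.
- by apply: filterS fg => w /= -> _.
Qed.

Lemma Ex_ae f g : measurable_fun setT f -> measurable_fun setT g ->
  {ae P, forall w, f w = g w} -> Ex f = Ex g.
Proof.
move=> mf mg fg; congr fine.
apply: ae_eq_integral => //; try exact/measurable_EFinP.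
by apply: filterS fg => w /= -> _.
Qed.

Lemma sqint_mul X Y : sqint X -> sqint Y -> integ (fun w => X w * Y w).
Proof.
move=> [mX X2] [mY Y2]; apply: integ_le (integD X2 Y2).
  exact: measurable_funM.
move=> w; rewrite normrM -(real_normK (num_real (X w))).
rewrite -(real_normK (num_real (Y w))).
have := sqr_ge0 (`|X w| - `|Y w|); have := normr_ge0 (X w).
have := normr_ge0 (Y w); nra.
Qed.

Lemma sqintD X Y : sqint X -> sqint Y -> sqint (fun w => X w + Y w).
Proof.
move=> hX hY; split; first exact: measurable_funD hX.1 hY.1.
have := integD (integD hX.2 hY.2) (integZ 2 (sqint_mul hX hY)).
by congr integ; apply/funext => w; ring.
Qed.

Lemma sqintZ c X : sqint X -> sqint (fun w => c * X w).
Proof.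
move=> hX; split; first by apply: measurable_funM => //; exact: hX.1.
have := integZ (c ^+ 2) hX.2.
by congr integ; apply/funext => w; ring.
Qed.

Lemma sqintB X Y : sqint X -> sqint Y -> sqint (fun w => X w - Y w).
Proof.
move=> hX hY; have := sqintD hX (sqintZ (-1) hY).
by congr sqint; apply/funext => w; rewrite mulN1r.
Qed.

Lemma sqint_cst c : sqint (fun=> c).
Proof. by split => //; exact: integ_cst. Qed.

Lemma sqint_bounded M f : measurable_fun setT f -> (forall w, `|f w| <= M) ->
  sqint f.
Proof.
move=> mf fM; split => //; apply: (@integ_bounded (M ^+ 2)).
  exact: measurable_funX.
move=> w; rewrite normrX; apply: lerXn2r => //; rewrite nnegrE //.
by rewrite (le_trans _ (fM w)).
Qed.

Lemma sqint_sum (I : Type) (r : seq I) (F : I -> T -> R) :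
  (forall i, sqint (F i)) -> sqint (fun w => \sum_(i <- r) F i w).
Proof.
move=> hF; elim: r => [|i r IH].
  by under eq_fun do rewrite big_nil; exact: sqint_cst.
by under eq_fun do rewrite big_cons; exact: sqintD.
Qed.

Lemma sqint_integ X : sqint X -> integ X.
Proof.
move=> hX; have := sqint_mul hX (sqint_cst 1).
by congr integ; apply/funext => w; rewrite mulr1.
Qed.

Lemma sqint_boundedM M X Y : measurable_fun setT X ->
  (forall w, `|X w| <= M) -> sqint Y -> sqint (fun w => X w * Y w).
Proof.
move=> mX XM hY; have [mY Y2] := hY.
split; first exact: measurable_funM.
apply: integ_le (integZ (M ^+ 2) Y2).
  by apply: measurable_funX; exact: measurable_funM.
move=> w; rewrite normrX normrM exprMn (real_normK (num_real (Y w))).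
apply: ler_wpM2r; first exact: sqr_ge0.
apply: lerXn2r; rewrite ?nnegrE //.
by rewrite (le_trans _ (XM w)).
Qed.

Lemma sqint_ae X Y : measurable_fun setT Y -> {ae P, forall w, X w = Y w} ->
  sqint X -> sqint Y.
Proof.
move=> mY XY [mX X2]; split => //.
apply: integ_ae X2; first exact: measurable_funX.
by apply: filterS XY => w ->.
Qed.

(** Young's inequality stands in for Cauchy-Schwarz: the free parameter is
    optimised where the bound is used. *)
Lemma Ex_young e X Y : 0 < e -> sqint X -> sqint Y ->
  `|Ex (fun w => X w * Y w)| <=
  (e * Ex (fun w => X w ^+ 2) + e^-1 * Ex (fun w => Y w ^+ 2)) / 2.
Proof.
move=> e0 hX hY.
have key (x y : R) : `|x * y| <= (e * x ^+ 2 + e^-1 * y ^+ 2) / 2.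
  rewrite normrM -(real_normK (num_real x)) -(real_normK (num_real y)).
  have h := sqr_ge0 (e * `|x| - `|y|).
  have -> : (e * `|x| ^+ 2 + e^-1 * `|y| ^+ 2) / 2 =
    e^-1 * (e * `|x| - `|y|) ^+ 2 / 2 + `|x| * `|y|.
    by field; rewrite gt_eqF.
  rewrite lerDr; apply: mulr_ge0 => //; apply: mulr_ge0 => //.
  by rewrite invr_ge0 ltW.
have h1 := integZ (2^-1 * e) hX.2; have h2 := integZ (2^-1 * e^-1) hY.2.
have -> : (e * Ex (fun w => X w ^+ 2) + e^-1 * Ex (fun w => Y w ^+ 2)) / 2 =
   Ex (fun w => 2^-1 * e * X w ^+ 2 + 2^-1 * e^-1 * Y w ^+ 2).
  by rewrite ExD // (ExZ _ hX.2) (ExZ _ hY.2); ring.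
apply: (le_trans (le_normr_Rintegral _ (sqint_mul hX hY))) => //.
apply: Ex_le; [|exact: integD|].
  exact: (integrable_norm (sqint_mul hX hY)).
by move=> w; rewrite (le_trans (key _ _)) //; lra.
Qed.

Lemma Ex_sqrD e X Y : 0 < e -> sqint X -> sqint Y ->
  Ex (fun w => (X w + Y w) ^+ 2) <=
  (1 + e) * Ex (fun w => X w ^+ 2) + (1 + e^-1) * Ex (fun w => Y w ^+ 2).
Proof.
move=> e0 hX hY.
rewrite -(ExZ _ hX.2) -(ExZ _ hY.2) -ExD; [|exact: integZ hX.2|exact: integZ hY.2].
apply: Ex_le; [exact: (sqintD hX hY).2| |].
  by apply: integD; [exact: integZ hX.2|exact: integZ hY.2].
by move=> w; exact: sqrD_young.
Qed.

Lemma Ex_sqr_ge0 X : 0 <= Ex (fun w => X w ^+ 2).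
Proof. by apply: Ex_ge0 => w; exact: sqr_ge0. Qed.

Lemma le_add_eps (x y c : R) : 0 <= c -> (forall e, 0 < e -> x <= y + c * e) -> x <= y.
Proof.
move=> c0 h; apply/ler_addgt0Pr => e e0.
have c1 : 0 < c + 1 by rewrite ltr_wpDl.
apply: (le_trans (h (e / (c + 1)) (divr_gt0 e0 c1))).
rewrite lerD2l mulrA ler_pdivrMr // mulrC ler_pM2l //; lra.
Qed.

End Expectation.

(** * Limits in probability *)

Section LimitInProbability.
Context {R : realType} {dT : measure_display} {T : measurableType dT}.
Variable P : probability T R.
Implicit Types (f g X Y Z : T -> R).

Lemma Ex_indic (A : set T) : measurable A -> (Ex P (\1_A))%:E = P A.
Proof.
move=> mA; rewrite EFin_Ex; last first.
  by apply: (@integ_bounded _ _ _ _ 1) => [|w]; [exact: measurable_indic|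
    rewrite indicE; case: (_ \in _); rewrite ?normr1 ?normr0].
by rewrite integral_indic // setIT.
Qed.

Lemma measurable_ge_norm e Y : measurable_fun setT Y ->
  measurable [set w | (e%:E <= `|(Y w)%:E|)%E].
Proof.
move=> mY; rewrite -[X in measurable X]setTI.
apply: emeasurable_fun_c_infty => //.
by apply: measurableT_comp => //; exact/measurable_EFinP.
Qed.

Definition tail e Y := fine (P [set w | (e%:E <= `|(Y w)%:E|)%E]).

Lemma tail_Ex e Y : measurable_fun setT Y ->
  tail e Y = Ex P (\1_[set w | (e%:E <= `|(Y w)%:E|)%E]).
Proof. by move=> mY; rewrite /tail -Ex_indic //; exact: measurable_ge_norm. Qed.

Lemma cvg_tail (Yn : nat -> T -> R) e : 0 < e ->
  (forall n, measurable_fun setT (Yn n)) ->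
  cvg_in_probability0 P (fun n w => (Yn n w)%:E) ->
  tail e (Yn n) @[n --> \oo] --> 0.
Proof. by move=> e0 mY /(_ e e0) /fine_cvg. Qed.

Lemma indic_integ A : measurable A -> integ P (\1_A).
Proof.
move=> mA; apply: (@integ_bounded _ _ _ _ 1) => [|w].
  exact: measurable_indic.
by rewrite indicE; case: (_ \in _); rewrite ?normr1 ?normr0.
Qed.

Lemma eq_cvg_prob (Yn Zn : nat -> T -> R) : (forall n w, Zn n w = Yn n w) ->
  cvg_in_probability0 P (fun n w => (Yn n w)%:E) ->
  cvg_in_probability0 P (fun n w => (Zn n w)%:E).
Proof.
move=> h; congr cvg_in_probability0.
by apply/funext => n; apply/funext => w; rewrite h.
Qed.

(** Fatou's lemma along convergence in probability; the constant 2 is the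
    price of not extracting an almost surely convergent subsequence. *)
Lemma prob_limit_sqint (Yn : nat -> T -> R) Y (c : R) (n0 : nat) :
  measurable_fun setT Y -> (forall n, sqint P (Yn n)) ->
  (forall n, (n0 <= n)%N -> Ex P (fun w => Yn n w ^+ 2) <= c) ->
  cvg_in_probability0 P (fun n w => (Yn n w - Y w)%:E) ->
  sqint P Y /\ Ex P (fun w => Y w ^+ 2) <= 2 * c.
Proof.
move=> mY hYn hc cv.
have mD n : measurable_fun setT (fun w => Yn n w - Y w).
  by apply: measurable_funB => //; exact: (hYn n).1.
pose Z (k : nat) w := Num.min (Y w ^+ 2) k%:R.
have mZ k : measurable_fun setT (Z k).
  by apply: measurable_minr => //; exact: measurable_funX.
have Z0 k w : 0 <= Z k w by rewrite /Z le_min sqr_ge0 ler0n.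
have iZ k : integ P (Z k).
  apply: (@integ_bounded _ _ _ _ k%:R) => // w.
  by rewrite ger0_norm // /Z ge_min lexx orbT.
have bZ k : Ex P (Z k) <= 2 * c.
  apply: (@le_add_eps _ _ _ (2 + k%:R)); first by rewrite addr_ge0.
  move=> e e0.
  pose d := Num.min 1 e.
  have d0 : 0 < d by rewrite /d lt_min ltr01 e0.
  have d2e : d ^+ 2 <= e.
    have : d <= 1 by rewrite /d ge_min lexx.
    have : d <= e by rewrite /d ge_min lexx orbT.
    by move=> ? ?; rewrite expr2; nra.
  have /cvgrPdist_le/(_ _ e0) [n1 _ hn1] := cvg_tail d0 mD cv.
  pose n := maxn n0 n1.
  have tl : tail d (fun w => Yn n w - Y w) <= e.
    by have := hn1 n (leq_maxr _ _); rewrite sub0r normrN; exact: le_trans (ler_norm _).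
  pose A := [set w | (d%:E <= `|(Yn n w - Y w)%:E|)%E].
  have mA : measurable A by exact: measurable_ge_norm.
  have iA := indic_integ mA.
  have -> : 2 * c + (2 + k%:R) * e = 2 * c + 2 * e + k%:R * e by ring.
  apply: (@le_trans _ _ (Ex P (fun w => 2 * Yn n w ^+ 2 + 2 * e + k%:R * \1_A w))).
    apply: Ex_le => //.
      apply: integD; last exact: integZ.
      by apply: integD; [apply: integZ; exact: (hYn n).2|exact: integ_cst].
    move=> w; rewrite /Z indicE.
    have [wA|wA] := pselect (A w).
      rewrite mem_set //= mulr1 ge_min; apply/orP; right.
      by rewrite lerDr addr_ge0 // mulr_ge0 // ?sqr_ge0 // ltW.
    rewrite memNset //= mulr0 addr0 ge_min; apply/orP; left.
    have : `|Yn n w - Y w| < d.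
      by rewrite ltNge; apply/negP => h; apply: wA; rewrite /A /= lee_fin.
    set u := Yn n w; set v := Y w => h.
    have : (u - v) ^+ 2 <= d ^+ 2.
      rewrite -(real_normK (num_real (u - v))).
      by apply: lerXn2r; rewrite ?nnegrE // ltW.
    have := sqr_ge0 (u * 2 - v); nra.
  have i2 := integZ 2 (hYn n).2.
  rewrite ExD; [|by apply: integD => //; exact: integ_cst|exact: integZ].
  rewrite ExD //; last exact: integ_cst.
  rewrite Ex_cst (ExZ _ iA) (ExZ _ (hYn n).2) -tail_Ex //.
  apply: lerD; last by rewrite ler_wpM2l.
  by rewrite lerD2r ler_wpM2l // hc // leq_maxl.
have key : (\int[P]_w (Y w ^+ 2)%:E <= (2 * c)%:E)%E.
  have cvZ : (\int[P]_w (Z n w)%:E @[n --> \oo] --> \int[P]_w (limn (fun n => (Z n w)%:E)))%E.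
    apply: cvg_monotone_convergence => //.
    - by move=> n; exact/measurable_EFinP.
    - by move=> n w _; rewrite lee_fin.
    - move=> w _ m n mn; rewrite lee_fin /Z le_min !ge_min lexx /=.
      by rewrite ler_nat mn orbT.
  have limE w : limn (fun n => (Z n w)%:E) = (Y w ^+ 2)%:E.
    apply/cvg_lim => //; apply: cvg_near_cst.
    exists (Num.bound `|Y w ^+ 2|) => // n /= hn; rewrite /Z.
    rewrite min_l //; apply: (le_trans (ler_norm _)); apply: ltW.
    by apply: (lt_le_trans (archi_boundP _)) => //; rewrite ler_nat.
  rewrite (eq_integral (fun w => limn (fun n => (Z n w)%:E))); last first.
    by move=> w _; rewrite limE.
  rewrite -(cvg_lim _ cvZ) //; apply: lime_le.
    by apply/cvg_ex; eexists; exact: cvZ.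
  by apply: nearW => n; rewrite -EFin_Ex // lee_fin.
have i2 : integ P (fun w => Y w ^+ 2).
  apply/integrableP; split.
    by apply/measurable_EFinP; exact: measurable_funX.
  apply: (le_lt_trans _ (ltry (2 * c))); apply: le_trans key.
  apply: ge0_le_integral => //=.
  - apply/measurable_EFinP; apply: measurableT_comp => //.
    exact: measurable_funX.
  - by apply/measurable_EFinP; exact: measurable_funX.
  - by move=> w _; rewrite lee_fin ger0_norm // sqr_ge0.
split; first by split.
by rewrite -lee_fin EFin_Ex.
Qed.

(** Fatou's lemma, applied to the differences with a fixed far term. *)
Lemma prob_cauchy_L2 (Yn : nat -> T -> R) Y :
  measurable_fun setT Y -> (forall n, sqint P (Yn n)) ->
  (forall e, 0 < e -> exists n0, forall m n, (n0 <= m)%N -> (n0 <= n)%N ->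
     Ex P (fun w => (Yn m w - Yn n w) ^+ 2) <= e) ->
  cvg_in_probability0 P (fun n w => (Yn n w - Y w)%:E) ->
  sqint P Y /\ Ex P (fun w => (Yn n w - Y w) ^+ 2) @[n --> \oo] --> 0.
Proof.
move=> mY hYn hC cv.
have main e n0 : (forall m n, (n0 <= m)%N -> (n0 <= n)%N ->
     Ex P (fun w => (Yn m w - Yn n w) ^+ 2) <= e) -> forall n, (n0 <= n)%N ->
  sqint P (fun w => Y w - Yn n w) /\
  Ex P (fun w => (Y w - Yn n w) ^+ 2) <= 2 * e.
  move=> h n nn.
  apply: (@prob_limit_sqint (fun m w => Yn m w - Yn n w) _ _ n0).
  - by apply: measurable_funB => //; exact: (hYn n).1.
  - by move=> m; exact: sqintB.
  - by move=> m nm; exact: h.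
  - by apply: eq_cvg_prob cv => m w; rewrite opprB addrA subrK.
split.
  have [n0 h] := hC 1 ltr01.
  have [h1 _] := main 1 n0 h n0 (leqnn _).
  have := sqintD h1 (hYn n0).
  by congr sqint; apply/funext => w; rewrite subrK.
apply/cvgrPdist_le => e e0.
have [n0 h] := hC (e / 2) (divr_gt0 e0 (ltr0n _ 2)).
exists n0 => // n /= nn; rewrite sub0r normrN ger0_norm ?Ex_sqr_ge0 //.
have [_ ] := main _ n0 h n nn.
rewrite mulrCA divff // mulr1; congr (_ <= _).
by congr Ex; apply/funext => w; rewrite -sqrrN opprB.
Qed.

(** Outside an event of small probability the variables are small, and on it
    they are at most [M]. *)
Lemma prob_bounded_Ex (D : nat -> T -> R) M :
  (forall n, measurable_fun setT (D n)) -> (forall n w, 0 <= D n w <= M) ->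
  cvg_in_probability0 P (fun n w => (D n w)%:E) ->
  Ex P (D n) @[n --> \oo] --> 0.
Proof.
move=> mD hD cv.
have M0 : 0 <= M by have /andP[] := hD 0%N point; exact: le_trans.
apply/cvgrPdist_le => e e0.
pose d := e / (M + 1).
have M1 : 0 < M + 1 by rewrite ltr_wpDl.
have d0 : 0 < d by rewrite divr_gt0.
have de : (M + 1) * d = e by rewrite /d mulrC divfK // gt_eqF.
have /cvgrPdist_le/(_ _ d0) [n1 _ hn1] := cvg_tail d0 mD cv.
exists n1 => // n /= nn.
have := hn1 n nn; rewrite sub0r normrN => /(le_trans (ler_norm _)) tl.
rewrite sub0r normrN ger0_norm; last first.
  by apply: Ex_ge0 => w; have /andP[] := hD n w.
pose A := [set w | (d%:E <= `|(D n w)%:E|)%E].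
have mA : measurable A by exact: measurable_ge_norm.
have iA := indic_integ mA.
apply: (@le_trans _ _ (Ex P (fun w => d + M * \1_A w))).
  apply: Ex_le.
  - apply: (@integ_bounded _ _ _ _ M) => // w.
    by have /andP[h1 h2] := hD n w; rewrite ger0_norm.
  - by apply: integD; [exact: integ_cst|exact: integZ].
  - move=> w; rewrite indicE; have /andP[h1 h2] := hD n w.
    have [wA|wA] := pselect (A w).
      by rewrite mem_set //= mulr1; apply: ler_wpDl => //; exact: ltW.
    rewrite memNset //= mulr0 addr0 ltW // ltNge; apply/negP => h.
    by apply: wA; rewrite /A /= lee_fin ger0_norm.
rewrite ExD; [|exact: integ_cst|exact: integZ].
rewrite Ex_cst (ExZ _ iA) -tail_Ex // -de mulrDl mul1r addrC lerD2r.
by rewrite ler_wpM2l.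
Qed.

End LimitInProbability.

(** * Second moments of the normal law *)

Section GaussianMoments.
Context {R : realType}.
Variable s : R.
Hypothesis s0 : s != 0.
Local Notation mu := (@lebesgue_measure R).
Local Notation p := (normal_pdf 0 s).

(** The density is almost everywhere the Radon-Nikodym derivative of the law,
    both having the same integral over every event. *)
Lemma ge0_integral_normal_prob (f : R -> \bar R) :
  (forall x, (0 <= f x)%E) -> measurable_fun setT f ->
  (\int[normal_prob 0 s]_x f x = \int[mu]_x (f x * (p x)%:E))%E.
Proof.
move=> f0 mf.
have dom := normal_prob_dominates (0 : R) s.
rewrite -(Radon_Nikodym_SigmaFinite.change_of_variables dom f0 measurableT mf).
have i1 := Radon_Nikodym_SigmaFinite.f_integrable dom.
apply: ae_eq_integral => //.
- by apply: emeasurable_funM => //; apply: (measurable_int mu).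
- apply: emeasurable_funM => //; apply/measurable_EFinP.
  exact: measurable_normal_pdf.
- apply: ae_eqe_mul2l => /=.
  apply: integral_ae_eq => //=.
  + by apply/measurable_EFinP; exact: measurable_normal_pdf.
  + by move=> E _ mE; rewrite -Radon_Nikodym_SigmaFinite.f_integral.
Qed.

Lemma is_derive_normal_pdf (x : R) :
  is_derive x 1 p (- (x / s ^+ 2) * p x).
Proof.
have -> : p = normal_peak s *: (expR \o (- (s ^+ 2 *+ 2)^-1 *: (id ^+ 2))).
  rewrite normal_pdfE //; apply/funext => y.
  rewrite /normal_fun subr0 /=; congr (_ * expR _).
  by rewrite mulNr mulrC -mulNr; congr (_ * _); rewrite fctE.
apply: is_derive_eq; rewrite -mulr_natr !fctE /GRing.scale /=.
by field; rewrite s0.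
Qed.

Let F c (x : R) : R := - s ^+ 2 * (x + 2 * c) * p x.

(** Up to an explicit primitive, the second moment around [- c] is a multiple
    of the total mass. *)
Lemma is_derive_gauss_primitive c (x : R) :
  is_derive x 1 (F c) (((x + c) ^+ 2 - (s ^+ 2 + c ^+ 2)) * p x).
Proof.
have h := is_derive_normal_pdf x.
have -> : F c = (- s ^+ 2 *: (id + cst (2 * c))) * p.
  by apply/funext => y; rewrite /F !fctE.
apply: is_derive_eq; rewrite !fctE /GRing.scale /=.
by field; rewrite s0.
Qed.

Let cp : continuous p. Proof. exact: continuous_normal_pdf. Qed.

Let csq c : continuous (fun x : R => (x + c) ^+ 2).
Proof.
move=> x; apply: (@continuous_comp _ _ _ (fun y => y + c) (fun y => y ^+ 2)).
  by apply: continuousD; [exact: cvg_id|exact: cvg_cst].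
exact: exprn_continuous.
Qed.

Lemma integral_gauss_segment c (n : nat) : (0 < n)%N ->
  let I := `[(- n%:R)%R, (n%:R : R)] in
  (\int[mu]_(x in [set` I]) (((x + c) ^+ 2) * p x)%:E =
   (s ^+ 2 + c ^+ 2)%:E * \int[mu]_(x in [set` I]) (p x)%:E
   - (2 * s ^+ 2 * n%:R * p n%:R)%:E)%E.
Proof.
move=> n0 I.
have nn : - n%:R < n%:R :> R by rewrite gtrN // ltr0n.
have inte (g : R -> R) : continuous g -> mu.-integrable [set` I] (EFin \o g).
  move=> cg; apply: continuous_compact_integrable.
    exact: segment_compact.
  exact: continuous_subspaceT.
pose q c := fun x => ((x + c) ^+ 2 - (s ^+ 2 + c ^+ 2)) * p x.
have cf : continuous (q c).
  move=> x; apply: cvgM; last exact: cp.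
  by apply: cvgB; [exact: csq|exact: cvg_cst].
have dF : forall x, derivable (F c) x 1.
  by move=> x; have [] := is_derive_gauss_primitive c x.
have cF : continuous (F c).
  by move=> x; apply/differentiable_continuous/derivable1_diffP.
have /= ftc : (\int[mu]_(x in [set` I]) (q c x)%:E = (F c n%:R)%:E - (F c (- n%:R))%:E)%E.
  apply: continuous_FTC2 => //.
  - exact: continuous_subspaceT.
  - split => //.
    + by apply: cvg_at_right_filter; exact: cF.
    + by apply: cvg_at_left_filter; exact: cF.
  - by move=> x _; rewrite derive1E; have [_ ->] := is_derive_gauss_primitive c x.
have pe : p (- n%:R) = p n%:R.
  by rewrite normal_pdfE // /normal_fun !subr0 sqrrN.
have -> : (\int[mu]_(x in [set` I]) (((x + c) ^+ 2) * p x)%:E =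
  \int[mu]_(x in [set` I]) ((q c x)%:E + ((s ^+ 2 + c ^+ 2) * p x)%:E))%E.
  by apply: eq_integral => x _; rewrite -EFinD /q; congr EFin; ring.
rewrite integralD_EFin //; last 2 first.
- exact: inte.
- apply: inte => x; apply: cvgM; last exact: cp.
  exact: cvg_cst.
rewrite ftc /F pe addeC; congr (_ + _)%E; last by congr EFin; ring.
rewrite [in LHS]/comp; under [in LHS]eq_integral do rewrite EFinM.
by rewrite integralZl //; exact: inte.
Qed.

Let symitv n : set R := [set` `[(- n%:R)%R, (n%:R : R)]].

Let bigcup_symitv : \bigcup_n symitv n = setT.
Proof.
rewrite -subTset => x _; exists (Num.bound `|x|) => //=.
rewrite /symitv /= in_itv /= -ler_norml ltW //.
by apply: archi_boundP.
Qed.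

Let cvg_symitv (g : R -> R) : (forall x, 0 <= g x) -> measurable_fun setT g ->
  (\int[mu]_(x in symitv n) (g x)%:E @[n --> \oo] --> \int[mu]_x (g x)%:E)%E.
Proof.
move=> g0 mg; rewrite -bigcup_symitv; apply: ge0_nondecreasing_set_cvg_integral.
- move=> m n mn; apply/subsetPset => x; rewrite /symitv /= !in_itv /= => /andP[h1 h2].
  have : m%:R <= n%:R :> R by rewrite ler_nat.
  by lra.
- by move=> i; exact: measurable_itv.
- by move=> i; apply/measurable_EFinP; apply: measurable_funTS.
- by move=> i x _; rewrite lee_fin.
Qed.

Let cvg_boundary : (2 * s ^+ 2 * n%:R * p n%:R) @[n --> \oo] --> (0 : R).
Proof.
pose K := 8 * s ^+ 4 * normal_peak s.
have hK : K * harmonic n @[n --> \oo] --> (0 : R).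
  by rewrite -(mulr0 K); apply: cvgM; [exact: cvg_cst|exact: cvg_harmonic].
have s2 : 0 < s ^+ 2 by rewrite exprn_even_gt0.
apply: (squeeze_cvgr _ (cvg_cst 0) hK).
exists 1%N => // n /= n0.
have n1 : 0 < n%:R :> R by rewrite ltr0n.
have pk : 0 < normal_peak s by exact: normal_peak_gt0.
apply/andP; split.
  by apply: mulr_ge0; rewrite ?normal_pdf_ge0 // mulr_ge0 // mulr_ge0 // ltW.
rewrite normal_pdfE // /normal_fun subr0 mulNr expRN.
set y := n%:R ^+ 2 / _.
have y0 : 0 < y by apply: divr_gt0; [rewrite exprn_gt0|rewrite pmulrn_lgt0].
have h : (expR y)^-1 <= y^-1.
  rewrite lef_pV2 ?posrE ?expR_gt0 //.
  by rewrite (le_trans _ (expR_ge1Dx y)) // lerDr.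
have h2 : y^-1 = 2 * s ^+ 2 / n%:R ^+ 2.
  by rewrite /y invf_div -mulr_natl.
apply: (@le_trans _ _ (2 * s ^+ 2 * n%:R * (normal_peak s * y^-1))).
  by rewrite ler_pM2l ?ler_pM2l //; apply: mulr_gt0 => //; apply: mulr_gt0.
rewrite h2 /K /harmonic /=.
have -> : 2 * s ^+ 2 * n%:R * (normal_peak s * (2 * s ^+ 2 / n%:R ^+ 2)) =
  4 * s ^+ 4 * normal_peak s * n%:R^-1 by field; rewrite gt_eqF.
have -> : 8 * s ^+ 4 * normal_peak s * n.+1%:R^-1 =
  4 * s ^+ 4 * normal_peak s * (2 * n.+1%:R^-1) by ring.
rewrite ler_pM2l; last by rewrite mulr_gt0 // mulr_gt0 // (exprM s 2 2) exprn_gt0.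
rewrite ler_pdivlMr ?ltr0n // ler_pdivrMl // -natr1.
have : 1 <= n%:R :> R by rewrite ler1n.
lra.
Qed.

(** The shift makes one computation yield both the variance, at [c = 0], and,
    by comparison with [c = 1], the mean. *)
Lemma normal_second_moment c :
  (\int[normal_prob 0 s]_x ((x + c) ^+ 2)%:E = (s ^+ 2 + c ^+ 2)%:E)%E.
Proof.
rewrite ge0_integral_normal_prob; last 2 first.
- by move=> x; rewrite lee_fin sqr_ge0.
- apply/measurable_EFinP; apply: continuous_measurable_fun; exact: csq.
under eq_integral do rewrite -EFinM.
have h1 : (\int[mu]_(x in symitv n) (((x + c) ^+ 2) * p x)%:E @[n --> \oo] -->
   \int[mu]_x (((x + c) ^+ 2) * p x)%:E)%E.
  apply: cvg_symitv => [x|].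
    by rewrite mulr_ge0 ?sqr_ge0 // normal_pdf_ge0.
  apply: measurable_funM; last exact: measurable_normal_pdf.
  by apply: continuous_measurable_fun; exact: csq.
have h2 := cvg_symitv (normal_pdf_ge0 0 s) (measurable_normal_pdf 0 s).
rewrite integral_normal_pdf in h2.
apply/esym/(cvg_unique _ _ h1) => //.
suff : ((s ^+ 2 + c ^+ 2)%:E * \int[mu]_(x in symitv n) (p x)%:E
   - (2 * s ^+ 2 * n%:R * p n%:R)%:E @[n --> \oo] --> (s ^+ 2 + c ^+ 2)%:E * 1%E - 0%:E)%E.
  rewrite mule1 sube0; apply: cvg_trans; apply: near_eq_cvg.
  by exists 1%N => // n /= n0; rewrite integral_gauss_segment.
apply: cvgeB => //.
- apply: cvgeM => //; exact: cvg_cst.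
- by apply: cvg_EFin; [exact: nearW|exact: cvg_boundary].
Qed.

End GaussianMoments.

(** * Independence and Brownian increments *)

Section Independence.
Context {R : realType} {dT : measure_display} {T : measurableType dT}.
Variable P : probability T R.

(** The law of the pair and the product of the laws agree on rectangles, hence
    everywhere; the factorization is then Fubini's theorem. *)
Lemma indep_Ex d1 (T1 : measurableType d1) d2 (T2 : measurableType d2)
    (X : T -> T1) (Y : T -> T2) (f : T1 -> R) (g : T2 -> R) :
  measurable_fun setT X -> measurable_fun setT Y ->
  (forall A B, measurable A -> measurable B ->
     P (X @^-1` A `&` Y @^-1` B) = (P (X @^-1` A) * P (Y @^-1` B))%E) ->
  measurable_fun setT f -> measurable_fun setT g ->
  integ P (fun w => f (X w)) -> integ P (fun w => g (Y w)) ->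
  integ P (fun w => f (X w) * g (Y w)) /\
  Ex P (fun w => f (X w) * g (Y w)) =
    Ex P (fun w => f (X w)) * Ex P (fun w => g (Y w)).
Proof.
move=> mX mY ind mf mg iX iY.
have mXY : measurable_fun setT (fun w => (X w, Y w)) by exact: measurable_fun_pair.
pose X' : {mfun T >-> T1} :=
  MeasurableFun.Pack (MeasurableFun.Class (isMeasurableFun.Build _ _ _ _ _ mX)).
pose Y' : {mfun T >-> T2} :=
  MeasurableFun.Pack (MeasurableFun.Class (isMeasurableFun.Build _ _ _ _ _ mY)).
pose Z' : {mfun T >-> (T1 * T2)%type} :=
  MeasurableFun.Pack (MeasurableFun.Class (isMeasurableFun.Build _ _ _ _ _ mXY)).
pose pX := distribution P X'; pose pY := distribution P Y'.
have prodE S : measurable S -> (pX \x pY)%E S = distribution P Z' S.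
  apply: product_measure_unique => A B mA mB.
  by rewrite /distribution /pushforward /= -ind.
pose h (z : T1 * T2) := f z.1 * g z.2.
have mh : measurable_fun setT h.
  by apply: measurable_funM; apply: measurableT_comp.
have iXe : pX.-integrable setT (EFin \o f).
  by apply: integrable_pushforward => //; exact/measurable_EFinP.
have iYe : pY.-integrable setT (EFin \o g).
  by apply: integrable_pushforward => //; exact/measurable_EFinP.
have iprod : (pX \x pY)%E.-integrable setT (EFin \o h).
  apply/integrable12ltyP; first exact/measurable_EFinP.
  under eq_integral => x _.
    under eq_integral => y _ do rewrite /= /h /= normrM EFinM.
    rewrite ge0_integralZl_EFin //; last first.
      by apply/measurable_EFinP; exact: measurableT_comp.
    over.
  rewrite ge0_integralZr //.
  - by apply: lte_mul_pinfty; [exact: integral_ge0|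
      exact: (integrable_fin_num measurableT (integrable_abse iXe))|
      have /integrableP[] := iYe].
  - by apply/measurable_EFinP; exact: measurableT_comp.
  - exact: integral_ge0.
have iZ : (distribution P Z').-integrable setT (EFin \o h).
  apply/integrableP; split; first exact/measurable_EFinP.
  rewrite (eq_measure_integral (pX \x pY)%E); first by have /integrableP[] := iprod.
  by move=> A mA _; exact/esym/prodE.
have iXY : integ P (fun w => f (X w) * g (Y w)).
  apply/integrableP; split.
    by apply/measurable_EFinP; apply: measurable_funM; exact: measurableT_comp.
  move/integrableP : iZ => [_]; rewrite ge0_integral_distribution //.
  by apply: measurableT_comp => //; exact/measurable_EFinP.
split => //.
apply: EFin_inj; rewrite EFin_Ex // EFinM !EFin_Ex //.
have -> : (\int[P]_w (f (X w) * g (Y w))%:E = \int[distribution P Z']_z (h z)%:E)%E.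
  by rewrite integral_distribution //; exact/measurable_EFinP.
rewrite (eq_measure_integral (pX \x pY)%E); last by move=> A mA _; exact/esym/prodE.
rewrite -integral12_prod_meas1 // /fubini_F.
under eq_integral => x _.
  under eq_integral => y _ do rewrite /h /= EFinM.
  rewrite integralZl //.
  rewrite (integral_distribution (X := Y') _ iY) //; last exact/measurable_EFinP.
  rewrite -(EFin_Ex iY).
  over.
rewrite integralZr //.
by rewrite (integral_distribution (X := X') _ iX) ?EFin_Ex //; exact/measurable_EFinP.
Qed.

End Independence.

Section BrownianIncrements.
Context {R : realType} {dT : measure_display} {T : measurableType dT}.
Variables (P : probability T R) (d : nat).
Variables (F : R -> set_system T) (B : R -> T -> 'cV[R]_d).
Hypotheses (hF : filtration F) (hB : brownian_motion P F B).

Lemma measurable_wrtS s t (Z : T -> R) : 0 <= s -> s <= t ->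
  measurable_wrt (F s) Z -> measurable_wrt (F t) Z.
Proof. by move=> s0 st mZ E mE; have [_ _] := hF; apply; [exact: s0| |exact: mZ]. Qed.

Lemma measurable_wrt_measurable t (Z : T -> R) : 0 <= t ->
  measurable_wrt (F t) Z -> measurable_fun setT Z.
Proof.
move=> t0 mZ _ E mE; rewrite setTI; have [_ h _] := hF.
by apply: (h t t0); exact: mZ.
Qed.

(** Measurability with respect to [F t] is measurability on the type [T]
    equipped with the sigma-algebra [F t], so every closure property of measurable
    functions applies to it. *)
Lemma measurable_wrtP t (Z : T -> R) : 0 <= t ->
  measurable_wrt (F t) Z <->
  measurable_fun setT (Z : g_sigma_algebraType (F t) -> R).
Proof.
move=> t0; have [/(_ t t0) sF _ _] := hF.
split=> [mZ _ E mE|mZ E mE].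
  by rewrite setTI measurable_g_measurableTypeE //; exact: mZ.
have := mZ measurableT E mE.
by rewrite setTI measurable_g_measurableTypeE.
Qed.

Definition incr j s t w := B t w j 0 - B s w j 0.

Lemma B_meas t j : 0 <= t -> measurable_wrt (F t) (fun w => B t w j 0).
Proof. by move=> t0; have [h _ _ _] := hB; exact: h. Qed.

Lemma incr_wrt j s t : 0 <= s -> s <= t -> measurable_wrt (F t) (incr j s t).
Proof.
move=> s0 st; have t0 := le_trans s0 st.
apply/measurable_wrtP => //; apply: measurable_funB; apply/measurable_wrtP => //.
  exact: B_meas.
by apply: (@measurable_wrtS s) => //; exact: B_meas.
Qed.

Lemma incr_meas j s t : 0 <= s -> s <= t -> measurable_fun setT (incr j s t).
Proof.
by move=> s0 st; apply: (@measurable_wrt_measurable t); [exact: le_trans st|exact: incr_wrt].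
Qed.

Variables (s t : R).
Hypotheses (s0 : 0 <= s) (st : s < t).
Let N := normal_prob 0 (Num.sqrt (t - s)).
Let t0 : 0 <= t. Proof. exact: (le_trans s0 (ltW st)). Qed.
Let mI j : measurable_fun setT (incr j s t).
Proof. by apply: incr_meas => //; exact: ltW. Qed.

Let FT : F s setT.
Proof.
have [/(_ s s0) [h0 hC _] _ _] := hF.
by rewrite -(setD0 setT); exact: hC.
Qed.

Lemma incr_rect A j E : F s A -> measurable E ->
  P (A `&` incr j s t @^-1` E) = (P A * N E)%E.
Proof.
move=> FA mE; have [_ _ _ h] := hB.
have mEi (i : 'I_d) : measurable ((fun i => if i == j then E else setT) i : set R).
  by rewrite /=; case: ifP.
have := h s t s0 st A (fun i => if i == j then E else setT) FA mEi.
rewrite (bigD1 j) //= eqxx big1 ?mule1 => [<-|i /negbTE ->]; last first.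
  exact: probability_setT.
congr (P (_ `&` _)); apply/seteqP; split => w /=.
  by move=> hw i; case: eqP => [->|].
by move=> /(_ j); rewrite eqxx.
Qed.

Lemma incr_rect2 A j l E E' : j != l -> F s A -> measurable E -> measurable E' ->
  P (A `&` (incr j s t @^-1` E `&` incr l s t @^-1` E')) = (P A * (N E * N E'))%E.
Proof.
move=> jl FA mE mE'; have [_ _ _ h] := hB.
pose G (i : 'I_d) := if i == j then E else if i == l then E' else setT.
have mG i : measurable (G i) by rewrite /G; case: ifP => //; case: ifP.
have := h s t s0 st A G FA mG.
rewrite (bigD1 j) //= (bigD1 l) //=; last by rewrite eq_sym.
rewrite big1 ?mule1 => [|i /andP[/negbTE h1 /negbTE h2]]; last first.
  by rewrite /G h1 h2; exact: probability_setT.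
rewrite {2 3}/G !eqxx eq_sym (negbTE jl) => <-.
congr (P (_ `&` _)); apply/seteqP; split => w /=.
  by move=> [h1 h2] i; rewrite /G; case: eqP => [->|] //; case: eqP => [->|].
move=> hw; split; first by have := hw j; rewrite /G eqxx.
by have := hw l; rewrite /G eqxx eq_sym (negbTE jl).
Qed.

Lemma incr_law j E : measurable E -> P (incr j s t @^-1` E) = N E.
Proof.
move=> mE; have := incr_rect j FT mE.
by rewrite setTI probability_setT mul1e.
Qed.

Lemma incr_second_moment j c :
  (\int[P]_w ((incr j s t w + c) ^+ 2)%:E = (t - s + c ^+ 2)%:E)%E.
Proof.
have ts : 0 < t - s by rewrite subr_gt0.
have mf : measurable_fun setT (fun x : R => ((x + c) ^+ 2)%:E).
  apply/measurable_EFinP; apply: measurable_funX.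
  exact: measurable_funD.
rewrite -[in RHS](sqr_sqrtr (ltW ts)) -normal_second_moment; last first.
  by rewrite gt_eqF // sqrtr_gt0.
have mI' : measurable_fun setT (incr j s t : T -> measurableTypeR R) by exact: mI.
pose I : {mfun T >-> measurableTypeR R} :=
  MeasurableFun.Pack (MeasurableFun.Class (isMeasurableFun.Build _ _ _ _ _ mI')).
transitivity (\int[distribution P I]_x ((x + c) ^+ 2)%:E)%E.
  by rewrite ge0_integral_distribution // => y; rewrite lee_fin sqr_ge0.
apply: (@eq_measure_integral _ (measurableTypeR R) R setT (normal_prob 0 (Num.sqrt (t - s))) (distribution P I)) => E mE _; exact: incr_law.
Qed.

Lemma incr_sqint j : sqint P (incr j s t).
Proof.
split => //; apply/integrableP; split.
  by apply/measurable_EFinP; exact: measurable_funX.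
under eq_integral => w _ do
  rewrite /= ger0_norm ?sqr_ge0 // -[incr _ _ _ _]addr0.
by rewrite incr_second_moment ltry.
Qed.

Lemma Ex_incr2 j : Ex P (fun w => incr j s t w ^+ 2) = t - s.
Proof.
apply: EFin_inj; rewrite EFin_Ex; last exact: (incr_sqint j).2.
under eq_integral => w _ do rewrite -[incr _ _ _ _]addr0.
by rewrite incr_second_moment expr0n addr0.
Qed.

Lemma Ex_incr j : Ex P (incr j s t) = 0.
Proof.
have h2 := incr_sqint j; have h1 := sqint_integ h2.
have : Ex P (fun w => (incr j s t w + 1) ^+ 2) = t - s + 1.
  apply: EFin_inj; rewrite EFin_Ex; last exact: (sqintD h2 (sqint_cst _ 1)).2.
  by rewrite incr_second_moment expr1n.
have -> : (fun w => (incr j s t w + 1) ^+ 2) =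
  (fun w => incr j s t w ^+ 2 + (2 * incr j s t w + 1)).
  by apply/funext => w; ring.
have i1 : integ P (fun w => 2 * incr j s t w + 1).
  by apply: integD; [exact: integZ|exact: integ_cst].
rewrite (ExD h2.2 i1) Ex_incr2 (ExD (integZ 2 h1)) ?Ex_cst ?(ExZ _ h1) //; last first.
  exact: integ_cst.
lra.
Qed.

(** The identity of [T], read in the sigma-algebra [F s], is a random variable
    independent of [W]; every [F s]-measurable variable is a function of it. *)
Lemma Ex_indep_past d2 (T2 : measurableType d2) (W : T -> T2) (g : T2 -> R)
    (Z : T -> R) :
  measurable_fun setT W ->
  (forall A E, F s A -> measurable E ->
     P (A `&` W @^-1` E) = (P A * P (W @^-1` E))%E) ->
  measurable_fun setT g -> measurable_wrt (F s) Z -> integ P Z ->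
  integ P (fun w => g (W w)) ->
  integ P (fun w => Z w * g (W w)) /\
  Ex P (fun w => Z w * g (W w)) = Ex P Z * Ex P (fun w => g (W w)).
Proof.
move=> mW ind mg mZ iZ ig.
have [/(_ s s0) sF /(_ s s0) Fm _] := hF.
apply: (@indep_Ex _ _ _ P _ (g_sigma_algebraType (F s)) _ _ id W Z g) => //.
- move=> _ A; rewrite measurable_g_measurableTypeE // => FA.
  by rewrite setTI; exact: Fm.
- move=> A E; rewrite measurable_g_measurableTypeE // => FA mE.
  exact: ind.
- exact/measurable_wrtP.
Qed.

Lemma incr_indep1 j (g : R -> R) Z : measurable_fun setT g ->
  measurable_wrt (F s) Z -> integ P Z -> integ P (fun w => g (incr j s t w)) ->
  integ P (fun w => Z w * g (incr j s t w)) /\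
  Ex P (fun w => Z w * g (incr j s t w)) = Ex P Z * Ex P (fun w => g (incr j s t w)).
Proof.
move=> mg mZ iZ ig; apply: Ex_indep_past => // A E FA mE.
by rewrite incr_rect // incr_law.
Qed.

Lemma incr_indep2 j l Z : j != l -> measurable_wrt (F s) Z -> integ P Z ->
  integ P (fun w => Z w * (incr j s t w * incr l s t w)) /\
  Ex P (fun w => Z w * (incr j s t w * incr l s t w)) = 0.
Proof.
move=> jl mZ iZ.
have [ijl Ejl] : integ P (fun w => incr j s t w * incr l s t w) /\
   Ex P (fun w => incr j s t w * incr l s t w) =
   Ex P (incr j s t) * Ex P (incr l s t).
  apply: (@indep_Ex _ _ _ P _ _ _ _ (incr j s t) (incr l s t) id id) => //.
  - move=> A E mA mE; have := incr_rect2 jl FT mA mE.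
    by rewrite setTI probability_setT mul1e !incr_law.
  - by apply: sqint_integ; exact: incr_sqint.
  - by apply: sqint_integ; exact: incr_sqint.
(* The pair is independent of the past on rectangles by assumption, and on
   all events because two finite measures that agree on rectangles are equal. *)
pose W w := (incr j s t w, incr l s t w).
have mW : measurable_fun setT W by exact: measurable_fun_pair.
have := @Ex_indep_past _ _ W (fun z => z.1 * z.2) Z mW _ _ mZ iZ ijl.
rewrite Ejl Ex_incr mul0r mulr0; apply.
  move=> A E FA mE; have [_ /(_ s s0 A FA) mA _] := hF.
  have a0 : 0 <= fine (P A) by exact: fine_ge0.
  pose r : {nonneg R} := NngNum a0.
  pose W' : {mfun T >-> (R * R)%type} :=
    MeasurableFun.Pack (MeasurableFun.Class (isMeasurableFun.Build _ _ _ _ _ mW)).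
  pose m1 : {measure set (R * R)%type -> \bar R} :=
    measure_function_pushforward__canonical__measure_function_Measure
      [the {measure set T -> \bar R} of mrestr P mA] mW.
  pose m2 : {measure set (R * R)%type -> \bar R} := mscale r (distribution P W').
  have PAE : P A = (fine (P A))%:E by rewrite fineK // fin_num_measure.
  have : m1 E = m2 E; last first.
    by rewrite /m1 /m2 /= /pushforward /mscale /mrestr /= setIC -PAE.
  apply: (measure_unique [set C `*` D | C in measurable & D in measurable]
    (fun=> setT)) => //.
  - exact: measurable_prod_measurableType.
  - move=> _ _ [C1 mC1 [D1 mD1 <-]] [C2 mC2 [D2 mD2 <-]].
    exists (C1 `&` C2); first exact: measurableI.
    by exists (D1 `&` D2); [exact: measurableI|rewrite setXI].
  - by move=> _; exists setT => //; exists setT => //; rewrite setXTT.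
  - by rewrite bigcup_const //; exists 0%N.
  - move=> _ [C mC [D mD <-]].
    rewrite /m1 /m2 /= /mscale /distribution /= /pushforward /mrestr /=.
    have -> : W @^-1` (C `*` D) = incr j s t @^-1` C `&` incr l s t @^-1` D by [].
    rewrite setIC incr_rect2 // -PAE; congr (_ * _)%E.
    by have := incr_rect2 jl FT mC mD; rewrite setTI probability_setT mul1e => <-.
  - move=> _; rewrite /m1 /= /pushforward /mrestr.
    by apply: (le_lt_trans (probability_le1 _ _)); rewrite ?ltry // preimage_setT setTI.
by apply: measurable_funM; [exact: measurable_fst|exact: measurable_snd].
Qed.

End BrownianIncrements.

(** * Integrals of step processes *)

Section StepIntegrals.
Context {R : realType} {dT : measure_display} {T : measurableType dT}.
Variables (P : probability T R) (d : nat).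
Variables (F : R -> set_system T) (B : R -> T -> 'cV[R]_d).
Hypotheses (hF : filtration F) (hB : brownian_motion P F B).
Implicit Types (Z : T -> R) (i j l : 'I_d) (a b c e s t : R).

Lemma incr_refl j a w : incr B j a a w = 0.
Proof. exact: subrr. Qed.

Lemma incr_split j a b c w : incr B j a c w = incr B j a b w + incr B j b c w.
Proof. by rewrite /incr [RHS]addrC addrA subrK. Qed.

Lemma incr_sqint_le j a b : 0 <= a -> a <= b -> sqint P (incr B j a b).
Proof.
move=> a0; rewrite le_eqVlt => /orP[/eqP <-|ab]; last exact: (incr_sqint hF hB).
have -> : incr B j a a = fun=> 0 by apply/funext => w; exact: incr_refl.
exact: sqint_cst.
Qed.

Lemma incr_future j a b Z : 0 <= a -> a <= b -> measurable_wrt (F a) Z ->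
  integ P Z ->
  integ P (fun w => Z w * incr B j a b w) /\
  Ex P (fun w => Z w * incr B j a b w) = 0.
Proof.
move=> a0; rewrite le_eqVlt => /orP[/eqP <-|ab] mZ iZ.
  have -> : (fun w => Z w * incr B j a a w) = fun=> 0.
    by apply/funext => w; rewrite incr_refl mulr0.
  by split; [exact: integ_cst|exact: Ex_cst].
have := incr_indep1 hF hB a0 ab (j := j) (g := id) (@measurable_id _ _ _) mZ iZ.
move=> /(_ (sqint_integ (incr_sqint hF hB a0 ab j))) [h1 ->]; split => //.
by rewrite (Ex_incr hF hB a0 ab) mulr0.
Qed.

Lemma incr_same j l a b Z : 0 <= a -> a <= b -> measurable_wrt (F a) Z ->
  integ P Z ->
  Ex P (fun w => Z w * (incr B j a b w * incr B l a b w)) =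
  (j == l)%:R * (b - a) * Ex P Z.
Proof.
move=> a0; rewrite le_eqVlt => /orP[/eqP <-|ab] mZ iZ.
  rewrite subrr mulr0 mul0r -[RHS](Ex_cst P).
  by congr Ex; apply/funext => w; rewrite incr_refl mul0r mulr0.
have [<-|jl] := eqVneq j l.
  have := incr_indep1 hF hB a0 ab (j := j) (g := fun x => x ^+ 2) _ mZ iZ.
  move=> /(_ (exprn_measurable 2)) /(_ (incr_sqint hF hB a0 ab j).2) [_].
  by rewrite (Ex_incr2 hF hB a0 ab) mul1r mulrC => <-.
by rewrite !mul0r; have [_] := incr_indep2 hF hB a0 ab jl mZ iZ.
Qed.

Definition overlap a b c e : R := Num.max 0 (Num.min b e - Num.max a c).

Lemma overlapC a b c e : overlap a b c e = overlap c e a b.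
Proof. by rewrite /overlap (minC b e) (maxC a c). Qed.

Lemma bounded_wrt_sqint a M Z : 0 <= a -> measurable_wrt (F a) Z ->
  (forall w, `|Z w| <= M) -> sqint P Z.
Proof.
move=> a0 mZ bZ; apply: sqint_bounded bZ.
exact: (measurable_wrt_measurable hF a0).
Qed.

Lemma measurable_wrtM a Z Z' : 0 <= a -> measurable_wrt (F a) Z ->
  measurable_wrt (F a) Z' -> measurable_wrt (F a) (fun w => Z w * Z' w).
Proof.
by move=> a0 mZ mZ'; apply/(measurable_wrtP hF) => //;
  apply: measurable_funM; exact/(measurable_wrtP hF).
Qed.

(** Two weighted increments are correlated only through the overlap of their
    time intervals: cut the earlier interval where the later one starts, then
    the longer one where the shorter one ends; every piece but the common one
    multiplies a variable known at its left end. *)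
Lemma Ex_incr_pair j l a b c e (Z Z' : T -> R) M :
  0 <= a -> a <= b -> 0 <= c -> c <= e ->
  measurable_wrt (F a) Z -> measurable_wrt (F c) Z' ->
  (forall w, `|Z w| <= M) -> (forall w, `|Z' w| <= M) ->
  Ex P (fun w => (Z w * incr B j a b w) * (Z' w * incr B l c e w)) =
  (j == l)%:R * overlap a b c e * Ex P (fun w => Z w * Z' w).
Proof.
wlog ac : j l a b c e Z Z' / a <= c.
  move=> h a0 ab c0 ce mZ mZ' bZ bZ'; have [ac|/ltW ca] := leP a c; first exact: h.
  have := h l j c e a b Z' Z ca c0 ce a0 ab mZ' mZ bZ' bZ.
  rewrite eq_sym overlapC.
  have -> : (fun w => Z' w * Z w) = (fun w => Z w * Z' w).
    by apply/funext => w; exact: mulrC.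
  by move=> <-; congr Ex; apply/funext => w; exact: mulrC.
move=> a0 ab c0 ce mZ mZ' bZ bZ'.
have mZc : measurable_wrt (F c) Z by exact: (measurable_wrtS hF a0 ac).
have mZZ : measurable_wrt (F c) (fun w => Z w * Z' w) by exact: measurable_wrtM.
have bZZ w : `|Z w * Z' w| <= M * M.
  by rewrite normrM ler_pM.
have iZZ : integ P (fun w => Z w * Z' w).
  by apply: sqint_integ; exact: (bounded_wrt_sqint c0 mZZ bZZ).
have past b' : a <= b' -> b' <= c ->
    integ P (fun w => (Z w * incr B j a b' w) * (Z' w * incr B l c e w)) /\
    Ex P (fun w => (Z w * incr B j a b' w) * (Z' w * incr B l c e w)) = 0.
  move=> ab' b'c.
  have mW : measurable_wrt (F c) (fun w => Z w * Z' w * incr B j a b' w).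
    apply: measurable_wrtM => //; apply: (measurable_wrtS hF (le_trans a0 ab') b'c).
    exact: (incr_wrt hF hB).
  have iW : integ P (fun w => Z w * Z' w * incr B j a b' w).
    apply: sqint_integ; apply: (@sqint_boundedM _ _ _ _ (M * M)) => //.
      exact: (measurable_wrt_measurable hF c0 mZZ).
    exact: incr_sqint_le.
  have := incr_future l c0 ce mW iW.
  set f := (fun w => _ * incr B l c e w); set g := (fun w => _ * (_ * _)).
  by have -> : f = g by apply/funext => w; rewrite /f /g; ring.
have [bc|/ltW cb] := leP b c.
  rewrite (past b ab bc).2 /overlap max_l ?mulr0 ?mul0r // subr_le0.
  by rewrite ge_min le_max bc orbT.
have common m m' : c <= m -> m <= m' -> forall k k',
    integ P (fun w => Z w * Z' w * (incr B k c m w * incr B k' c m' w)) /\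
    Ex P (fun w => Z w * Z' w * (incr B k c m w * incr B k' c m' w)) =
    (k == k')%:R * (m - c) * Ex P (fun w => Z w * Z' w).
  move=> cm mm' k k'; have m0 := le_trans c0 cm.
  have mZc0 := measurable_wrt_measurable hF c0 mZZ.
  have sq k1 : sqint P (fun w => Z w * Z' w * incr B k1 c m w).
    by apply: (@sqint_boundedM _ _ _ _ (M * M)) => //; exact: incr_sqint_le.
  have mW : measurable_wrt (F m) (fun w => Z w * Z' w * incr B k c m w).
    apply: measurable_wrtM => //; first exact: (measurable_wrtS hF c0 cm).
    exact: (incr_wrt hF hB).
  have [i1 e1] := incr_future k' m0 mm' mW (sqint_integ (sq k)).
  have e2 := incr_same k k' c0 cm mZZ iZZ.
  have i2 := sqint_mul (sq k) (incr_sqint_le k' c0 cm).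
  have -> : (fun w => Z w * Z' w * (incr B k c m w * incr B k' c m' w)) =
    (fun w => Z w * Z' w * incr B k c m w * incr B k' c m w +
       Z w * Z' w * incr B k c m w * incr B k' m m' w).
    by apply/funext => w; rewrite (incr_split k' c m m'); ring.
  split; first exact: integD.
  rewrite ExD // e1 addr0 -e2; congr Ex; apply/funext => w; ring.
have [ip ep] := past c ac (lexx c).
have ovE : overlap a b c e = Num.min b e - c.
  by rewrite /overlap [Num.max a c]max_r // max_r // subr_ge0 le_min cb ce.
rewrite ovE.
have -> : (fun w => Z w * incr B j a b w * (Z' w * incr B l c e w)) =
  (fun w => Z w * incr B j a c w * (Z' w * incr B l c e w) +
    Z w * Z' w * (incr B j c b w * incr B l c e w)).
  by apply/funext => w; rewrite (incr_split j a c b); ring.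
have [be|/ltW eb] := leP b e.
  have [ic ec] := common b e cb be j l.
  by rewrite ExD // ep add0r ec.
have [ic ec] := common e b ce eb l j.
have E : (fun w => Z w * Z' w * (incr B l c e w * incr B j c b w)) =
  (fun w => Z w * Z' w * (incr B j c b w * incr B l c e w)).
  by apply/funext => w; rewrite [X in _ * X]mulrC.
rewrite E in ic ec.
by rewrite ExD // ep add0r ec eq_sym.
Qed.

(** Elementary integrands whose intervals may overlap: unlike partitions, they
    are closed under difference without merging the time grids. *)
Record step := Step {
  step_idx : finType ;
  lo : step_idx -> R ;
  hi : step_idx -> R ;
  coef : step_idx -> T -> R ;
  lo_ge0 : forall k, 0 <= lo k ;
  lo_hi : forall k, lo k <= hi k ;
  coef_wrt : forall k, measurable_wrt (F (lo k)) (coef k) ;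
  coef_bounded : exists M, forall k w, `|coef k w| <= M }.

Definition step_val (G : step) r w : R :=
  \sum_(k : step_idx G) coef k w * \1_(`]lo k, hi k] : set R) r.

Definition step_int (G : step) j w : R :=
  \sum_(k : step_idx G) coef k w * incr B j (lo k) (hi k) w.

Definition step_energy (G G' : step) w : R :=
  \sum_(k : step_idx G) \sum_(k' : step_idx G')
    overlap (lo k) (hi k) (lo k') (hi k') * (coef k w * coef k' w).

Lemma coef_sqint (G : step) (k : step_idx G) : sqint P (coef k).
Proof.
have [M hM] := coef_bounded G.
by apply: (bounded_wrt_sqint (lo_ge0 k) (coef_wrt k)) => w; exact: hM.
Qed.

Lemma coef_incr_sqint (G : step) j (k : step_idx G) :
  sqint P (fun w => coef k w * incr B j (lo k) (hi k) w).
Proof.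
have [M hM] := coef_bounded G.
apply: (@sqint_boundedM _ _ _ _ M); first exact: (coef_sqint k).1.
  by move=> w; exact: hM.
by apply: incr_sqint_le; [exact: lo_ge0|exact: lo_hi].
Qed.

Lemma step_int_sqint G j : sqint P (step_int G j).
Proof. by apply: sqint_sum => k; exact: coef_incr_sqint. Qed.

Lemma step_energy_integ G G' : integ P (step_energy G G').
Proof.
apply: integ_sum => k; apply: integ_sum => k'; apply: integZ.
by apply: sqint_mul; exact: coef_sqint.
Qed.

Lemma measurable_energy_gt G G' c : measurable [set w | c < step_energy G G' w].
Proof.
have -> : [set w | c < step_energy G G' w] = step_energy G G' @^-1` `]c, +oo[.
  by apply/seteqP; split => w /=; rewrite in_itv /= andbT.
by rewrite -[X in measurable X]setTI; exact: (integ_meas (step_energy_integ G G')).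
Qed.

Lemma step_isometry G G' j l :
  Ex P (fun w => step_int G j w * step_int G' l w) =
  (j == l)%:R * Ex P (step_energy G G').
Proof.
have [M hM] := coef_bounded G; have [M' hM'] := coef_bounded G'.
have -> : (fun w => step_int G j w * step_int G' l w) = (fun w =>
   \sum_(k : step_idx G) \sum_(k' : step_idx G')
    (coef k w * incr B j (lo k) (hi k) w) *
    (coef k' w * incr B l (lo k') (hi k') w)).
  apply/funext => w; rewrite /step_int big_distrl /=.
  by apply: eq_bigr => k _; rewrite big_distrr.
have i1 (k : step_idx G) (k' : step_idx G') :
    integ P (fun w => coef k w * incr B j (lo k) (hi k) w *
    (coef k' w * incr B l (lo k') (hi k') w)).
  by apply: sqint_mul; exact: coef_incr_sqint.
have i2 (k : step_idx G) (k' : step_idx G') :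
    integ P (fun w => coef k w * coef k' w).
  by apply: sqint_mul; exact: coef_sqint.
rewrite Ex_sum; last by move=> k; apply: integ_sum => k'; exact: i1.
rewrite /step_energy Ex_sum; last first.
  by move=> k; apply: integ_sum => k'; exact: integZ.
rewrite big_distrr /=; apply: eq_bigr => k _.
rewrite Ex_sum // Ex_sum; last by move=> k'; exact: integZ.
rewrite big_distrr /=; apply: eq_bigr => k' _.
rewrite (ExZ _ (i2 k k')) mulrA.
apply: (@Ex_incr_pair _ _ _ _ _ _ _ _ (Num.max M M')).
- exact: lo_ge0.
- exact: lo_hi.
- exact: lo_ge0.
- exact: lo_hi.
- exact: coef_wrt.
- exact: coef_wrt.
- by move=> w; rewrite le_max hM.
- by move=> w; rewrite le_max hM' orbT.
Qed.

Lemma integral_overlap a b c e :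
  (\int[lebesgue_measure]_r
     (\1_(`]a, b] : set R) r * \1_(`]c, e] : set R) r)%:E = (overlap a b c e)%:E)%E.
Proof.
have -> : (fun r => (\1_(`]a, b] : set R) r * \1_(`]c, e] : set R) r : R)%:E) =
  (fun r => (\1_(`]Num.max a c, Num.min b e] : set R) r : R)%:E).
  apply/funext => r; rewrite !indicE -natrM mulnb; congr ((nat_of_bool _)%:R)%:E.
  by rewrite !memitvE !in_itv /= gt_max le_min andbACA.
rewrite integral_indic // setIT /= lebesgue_measure_itv /= lte_fin /overlap.
case: ltP => h; first by rewrite [Num.max 0 _]max_r ?subr_ge0 ?ltW // EFinB.
by rewrite [Num.max 0 _]max_l // subr_le0.
Qed.

Lemma integrable_indic2 a b c e :
  lebesgue_measure.-integrable setT
    (fun r => (\1_(`]a, b] : set R) r * \1_(`]c, e] : set R) r : R)%:E).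
Proof.
apply/integrableP; split.
  by apply/measurable_EFinP; apply: measurable_funM; exact: measurable_indic.
under eq_integral => r _ do
  rewrite /= ger0_norm ?mulr_ge0 //.
by rewrite integral_overlap ltry.
Qed.

Lemma step_energyE G w :
  (\int[lebesgue_measure]_r ((step_val G r w) ^+ 2)%:E = (step_energy G G w)%:E)%E.
Proof.
pose t k k' r : R := coef (s := G) k w * coef (s := G) k' w *
  (\1_(`]lo k, hi k] : set R) r * \1_(`]lo k', hi k'] : set R) r).
have it k k' : lebesgue_measure.-integrable setT (fun r => (t k k' r)%:E).
  have := integrableZl measurableT (coef k w * coef k' w)
    (integrable_indic2 (lo k) (hi k) (lo k') (hi k')).
  by apply: eq_integrable => // r _; rewrite -EFinM.
under eq_integral => r _.
  have -> : (step_val G r w ^+ 2)%:E = (\sum_k \sum_k' (t k k' r)%:E)%E.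
    rewrite expr2 /step_val big_distrl /= -sumEFin; apply: eq_bigr => k _.
    rewrite big_distrr /= -sumEFin; apply: eq_bigr => k' _.
    by congr EFin; rewrite /t; ring.
  over.
rewrite integral_sum //; last first.
  by move=> k; apply: (integrable_sum measurableT) => k' _.
rewrite /step_energy -sumEFin; apply: eq_bigr => k _.
rewrite integral_sum // -sumEFin; apply: eq_bigr => k' _.
rewrite /t; under eq_integral => r _ do rewrite EFinM.
rewrite integralZl //; last exact: integrable_indic2.
by rewrite integral_overlap -EFinM mulrC.
Qed.

End StepIntegrals.

(** * Restriction and stopping of step processes *)

Section StepOperations.
Context {R : realType} {dT : measure_display} {T : measurableType dT}.
Variables (P : probability T R) (d : nat).
Variables (F : R -> set_system T) (B : R -> T -> 'cV[R]_d).
Hypotheses (hF : filtration F) (hB : brownian_motion P F B).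
Implicit Types (G : step F) (j : 'I_d).

Section Difference.
Variables G G' : step F.
Let lo2 (k : step_idx G + step_idx G') :=
  match k with inl k => lo k | inr k => lo k end.
Let hi2 (k : step_idx G + step_idx G') :=
  match k with inl k => hi k | inr k => hi k end.
Let coef2 (k : step_idx G + step_idx G') :=
  match k with inl k => coef k | inr k => fun w => - coef k w end.

Fact sub_lo_ge0 k : 0 <= lo2 k.
Proof. by case: k => k; exact: lo_ge0. Qed.
Fact sub_lo_hi k : lo2 k <= hi2 k.
Proof. by case: k => k; exact: lo_hi. Qed.
Fact sub_coef_wrt k : measurable_wrt (F (lo2 k)) (coef2 k).
Proof.
case: k => k; first exact: coef_wrt.
apply/(measurable_wrtP hF); first exact: lo_ge0.
apply: measurable_funN; apply/(measurable_wrtP hF); first exact: lo_ge0.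
exact: coef_wrt.
Qed.
Fact sub_coef_bounded : exists M : R, forall k w, `|coef2 k w| <= M.
Proof.
have [M hM] := coef_bounded G; have [M' hM'] := coef_bounded G'.
exists (Num.max M M') => -[k|k] w /=; rewrite le_max.
  by rewrite hM.
by rewrite normrN hM' orbT.
Qed.

Definition step_sub : step F :=
  Step sub_lo_ge0 sub_lo_hi sub_coef_wrt sub_coef_bounded.

Lemma step_val_sub r w : step_val step_sub r w = step_val G r w - step_val G' r w.
Proof.
rewrite /step_val big_sumType /= -sumrN; congr (_ + _).
by apply: eq_bigr => k _; rewrite mulNr.
Qed.

Lemma step_int_sub j w :
  step_int B step_sub j w = step_int B G j w - step_int B G' j w.
Proof.
rewrite /step_int big_sumType /= -sumrN; congr (_ + _).
by apply: eq_bigr => k _; rewrite mulNr.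
Qed.

End Difference.

Section Restriction.
Variables (s : R) (s0 : 0 <= s) (G : step F).

Fact tail_lo_ge0 (k : step_idx G) : 0 <= Num.max s (lo k).
Proof. by rewrite le_max s0. Qed.
Fact tail_lo_hi (k : step_idx G) : Num.max s (lo k) <= Num.max s (hi k).
Proof. by rewrite ge_max !le_max lexx /= lo_hi orbT. Qed.
Fact tail_coef_wrt (k : step_idx G) : measurable_wrt (F (Num.max s (lo k))) (coef k).
Proof.
apply: (measurable_wrtS hF (lo_ge0 k)); last exact: coef_wrt.
by rewrite le_max lexx orbT.
Qed.
End Restriction.

Definition step_after s (s0 : 0 <= s) G : step F :=
  Step (tail_lo_ge0 s0 (G := G)) (tail_lo_hi s (G := G))
    (tail_coef_wrt s (G := G)) (coef_bounded G).

Lemma step_val_after s (s0 : 0 <= s) G r w :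
  step_val (step_after s0 G) r w = if s < r then step_val G r w else 0.
Proof.
rewrite /step_val /=; case: ltP => sr.
  apply: eq_bigr => k _; congr (_ * _); rewrite !indicE !memitvE !in_itv /=.
  by rewrite gt_max sr le_max [r <= s]leNgt sr.
rewrite big1 // => k _; rewrite indicE memitvE in_itv /= gt_max.
by rewrite [s < r]ltNge sr mulr0.
Qed.

(** The part before [s] is what remains after subtracting the part after [s]. *)
Lemma step_val_before s (s0 : 0 <= s) G r w :
  step_val (step_sub G (step_after s0 G)) r w = if s < r then 0 else step_val G r w.
Proof. by rewrite step_val_sub step_val_after; case: ifP => _; rewrite ?subrr ?subr0. Qed.

Section Grid.
Variables (n : nat) (tau : nat -> R).
Hypothesis tau0 : 0 <= tau 0%N.
Hypothesis tauS : forall k, (k < n)%N -> tau k <= tau k.+1.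

Lemma grid_mono k m : (k <= m)%N -> (m <= n)%N -> tau k <= tau m.
Proof.
elim: m => [|m IH]; first by rewrite leqn0 => /eqP ->.
rewrite leq_eqVlt => /orP[/eqP -> //|]; rewrite ltnS => km mn.
by apply: (le_trans (IH km (ltnW mn))); exact: tauS.
Qed.

Lemma grid_ge0 k : (k <= n)%N -> 0 <= tau k.
Proof. by move=> kn; apply: (le_trans tau0); exact: grid_mono. Qed.

Section GridStep.
Variable xi : nat -> T -> R.
Hypothesis xi_wrt : forall k, (k < n)%N -> measurable_wrt (F (tau k)) (xi k).
Hypothesis xi_bnd : exists M : R, forall k w, (k < n)%N -> `|xi k w| <= M.

Fact grid_lo_ge0 (k : 'I_n) : 0 <= tau k.
Proof. by apply: grid_ge0; exact: ltnW. Qed.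
Fact grid_lo_hi (k : 'I_n) : tau k <= tau k.+1.
Proof. exact: tauS. Qed.
Fact grid_coef_wrt (k : 'I_n) : measurable_wrt (F (tau k)) (xi k).
Proof. exact: xi_wrt. Qed.
Fact grid_coef_bounded : exists M : R, forall (k : 'I_n) w, `|xi k w| <= M.
Proof. by have [M hM] := xi_bnd; exists M => k w; exact: hM. Qed.

Definition grid_step : step F :=
  @Step _ _ _ F _ (fun k : 'I_n => tau k) (fun k : 'I_n => tau k.+1)
    (fun k : 'I_n => xi k) grid_lo_ge0 grid_lo_hi grid_coef_wrt grid_coef_bounded.

Lemma overlap_grid (k m : 'I_n) :
  overlap (tau k) (tau k.+1) (tau m) (tau m.+1) =
  (k == m)%:R * (tau k.+1 - tau k).
Proof.
wlog km : k m / (k <= m)%N.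
  move=> h; have [/h //|/ltnW /h] := leqP k m.
  rewrite overlapC => ->; rewrite eq_sym.
  by case: eqP => [->|] //; rewrite !mul0r.
rewrite /overlap; have [<-|kDm] := eqVneq k m.
  by rewrite mul1r minxx maxxx max_r // subr_ge0 tauS.
rewrite mul0r max_l // subr_le0 ge_min le_max; apply/orP; left; apply/orP; right.
apply: grid_mono; last exact: ltnW.
by rewrite ltn_neqAle km andbT.
Qed.

Lemma grid_energy w :
  step_energy grid_step grid_step w =
  \sum_(k < n) xi k w ^+ 2 * (tau k.+1 - tau k).
Proof.
apply: eq_bigr => k _; rewrite (bigD1 k) //= big1 ?addr0 => [|m mk].
  by rewrite overlap_grid eqxx mul1r mulrC expr2.
by rewrite overlap_grid eq_sym (negbTE mk) !mul0r.
Qed.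

End GridStep.

Lemma grid_unique r (k m : 'I_n) : tau k < r <= tau k.+1 ->
  tau m < r <= tau m.+1 -> k = m.
Proof.
wlog km : k m / (k <= m)%N.
  by move=> h; have [/h //|/ltnW /h + h1 h2] := leqP k m; move=> /(_ h2 h1).
move=> /andP[_ h1] /andP[h2 _]; apply/val_inj/eqP; rewrite eqn_leq km /= leqNgt.
apply/negP => lt_km.
have := grid_mono lt_km (ltnW (ltn_ord m)).
by rewrite leNgt (lt_le_trans h2 h1).
Qed.

(** The intervals of a grid are disjoint, so a function vanishing at 0 can be
    applied coefficient by coefficient. *)
Lemma grid_val_map (f : R -> R) (xi : nat -> T -> R) r w : f 0 = 0 ->
  \sum_(k < n) f (xi k w) * \1_(`]tau k, tau k.+1] : set R) r =
  f (\sum_(k < n) xi k w * \1_(`]tau k, tau k.+1] : set R) r).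
Proof.
move=> f0.
have [[k hk]|h] := pselect (exists k : 'I_n, tau k < r <= tau k.+1).
  have z (g : nat -> R) :
      \sum_(k < n) g k * \1_(`]tau k, tau k.+1] : set R) r = g k.
    rewrite (bigD1 k) //= big1 ?addr0 => [|m mk].
      by rewrite indicE memitvE in_itv /= hk mulr1.
    rewrite indicE memitvE in_itv /=; case: (boolP (_ && _)) => hm.
      by rewrite (grid_unique hm hk) eqxx in mk.
    by rewrite mulr0.
  by rewrite (z (fun k => f (xi k w))) (z (fun k => xi k w)).
have z (g : nat -> R) :
    \sum_(k < n) g k * \1_(`]tau k, tau k.+1] : set R) r = 0.
  rewrite big1 // => m _; rewrite indicE memitvE in_itv /=.
  by case: (boolP (_ && _)) => hm; [case: h; exists m|rewrite mulr0].
by rewrite (z (fun k => f (xi k w))) (z (fun k => xi k w)).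
Qed.

Section Stopping.
Variable xi : nat -> T -> R.
Hypothesis xi_wrt : forall k, (k < n)%N -> measurable_wrt (F (tau k)) (xi k).
Hypothesis xi_bnd : exists M : R, forall k w, (k < n)%N -> `|xi k w| <= M.
Variable dlt : R.
Hypothesis dlt0 : 0 < dlt.

Let S k w := \sum_(m < k) xi m w ^+ 2 * (tau m.+1 - tau m).
Let xis k w := xi k w * \1_[set w | S k.+1 w <= dlt] w.

(** The energy [S k.+1] includes the interval that starts at [tau k], but it is
    known at time [tau k] already: stopping before the level [dlt] is exceeded
    does not look into the future. *)
Let S_wrt k : (k < n)%N -> measurable_wrt (F (tau k)) (S k.+1).
Proof.
move=> kn; have t0 := grid_ge0 (ltnW kn).
apply/(measurable_wrtP hF _ t0); apply: measurable_sum => m.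
apply: measurable_funM => //; apply: measurable_funX; apply/(measurable_wrtP hF _ t0).
have mk : (m <= k)%N by rewrite -ltnS.
have mn := leq_ltn_trans mk kn.
apply: (measurable_wrtS hF (grid_ge0 (ltnW mn))); last exact: xi_wrt.
by apply: grid_mono => //; exact: ltnW.
Qed.

Let xis_wrt k : (k < n)%N -> measurable_wrt (F (tau k)) (xis k).
Proof.
move=> kn; have t0 := grid_ge0 (ltnW kn).
apply: (measurable_wrtM hF t0); first exact: xi_wrt.
apply/(measurable_wrtP hF _ t0); apply: measurable_indic.
have /(measurable_wrtP hF _ t0) mS := S_wrt kn.
have -> : [set w | S k.+1 w <= dlt] = S k.+1 @^-1` `]-oo, dlt].
  by apply/seteqP; split => w /=; rewrite in_itv.
by rewrite -[X in measurable X]setTI; apply: mS.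
Qed.

Let xis_le k w : `|xis k w| <= `|xi k w|.
Proof.
rewrite /xis normrM indicE; case: (_ \in _); first by rewrite normr1 mulr1.
by rewrite normr0 mulr0.
Qed.

Let xis_bnd : exists M : R, forall k w, (k < n)%N -> `|xis k w| <= M.
Proof.
by have [M hM] := xi_bnd; exists M => k w kn; exact: (le_trans (xis_le k w) (hM _ _ kn)).
Qed.

Let G := grid_step xi_wrt xi_bnd.
Let Gs := grid_step xis_wrt xis_bnd.

Let S_mono k m w : (k <= m)%N -> (m <= n)%N -> S k w <= S m w.
Proof.
elim: m => [|m IH]; first by rewrite leqn0 => /eqP ->.
rewrite leq_eqVlt => /orP[/eqP -> //|]; rewrite ltnS => km mn.
apply: (le_trans (IH km (ltnW mn))); rewrite /S big_ord_recr /= lerDl.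
by rewrite mulr_ge0 ?sqr_ge0 // subr_ge0 tauS.
Qed.

Let stopped_energy w : step_energy Gs Gs w <= dlt.
Proof.
rewrite grid_energy.
suff : forall k, (k <= n)%N ->
    \sum_(m < k) xis m w ^+ 2 * (tau m.+1 - tau m) <= Num.min dlt (S k w).
  by move=> /(_ n (leqnn _)); rewrite le_min => /andP[].
elim=> [|k IH] kn; first by rewrite /S !big_ord0 le_min lexx ltW.
have {}IH := IH (ltnW kn).
have dt : 0 <= tau k.+1 - tau k by rewrite subr_ge0 tauS.
rewrite big_ord_recr /=; move: IH; rewrite !le_min => /andP[h1 h2].
have xs : xis k w ^+ 2 <= xi k w ^+ 2.
  rewrite -(real_normK (num_real (xis k w))) -(real_normK (num_real (xi k w))).
  by apply: lerXn2r; rewrite ?nnegrE.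
have h3 : \sum_(i < k) xis i w ^+ 2 * (tau i.+1 - tau i) +
    xis k w ^+ 2 * (tau k.+1 - tau k) <= S k.+1 w.
  by rewrite /S big_ord_recr /= lerD // ler_wpM2r.
rewrite h3 andbT; have [Sd|Sd] := leP (S k.+1 w) dlt; first exact: le_trans h3 Sd.
rewrite /xis indicE memNset /= ?mulr0 ?expr0n ?mul0r ?addr0 //.
by apply/negP; rewrite -ltNge.
Qed.

Let stopped_int j w : step_energy G G w <= dlt -> step_int B Gs j w = step_int B G j w.
Proof.
rewrite grid_energy => h; apply: eq_bigr => k _ /=; congr (_ * _).
rewrite /xis indicE mem_set ?mulr1 //=.
by apply: le_trans h; exact: S_mono.
Qed.

(** Stopping the integrand when its energy is about to exceed [dlt] changes
    nothing where the energy is at most [dlt], and the stopped integral has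
    second moment at most [dlt]: integrals are small in probability as soon as
    their energies are. *)
Lemma grid_tail j (e : R) : 0 < e ->
  (P [set w | (e%:E <= `|(step_int B G j w)%:E|)%E] <=
   P [set w | (dlt < step_energy G G w)%R] + (dlt / e ^+ 2)%:E)%E.
Proof.
move=> e0.
pose A := [set w | (e%:E <= `|(step_int B Gs j w)%:E|)%E].
have ms : measurable_fun setT (step_int B Gs j) := (step_int_sqint hF hB Gs j).1.
have mA : measurable A by exact: measurable_ge_norm.
have mE := measurable_energy_gt P hF G G dlt.
apply: (@le_trans _ _ (P ([set w | dlt < step_energy G G w] `|` A))).
  apply: le_measure; rewrite ?inE //.
  - by apply: measurable_ge_norm; exact: (step_int_sqint hF hB G j).1.
  - exact: measurableU.
  - move=> w /= h; have [le|gt] := leP (step_energy G G w) dlt; last by left.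
    by right; rewrite /A /= stopped_int.
apply: (le_trans (measureU2 _ _ _)) => //; rewrite leeD2l //.
have iA : integ P (\1_A) by exact: indic_integ.
apply: (@le_trans _ _ (Ex P (\1_A))%:E); [by rewrite Ex_indic|rewrite lee_fin].
have i2 := (step_int_sqint hF hB Gs j).2.
apply: (@le_trans _ _ (Ex P (fun w => (e ^+ 2)^-1 * step_int B Gs j w ^+ 2))).
  apply: Ex_le => //; first exact: integZ.
  move=> w; rewrite indicE; have [wA|wA] := pselect (A w).
    rewrite mem_set //=; move: wA; rewrite /A /= lee_fin => wA.
    rewrite ler_pdivlMl ?exprn_gt0 // mulr1.
    rewrite -(real_normK (num_real (step_int _ _ _ _))).
    by apply: lerXn2r; rewrite ?nnegrE // ltW.
  by rewrite memNset //= mulr_ge0 ?sqr_ge0 // invr_ge0 sqr_ge0.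
rewrite (ExZ _ i2) mulrC ler_wpM2r ?invr_ge0 ?sqr_ge0 //.
have -> : (fun w => step_int B Gs j w ^+ 2) =
  (fun w => step_int B Gs j w * step_int B Gs j w) by apply/funext => w; exact: expr2.
rewrite (step_isometry hF hB) eqxx mul1r -[leRHS](Ex_cst P).
apply: Ex_le; [exact: step_energy_integ|exact: integ_cst|exact: stopped_energy].
Qed.

End Stopping.
End Grid.
End StepOperations.

(** * Processes in mean square over time and chance *)

Section ProcessNorm.
Context {R : realType} {dT : measure_display} {T : measurableType dT}.
Variable P : probability T R.
Implicit Types u v : R -> T -> R.
Local Notation leb := (@lebesgue_measure R).

Definition jmeas u := measurable_fun setT (fun z : measurableTypeR R * T => u z.1 z.2).

(** The squared norm in which the Ito integral is an isometry. *)
Definition E2 u : \bar R :=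
  (\int[leb \x P]_z ((u z.1 z.2) ^+ 2)%:E)%E.

Lemma jmeas_sqr u : jmeas u ->
  measurable_fun setT (fun z : measurableTypeR R * T => ((u z.1 z.2) ^+ 2)%:E).
Proof. by move=> ju; apply/measurable_EFinP; exact: measurable_funX. Qed.

Lemma jmeas_section u w : jmeas u -> measurable_fun setT (fun r => u r w).
Proof.
move=> ju; apply: (measurableT_comp (f := fun z : measurableTypeR R * T => u z.1 z.2)
  (g := fun r => (r, w))) => //.
Qed.

Lemma jmeasD u v : jmeas u -> jmeas v -> jmeas (fun r w => u r w + v r w).
Proof. by move=> ju jv; exact: measurable_funD. Qed.

Lemma jmeasB u v : jmeas u -> jmeas v -> jmeas (fun r w => u r w - v r w).
Proof. by move=> ju jv; exact: measurable_funB. Qed.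

Lemma jmeasM u v : jmeas u -> jmeas v -> jmeas (fun r w => u r w * v r w).
Proof. by move=> ju jv; exact: measurable_funM. Qed.

Lemma jmeas_time (g : R -> R) : measurable_fun setT g -> jmeas (fun r _ => g r).
Proof. by move=> mg; exact: (measurableT_comp mg (@measurable_fst _ _ _ _)). Qed.

Lemma jmeas_var (g : T -> R) : measurable_fun setT g -> jmeas (fun _ w => g w).
Proof. by move=> mg; exact: (measurableT_comp mg (@measurable_snd _ _ _ _)). Qed.

Lemma E2_ge0 u : (0 <= E2 u)%E.
Proof. by apply: integral_ge0 => z _; rewrite lee_fin sqr_ge0. Qed.

Lemma E2_iter u : jmeas u ->
  E2 u = (\int[P]_w \int[leb]_r ((u r w) ^+ 2)%:E)%E.
Proof.
move=> ju; rewrite /E2 fubini_tonelli2 //; first exact: jmeas_sqr.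
by move=> z; rewrite lee_fin sqr_ge0.
Qed.

Lemma measurable_energy u : jmeas u ->
  measurable_fun setT (fun w => \int[leb]_r ((u r w) ^+ 2)%:E)%E.
Proof.
move=> ju; apply: (measurable_fun_fubini_tonelli_G
  (fun z : measurableTypeR R * T => ((u z.1 z.2) ^+ 2)%:E)) => //.
  exact: jmeas_sqr.
by move=> z; rewrite lee_fin sqr_ge0.
Qed.

Lemma E2_le u v : jmeas u -> jmeas v -> (forall r w, `|u r w| <= `|v r w|) ->
  (E2 u <= E2 v)%E.
Proof.
move=> ju jv uv; apply: ge0_le_integral => //.
- by move=> z _; rewrite lee_fin sqr_ge0.
- exact: jmeas_sqr.
- exact: jmeas_sqr.
- move=> z _; rewrite lee_fin.
  rewrite -(real_normK (num_real (u _ _))) -(real_normK (num_real (v _ _))).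
  by apply: lerXn2r; rewrite ?nnegrE.
Qed.

Lemma E2D (e : R) u v : 0 < e -> jmeas u -> jmeas v ->
  (E2 (fun r w => u r w + v r w)%R <= (1 + e)%:E * E2 u + (1 + e^-1)%:E * E2 v)%E.
Proof.
move=> e0 ju jv.
have e1 : 0 <= 1 + e by rewrite addr_ge0 // ltW.
have e2 : 0 <= 1 + e^-1 by rewrite addr_ge0 // invr_ge0 ltW.
have mu := jmeas_sqr ju; have mv := jmeas_sqr jv.
have p0 u1 (z : measurableTypeR R * T) : (0 <= ((u1 z.1 z.2 : R) ^+ 2)%:E)%E.
  by rewrite lee_fin sqr_ge0.
rewrite /E2 -ge0_integralZl_EFin // -[X in (_ <= _ + X)%E]ge0_integralZl_EFin //.
rewrite -ge0_integralD //; first last.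
- exact: measurable_funeM.
- by move=> z _; rewrite mule_ge0.
- exact: measurable_funeM.
- by move=> z _; rewrite mule_ge0.
apply: ge0_le_integral => //.
- by move=> z _; rewrite lee_fin sqr_ge0.
- exact: (jmeas_sqr (jmeasD ju jv)).
- by apply: emeasurable_funD; exact: measurable_funeM.
- by move=> z _; rewrite -!EFinM -EFinD lee_fin; exact: sqrD_young.
Qed.

Lemma E2B2 u v : jmeas u -> jmeas v ->
  (E2 (fun r w => u r w - v r w)%R <= 2%:E * E2 u + 2%:E * E2 v)%E.
Proof.
move=> ju jv; have jv' : jmeas (fun r w => - v r w) by exact: measurable_funN.
apply: (le_trans (E2D ltr01 ju jv')); rewrite invr1.
have -> : 1 + 1 = 2 :> R by [].
rewrite leeD2l // lee_pmul2l // E2_le // => r w.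
by rewrite normrN.
Qed.

End ProcessNorm.

Section ConvergenceInProbability.
Context {R : realType} {dT : measure_display} {T : measurableType dT}.
Variable P : probability T R.
Implicit Types X Y Z : nat -> T -> R.

Lemma cvg_probP Y : (forall n, measurable_fun setT (Y n)) ->
  (forall e eps, 0 < e -> 0 < eps -> \forall n \near \oo,
     (P [set w | (e%:E <= `|(Y n w)%:E|)%E] <= eps%:E)%E) ->
  cvg_in_probability0 P (fun n w => (Y n w)%:E).
Proof.
move=> mY h e e0; rewrite -[X in X @ _](_ : (fun n => (tail P e (Y n))%:E) = _).
  apply: cvg_EFin; first exact: nearW.
  apply/cvgrPdist_le => eps eps0.
  apply: filterS (h e eps e0 eps0) => n hn.
  have mA := measurable_ge_norm e (mY n).
  rewrite /= sub0r normrN ger0_norm; last by rewrite /tail fine_ge0.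
  have fA := fin_num_measure P _ mA.
  by rewrite -lee_fin /tail (fineK fA).
apply/funext => n.
have fA := fin_num_measure P _ (measurable_ge_norm e (mY n)).
by rewrite /tail (fineK fA).
Qed.

Lemma cvg_prob_near (Y : nat -> T -> \bar R) e eps : 0 < e -> 0 < eps ->
  cvg_in_probability0 P Y ->
  \forall n \near \oo, (P [set w | (e%:E <= `|Y n w|)%E] <= eps%:E)%E.
Proof.
move=> e0 eps0 /(_ e e0) cv.
have /fine_cvgP[fn /cvgrPdist_le/(_ _ eps0) h] := cv.
apply: filterS2 fn h => n fn; rewrite sub0r normrN => h.
by rewrite -(fineK fn) lee_fin (le_trans (ler_norm _)).
Qed.

Lemma cvg_prob_le (X : nat -> T -> R) (Y : nat -> T -> \bar R) :
  (forall n, measurable_fun setT (X n)) -> (forall n, measurable_fun setT (Y n)) ->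
  (forall n w, (`|(X n w)%:E| <= `|Y n w|)%E) ->
  cvg_in_probability0 P Y -> cvg_in_probability0 P (fun n w => (X n w)%:E).
Proof.
move=> mX mY XY cY; apply: cvg_probP => // e eps e0 eps0.
apply: filterS (cvg_prob_near e0 eps0 cY) => n; apply: le_trans.
apply: le_measure; rewrite ?inE.
- exact: measurable_ge_norm.
- rewrite -[X in measurable X]setTI.
  by apply: emeasurable_fun_c_infty => //; exact: measurableT_comp.
- by move=> w /= h; exact: le_trans h (XY n w).
Qed.

Lemma cvg_probB X Y :
  (forall n, measurable_fun setT (X n)) -> (forall n, measurable_fun setT (Y n)) ->
  cvg_in_probability0 P (fun n w => (X n w)%:E) ->
  cvg_in_probability0 P (fun n w => (Y n w)%:E) ->
  cvg_in_probability0 P (fun n w => (X n w - Y n w)%:E).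
Proof.
move=> mX mY cX cY.
have mXY n : measurable_fun setT (fun w => X n w - Y n w) by exact: measurable_funB.
apply: cvg_probP => // e eps e0 eps0.
have e2 : 0 < e / 2 by rewrite divr_gt0.
have p2 : 0 < eps / 2 by rewrite divr_gt0.
apply: filterS2 (cvg_prob_near e2 p2 cX) (cvg_prob_near e2 p2 cY) => n h1 h2.
pose A (Z : T -> R) := [set w | ((e / 2)%:E <= `|(Z w)%:E|)%E].
have mA (Z : T -> R) : measurable_fun setT Z -> measurable (A Z) by move=> mZ; exact: measurable_ge_norm.
apply: (@le_trans _ _ (P (A (X n) `|` A (Y n)))).
  apply: le_measure; rewrite ?inE.
  - exact: measurable_ge_norm.
  - by apply: measurableU; exact: mA.
  - move=> w; rewrite /A /= !lee_fin => h.
    have [h3|h3] := leP (e / 2) `|X n w|; first by left.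
    right; have := ler_normB (X n w) (Y n w); lra.
apply: (le_trans (measureU2 _ (mA _ (mX n)) (mA _ (mY n)))).
by rewrite [eps]splitr EFinD; exact: leeD.
Qed.

End ConvergenceInProbability.

(** * Ito integrals of bounded processes *)

Section ItoIntegral.
Context {R : realType} {dT : measure_display} {T : measurableType dT}.
Variables (P : probability T R) (d : nat).
Variables (F : R -> set_system T) (B : R -> T -> 'cV[R]_d).
Hypotheses (hF : filtration F) (hB : brownian_motion P F B).
Implicit Types (G : step F) (H : R -> T -> R) (j : 'I_d).
Local Notation leb := (@lebesgue_measure R).
Local Notation mono Hn := (@sp_time_mono _ _ _ _ _ Hn).

Lemma jmeas_step G : jmeas (step_val G).
Proof.
apply: measurable_sum => k; apply: (@jmeasM _ _ _ (fun _ w => coef k w)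
  (fun r _ => \1_(`]lo k, hi k] : set R) r)).
  by apply: jmeas_var; exact: (measurable_wrt_measurable hF (lo_ge0 k) (coef_wrt k)).
by apply: jmeas_time; exact: measurable_indic.
Qed.

Lemma E2_step G j : E2 P (step_val G) = (Ex P (fun w => step_int B G j w ^+ 2))%:E.
Proof.
rewrite E2_iter; last exact: jmeas_step.
under eq_integral => w _ do rewrite step_energyE.
rewrite -EFin_Ex; last exact: step_energy_integ.
have -> : (fun w => step_int B G j w ^+ 2) =
  (fun w => step_int B G j w * step_int B G j w) by apply/funext => w; exact: expr2.
by rewrite (step_isometry hF hB) eqxx mul1r.
Qed.

Definition window s t H r w : R := if s < r <= t then H r w else 0.

Lemma jmeas_window s t H : 0 <= s -> 0 <= t -> progressively_measurable F H ->
  jmeas (window s t H).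
Proof.
move=> s0 t0 pH _ E mE; rewrite setTI.
have [/(_ t t0) sF /(_ t t0) Fm _] := hF.
pose D := [set z : measurableTypeR R * T | s < z.1 <= t].
have mD : measurable D.
  have -> : D = `]s, t] `*` setT.
    by apply/seteqP; split => -[r w] /=; rewrite in_itv //= => -[].
  by apply: measurableX.
have mA : measurable [set z : measurableTypeR R * T | 0 <= z.1 <= t /\ E (H z.1 z.2)].
  apply: (smallest_sub _ _ (pH t t0 E mE)).
    exact: sigma_algebra_measurable.
  by move=> _ [A mA [C FC <-]]; apply: measurableX => //; exact: Fm.
have -> : (fun z : measurableTypeR R * T => window s t H z.1 z.2) @^-1` E =
  (D `&` [set z : measurableTypeR R * T | 0 <= z.1 <= t /\ E (H z.1 z.2)]) `|`
  (if 0 \in E then ~` D else set0).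
  apply/seteqP; split => -[r w]; rewrite /window /D /=.
    case: ifP => h hE; [left|right].
      move: (h) => /andP[sr rt]; split => //; split => //.
      by rewrite rt (le_trans s0) // ltW.
    by rewrite mem_set //=; apply/negP; rewrite h.
  move=> [[h [_ hE]]|]; first by rewrite h.
  by case: ifP => // /set_mem E0 /= /negP/negbTE ->.
apply: measurableU; first exact: measurableI.
by case: ifP => _ //; exact: measurableC.
Qed.

Lemma sp_eval_out t (Hn : simple_process F t) r w : ~~ (0 < r <= t) ->
  sp_eval Hn r w = 0.
Proof.
move=> h; rewrite /sp_eval big1 // => k _; rewrite indicE memitvE in_itv /=.
case: (boolP (_ && _)) => [/andP[h1 h2]|_]; last by rewrite mulr0.
case/negP: h; apply/andP; split.
  apply: le_lt_trans h1.
  by apply: (grid_ge0 (sp_time_ge0 Hn) (mono Hn)); exact: ltnW.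
apply: (le_trans h2); apply: le_trans (sp_time_le Hn).
by apply: (grid_mono (mono Hn)).
Qed.

Section Clip.
Variable C : R.
Hypothesis C0 : 0 <= C.

Definition clip (x : R) := Num.max (- C) (Num.min C x).

Lemma clip0 : clip 0 = 0.
Proof. by rewrite /clip min_r // max_r // oppr_le0. Qed.

Lemma clip_bounded x : `|clip x| <= C.
Proof.
rewrite ler_norml /clip le_max lexx /= ge_max ge_min lexx /= andbT.
by rewrite (le_trans _ C0) // oppr_le0.
Qed.

Lemma measurable_clip d' (T' : measurableType d') (f : T' -> R) :
  measurable_fun setT f -> measurable_fun setT (fun x => clip (f x)).
Proof. by move=> mf; apply: measurable_maxr => //; exact: measurable_minr. Qed.

(** Clipping is the metric projection onto [-C, C]. *)
Lemma clip_dist x y : `|y| <= C ->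
  `|clip x - y| <= `|x - y| /\ `|x - clip x| <= `|x - y|.
Proof.
rewrite ler_norml => /andP[y1 y2]; rewrite /clip.
have [h1|h1] := leP C x.
  rewrite max_r; last by rewrite (le_trans _ C0) // oppr_le0.
  by split; rewrite !ger0_norm ?subr_ge0 //; lra.
have [h2|h2] := leP (- C) x; first by split; rewrite ?subrr ?normr0.
by split; rewrite !ler0_norm ?subr_le0 //; lra.
Qed.

Section Clipped.
Variables (t : R) (Hn : simple_process F t).

Let wrt_map (f : R -> R) k : (forall d' (T' : measurableType d') (g : T' -> R),
    measurable_fun setT g -> measurable_fun setT (fun x => f (g x))) ->
  (k < sp_size Hn)%N ->
  measurable_wrt (F (sp_time Hn k)) (fun w => f (sp_coef Hn k w)).
Proof.
move=> mf kn.
have t0 := grid_ge0 (sp_time_ge0 Hn) (mono Hn) (ltnW kn).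
apply/(measurable_wrtP hF _ t0); apply: mf; apply/(measurable_wrtP hF _ t0).
exact: sp_coef_meas.
Qed.

Fact clip_wrt k : (k < sp_size Hn)%N ->
  measurable_wrt (F (sp_time Hn k)) (fun w => clip (sp_coef Hn k w)).
Proof. by apply: wrt_map; exact: measurable_clip. Qed.

Fact rem_wrt k : (k < sp_size Hn)%N ->
  measurable_wrt (F (sp_time Hn k)) (fun w => sp_coef Hn k w - clip (sp_coef Hn k w)).
Proof.
apply: (@wrt_map (fun x => x - clip x)) => d' T' g mg.
by apply: measurable_funB => //; exact: measurable_clip.
Qed.

Fact clip_bnd : exists M : R, forall k w, (k < sp_size Hn)%N ->
  `|clip (sp_coef Hn k w)| <= M.
Proof. by exists C => k w _; exact: clip_bounded. Qed.

Fact rem_bnd : exists M : R, forall k w, (k < sp_size Hn)%N ->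
  `|sp_coef Hn k w - clip (sp_coef Hn k w)| <= M.
Proof.
have [M hM] := sp_coef_bounded Hn; exists (M + C) => k w kn.
by apply: (le_trans (ler_normB _ _)); rewrite lerD ?hM // clip_bounded.
Qed.

Definition clip_step : step F :=
  grid_step (sp_time_ge0 Hn) (mono Hn) clip_wrt clip_bnd.
Definition rem_step : step F :=
  grid_step (sp_time_ge0 Hn) (mono Hn) rem_wrt rem_bnd.

Lemma clip_val r w : step_val clip_step r w = clip (sp_eval Hn r w).
Proof. exact: (grid_val_map (mono Hn) (f := clip) (sp_coef Hn) r w clip0). Qed.

Lemma rem_val r w : step_val rem_step r w = sp_eval Hn r w - clip (sp_eval Hn r w).
Proof.
apply: (grid_val_map (mono Hn) (f := fun x => x - clip x)
  (sp_coef Hn) r w).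
by rewrite clip0 subrr.
Qed.

Lemma clip_rem_int j w :
  sp_integral Hn (fun s w => B s w j 0) w =
  step_int B clip_step j w + step_int B rem_step j w.
Proof.
rewrite /step_int /sp_integral /= -big_split /=; apply: eq_bigr => k _.
by rewrite /incr; ring.
Qed.

End Clipped.

Section Approximation.
Variables (j : 'I_d) (H : R -> T -> R) (t : R) (I : T -> R).
Hypothesis t0 : 0 <= t.
Hypothesis HC : forall r w, 0 <= r -> `|H r w| <= C.
Hypothesis ito : is_ito_integral P F (fun s w => B s w j 0) H t I.

Let Hc := window 0 t H.
Let HcC r w : `|Hc r w| <= C.
Proof.
rewrite /Hc /window; case: ifP => [/andP[r0 _]|_]; last by rewrite normr0.
by apply: HC; exact: ltW.
Qed.
Let jHc : jmeas Hc.
Proof. by have [pH _ _ _] := ito; exact: jmeas_window. Qed.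

Let jsp (Hn : simple_process F t) : jmeas (sp_eval Hn).
Proof.
have -> : sp_eval Hn = (fun r w => step_val (clip_step Hn) r w + step_val (rem_step Hn) r w).
  by apply/funext => r; apply/funext => w; rewrite clip_val rem_val; ring.
by apply: jmeasD; exact: jmeas_step.
Qed.

Let dist_whole (Hn : simple_process F t) w :
  (\int[leb]_(s in `[0%R, t]) ((sp_eval Hn s w - H s w) ^+ 2)%:E =
   \int[leb]_s ((sp_eval Hn s w - Hc s w) ^+ 2)%:E)%E.
Proof.
have jd : measurable_fun setT (fun s => ((sp_eval Hn s w - Hc s w) ^+ 2)%:E).
  apply/measurable_EFinP; apply: measurable_funX.
  exact: (jmeas_section w (jmeasB (jsp Hn) jHc)).
have E : {in `]0, t]%classic, (fun s => ((sp_eval Hn s w - Hc s w) ^+ 2)%:E) =1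
    (fun s => ((sp_eval Hn s w - H s w) ^+ 2)%:E)}.
  by move=> s /set_mem /=; rewrite in_itv /= /Hc /window => ->.
rewrite -integral_itv_obnd_cbnd; last first.
  apply: (eq_measurable_fun _ E); exact: measurable_funTS.
rewrite integral_mkcond; apply: eq_integral => s _; rewrite patchE.
rewrite memitvE in_itv /=; case: ifPn => h; first by rewrite /Hc /window h.
by rewrite sp_eval_out // /Hc /window (negbTE h) subrr expr0n.
Qed.

(** Clipping the given approximations at the bound of [H] brings them closer
    to [H] and turns their convergence in probability into convergence in mean
    square. The discarded parts have small energies, hence small integrals, in
    probability, so the integrals of the clipped approximations still tend to
    [I]; being Cauchy in mean square by the isometry, they do so in mean
    square. *)
Lemma ito_approx : exists Gn : nat -> step F,
  [/\ sqint P I,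
      Ex P (fun w => (step_int B (Gn n) j w - I w) ^+ 2) @[n --> \oo] --> 0 &
      (E2 P (fun r w => step_val (Gn n) r w - Hc r w)%R @[n --> \oo] --> 0%E)].
Proof.
have [pH _ mI [Hn [cvH cvI]]] := ito.
pose Y n w := (\int[leb]_s ((sp_eval (Hn n) s w - Hc s w) ^+ 2)%:E)%E.
have mY n : measurable_fun setT (Y n) by exact: (measurable_energy (jmeasB (jsp (Hn n)) jHc)).
have Y0 n w : (0 <= Y n w)%E by apply: integral_ge0 => r _; rewrite lee_fin sqr_ge0.
have cvY : cvg_in_probability0 P Y.
  by move: cvH; congr cvg_in_probability0; apply/funext => n; apply/funext => w;
    exact: dist_whole.
pose Gn n := clip_step (Hn n); pose Rn n := rem_step (Hn n).
have le2 (f g : R -> R) : measurable_fun setT f -> measurable_fun setT g ->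
    (forall r, `|f r| <= `|g r|) ->
    (\int[leb]_r ((f r) ^+ 2)%:E <= \int[leb]_r ((g r) ^+ 2)%:E)%E.
  move=> mf mg fg; apply: ge0_le_integral => //.
  - by move=> r _; rewrite lee_fin sqr_ge0.
  - by apply/measurable_EFinP; exact: measurable_funX.
  - by apply/measurable_EFinP; exact: measurable_funX.
  - move=> r _; rewrite lee_fin -(real_normK (num_real (f r))) -(real_normK (num_real (g r))).
    by apply: lerXn2r; rewrite ?nnegrE.
have energyR n w : ((step_energy (Rn n) (Rn n) w)%:E <= Y n w)%E.
  rewrite -step_energyE; apply: le2.
  - exact: (jmeas_section w (jmeas_step (Rn n))).
  - exact: (jmeas_section w (jmeasB (jsp (Hn n)) jHc)).
  - by move=> r; rewrite rem_val; apply: (clip_dist _ (HcC r w)).2.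
pose D n w := (\int[leb]_s ((step_val (Gn n) s w - Hc s w) ^+ 2)%:E)%E.
have jD n := jmeasB (jmeas_step (Gn n)) jHc.
have mD n : measurable_fun setT (D n) by exact: (measurable_energy (jD n)).
have D0 n w : (0 <= D n w)%E by apply: integral_ge0 => r _; rewrite lee_fin sqr_ge0.
have DY n w : (D n w <= Y n w)%E.
  apply: le2.
  - exact: (jmeas_section w (jD n)).
  - exact: (jmeas_section w (jmeasB (jsp (Hn n)) jHc)).
  - by move=> r; rewrite clip_val; apply: (clip_dist _ (HcC r w)).1.
pose M := (2 * C) ^+ 2 * t.
have DM n w : (D n w <= M%:E)%E.
  apply: (@le_trans _ _ (\int[leb]_s ((2 * C) ^+ 2 * \1_(`]0, t] : set R) s)%:E)%E).
    apply: ge0_le_integral => //.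
    - by move=> r _; rewrite lee_fin sqr_ge0.
    - apply/measurable_EFinP; apply: measurable_funX.
      exact: (jmeas_section w (jD n)).
    - by apply/measurable_EFinP; apply: measurable_funM => //; exact: measurable_indic.
    - move=> r _; rewrite lee_fin indicE memitvE in_itv /=.
      case: (boolP (_ && _)) => h; last first.
        by rewrite clip_val sp_eval_out // clip0 /Hc /window (negbTE h) subrr expr0n mulr0.
      rewrite mulr1 -(real_normK (num_real (_ - _))).
      apply: lerXn2r; rewrite ?nnegrE ?mulr_ge0 //.
      apply: (le_trans (ler_normB _ _)); rewrite mulr2n mulrDl mul1r lerD //.
      by rewrite clip_val clip_bounded.
  under eq_integral => r _ do rewrite EFinM.
  rewrite ge0_integralZl_EFin //; [|by apply/measurable_EFinP; exact: measurable_indic|exact: sqr_ge0].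
  rewrite integral_indic // setIT /= lebesgue_measure_itv /= lte_fin.
  case: ltP => [_|h]; first by rewrite -EFinB subr0 /M EFinM.
  by rewrite mule0 lee_fin /M mulr_ge0 // sqr_ge0.
have Dfin n w : D n w \is a fin_num.
  by rewrite ge0_fin_numE // (le_lt_trans (DM n w)) // ltry.
pose Dr n w := fine (D n w).
have mDr n : measurable_fun setT (Dr n).
  by apply: (measurableT_comp (fine_measurable measurableT)).
have DrE n : E2 P (fun r w => step_val (Gn n) r w - Hc r w) = (Ex P (Dr n))%:E.
  rewrite E2_iter // EFin_Ex; last first.
    apply: (@integ_bounded _ _ _ _ M) => // w.
    by rewrite ger0_norm ?fine_ge0 // -lee_fin /Dr fineK.
  by apply: eq_integral => w _; rewrite /Dr fineK.
have cvD : Ex P (Dr n) @[n --> \oo] --> 0.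
  apply: (@prob_bounded_Ex _ _ _ _ _ M) => //.
    by move=> n w; rewrite -!lee_fin /Dr fineK // D0 DM.
  apply: (cvg_prob_le mDr mY _ cvY) => n w.
  by rewrite /Dr fineK // !gee0_abs.
have mR n : measurable_fun setT (step_int B (Rn n) j) := (step_int_sqint hF hB (Rn n) j).1.
have cvR : cvg_in_probability0 P (fun n w => (step_int B (Rn n) j w)%:E).
  apply: cvg_probP => // e eps e0 eps0.
  pose dlt := e ^+ 2 * (eps / 2).
  have dlt0 : 0 < dlt by rewrite mulr_gt0 ?exprn_gt0 // divr_gt0.
  have p2 : 0 < eps / 2 by rewrite divr_gt0.
  apply: filterS (cvg_prob_near dlt0 p2 cvY) => n hn.
  apply: (le_trans (grid_tail hF hB (sp_time_ge0 (Hn n)) (mono (Hn n))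
    (rem_wrt (Hn := Hn n)) (rem_bnd (Hn n)) dlt0 j e0)).
  have -> : dlt / e ^+ 2 = eps / 2 by rewrite /dlt mulrC mulKf // gt_eqF // exprn_gt0.
  rewrite [in leRHS](splitr eps) EFinD leeD2r //.
  apply: le_trans hn; apply: le_measure; rewrite ?inE.
  - exact: (measurable_energy_gt P hF).
  - rewrite -[X in measurable X]setTI.
    by apply: emeasurable_fun_c_infty => //; exact: measurableT_comp.
  - move=> w /= h; rewrite gee0_abs //; apply: le_trans (energyR n w).
    by rewrite lee_fin ltW.
have sqJ n : sqint P (step_int B (Gn n) j) by exact: step_int_sqint.
have msp n : measurable_fun setT
    (fun w => sp_integral (Hn n) (fun s w => B s w j 0) w - I w).
  under eq_fun do rewrite clip_rem_int.
  have h : measurable_fun setT (fun w => step_int B (Gn n) j w + step_int B (Rn n) j w).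
    exact: measurable_funD (sqJ n).1 (mR n).
  exact: measurable_funB h mI.
have cvJ : cvg_in_probability0 P (fun n w => (step_int B (Gn n) j w - I w)%:E).
  apply: (eq_cvg_prob _ (cvg_probB msp mR cvI cvR)) => n w.
  by rewrite clip_rem_int; ring.
have [|sqI cvL2] := prob_cauchy_L2 mI sqJ _ cvJ; last first.
  exists Gn; split => //.
  under eq_fun do rewrite DrE.
  by apply: cvg_EFin => //; exact: nearW.
move=> e e0.
have e4 : 0 < e / 4 by rewrite divr_gt0.
have /cvgrPdist_le/(_ _ e4) [n0 _ hn0] := cvD.
have sm n : (n0 <= n)%N -> Ex P (Dr n) <= e / 4.
  move=> nn; have := hn0 n nn; move: (Ex P (Dr n)) => x.
  by rewrite sub0r normrN; exact: (le_trans (ler_norm _)).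
exists n0 => m n nm nn; rewrite -lee_fin.
have -> : (fun w => (step_int B (Gn m) j w - step_int B (Gn n) j w) ^+ 2) =
  (fun w => step_int B (step_sub hF (Gn m) (Gn n)) j w ^+ 2).
  by apply/funext => w; rewrite step_int_sub.
rewrite -E2_step.
have -> : step_val (step_sub hF (Gn m) (Gn n)) =
  (fun r w => (step_val (Gn m) r w - Hc r w) - (step_val (Gn n) r w - Hc r w)).
  by apply/funext => r; apply/funext => w; rewrite step_val_sub; ring.
apply: (le_trans (E2B2 P (jD m) (jD n))).
rewrite (DrE m) (DrE n).
move: (sm m nm) (sm n nn); move: (Ex P (Dr m)) (Ex P (Dr n)) => x y hx hy.
by rewrite -!EFinM -EFinD lee_fin; lra.
Qed.

End Approximation.
End Clip.
End ItoIntegral.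

(** * Increments of Ito integrals *)

Section ItoIncrement.
Context {R : realType} {dT : measure_display} {T : measurableType dT}.
Variables (P : probability T R) (d : nat).
Variables (F : R -> set_system T) (B : R -> T -> 'cV[R]_d).
Hypotheses (hF : filtration F) (hB : brownian_motion P F B).
Local Notation leb := (@lebesgue_measure R).
Variables (C s t : R).
Hypotheses (C0 : 0 <= C) (s0 : 0 <= s) (st : s <= t).
Let t0 : 0 <= t. Proof. exact: le_trans st. Qed.
Local Notation ito j H t I := (is_ito_integral P F (fun r w => B r w j 0) H t I).

(** The integrals up to [s] and up to [t] come with unrelated approximations.
    Cut the one for [t] at [s]: the part after [s] is the sought [K], and the
    part before [s] is close in energy, hence by the isometry in integral, to
    the approximation for [s]. *)
Lemma ito_increment (j : 'I_d) (H : R -> T -> R) (Is It : T -> R) :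
  (forall r w, 0 <= r -> `|H r w| <= C) -> ito j H s Is -> ito j H t It ->
  sqint P (fun w => It w - Is w) /\
  forall e, 0 < e -> exists K : step F,
  [/\ (forall k : step_idx K, s <= lo k),
      Ex P (fun w => (step_int B K j w - (It w - Is w)) ^+ 2) <= e &
      (E2 P (fun r w => step_val K r w - window s t H r w)%R <= e%:E)%E].
Proof.
move=> HC hs ht.
have [G [sqt cvt ct]] := ito_approx hF hB C0 t0 HC ht.
have [G' [sqs cvs cs]] := ito_approx hF hB C0 s0 HC hs.
have sqI : sqint P (fun w => It w - Is w) by exact: sqintB.
split => // e e0.
have [pH _ _ _] := ht.
have jc a : 0 <= a -> jmeas (window 0 a H) by move=> a0; exact: (jmeas_window hF).
(* Three squared errors enter with weight 3 each; two are at most e / 24 and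
   the third at most 4 (e / 24). *)
have e12 : 0 < e / 24 by rewrite divr_gt0.
have near_e (u : nat -> \bar R) : (forall n, 0 <= u n)%E -> (u n @[n --> \oo] --> 0%E) ->
    \forall n \near \oo, (u n <= (e / 24)%:E)%E.
  move=> u0 /fine_cvgP[fu /cvgrPdist_le/(_ _ e12) hu].
  apply: filterS2 fu hu => n fn; rewrite /= sub0r normrN => h.
  by rewrite -(fineK fn) lee_fin (le_trans (ler_norm _)).
have near_r (u : nat -> R) : (u n @[n --> \oo] --> 0) ->
    \forall n \near \oo, u n <= e / 24.
  move=> /cvgrPdist_le/(_ _ e12); apply: filterS => n.
  by rewrite sub0r normrN; exact: (le_trans (ler_norm _)).
have [n [[h1 h2] [h3 h4]]] := @filter_ex _ _ _ _
  (filterI (filterI (near_r _ cvt) (near_r _ cvs))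
    (filterI (near_e _ (fun n => E2_ge0 P _) ct) (near_e _ (fun n => E2_ge0 P _) cs))).
pose K := step_after hF s0 (G n); pose hd := step_sub hF (G n) K.
have jK : jmeas (window s t H) by exact: (jmeas_window hF).
exists K; split.
- by move=> k /=; rewrite le_max lexx.
- pose c w := step_int B (step_sub hF hd (G' n)) j w.
  have sqc : sqint P c by exact: (step_int_sqint hF hB).
  have c_small : Ex P (fun w => c w ^+ 2) <= 4 * (e / 24).
    rewrite -lee_fin -(E2_step hF hB).
    have -> : step_val (step_sub hF hd (G' n)) =
      (fun r w => (step_val hd r w - window 0 s H r w) - (step_val (G' n) r w - window 0 s H r w)).
      by apply/funext => r; apply/funext => w; rewrite step_val_sub; ring.
    have jh := jmeasB (jmeas_step hF hd) (jc s s0).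
    have jg := jmeasB (jmeas_step hF (G' n)) (jc s s0).
    have jG := jmeasB (jmeas_step hF (G n)) (jc t t0).
    apply: (le_trans (E2B2 P jh jg)).
    have hle : (E2 P (fun r w => step_val hd r w - window 0 s H r w)%R <= (e / 24)%:E)%E.
      apply: le_trans h3; apply: E2_le => // r w.
      rewrite step_val_before /window; case: ltP => sr.
        by rewrite andbF subrr normr0.
      by rewrite (le_trans sr st) !andbT.
    apply: (@le_trans _ _ (2%:E * (e / 24)%:E + 2%:E * (e / 24)%:E)%E).
      by apply: leeD; rewrite lee_pmul2l.
    by rewrite -!EFinM -EFinD lee_fin; lra.
  pose a w := step_int B (G n) j w - It w; pose b w := step_int B (G' n) j w - Is w.
  have sqa : sqint P a by apply: sqintB => //; exact: (step_int_sqint hF hB).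
  have sqb : sqint P b by apply: sqintB => //; exact: (step_int_sqint hF hB).
  have -> : (fun w => (step_int B K j w - (It w - Is w)) ^+ 2) =
    (fun w => ((a w - b w) - c w) ^+ 2).
    by apply/funext => w; rewrite /a /b /c !step_int_sub; ring.
  have i3 := integD (integD (integZ 3 sqa.2) (integZ 3 sqb.2)) (integZ 3 sqc.2).
  apply: (@le_trans _ _ (Ex P (fun w => 3 * a w ^+ 2 + 3 * b w ^+ 2 + 3 * c w ^+ 2))).
    apply: Ex_le => //; first exact: (sqintB (sqintB sqa sqb) sqc).2.
    move=> w; move: (a w) (b w) (c w) => x y z /=; rewrite -subr_ge0.
    have -> : 3 * x ^+ 2 + 3 * y ^+ 2 + 3 * z ^+ 2 - (x - y - z) ^+ 2 =
      (x + y) ^+ 2 + (x + z) ^+ 2 + (y - z) ^+ 2 by ring.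
    by rewrite !addr_ge0 ?sqr_ge0.
  rewrite ExD; [|by apply: integD; [exact: integZ sqa.2|exact: integZ sqb.2]|exact: integZ sqc.2].
  rewrite ExD; [|exact: integZ sqa.2|exact: integZ sqb.2].
  rewrite (ExZ _ sqa.2) (ExZ _ sqb.2) (ExZ _ sqc.2).
  have := h1; have := h2; have := c_small.
  rewrite -/(a _) -/(b _).
  move: (Ex P (fun w => c w ^+ 2)) => z hz.
  change (Ex P (fun w => b w ^+ 2) <= e / 24 -> Ex P (fun w => a w ^+ 2) <= e / 24 ->
    3 * Ex P (fun w => a w ^+ 2) + 3 * Ex P (fun w => b w ^+ 2) + 3 * z <= e).
  move: (Ex P (fun w => a w ^+ 2)) (Ex P (fun w => b w ^+ 2)) => x y; lra.
- apply: (@le_trans _ _ (e / 24)%:E); last by rewrite lee_fin; lra.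
  apply: le_trans h3; apply: E2_le.
  + exact: jmeasB (jmeas_step hF K) jK.
  + exact: jmeasB (jmeas_step hF (G n)) (jc t t0).
  + move=> r w; rewrite step_val_after /window; case: ltP => sr /=.
      by rewrite (le_lt_trans s0 sr).
    by rewrite subrr normr0.
Qed.

(** Each increment of [B] starts after [s], so it is orthogonal to the product
    of [Z] and its coefficient. *)
Lemma step_orth (j : 'I_d) (K : step F) (Z : T -> R) :
  (forall k : step_idx K, s <= lo k) -> measurable_wrt (F s) Z -> sqint P Z ->
  Ex P (fun w => Z w * step_int B K j w) = 0.
Proof.
move=> hK mZ sqZ.
pose Zk k w := Z w * coef (s := K) k w.
have mZk k : measurable_wrt (F (lo k)) (Zk k).
  apply: (measurable_wrtM hF (lo_ge0 k)); last exact: coef_wrt.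
  exact: (measurable_wrtS hF s0 (hK k)).
have iZk k : integ P (Zk k) by apply: sqint_mul => //; exact: (coef_sqint P hF).
have h k := incr_future hF hB j (lo_ge0 k) (lo_hi k) (mZk k) (iZk k).
have -> : (fun w => Z w * step_int B K j w) =
  (fun w => \sum_k Zk k w * incr B j (lo k) (hi k) w).
  apply/funext => w; rewrite /step_int big_distrr /=.
  by apply: eq_bigr => k _; rewrite mulrA.
rewrite Ex_sum; last by move=> k; exact: (h k).1.
by rewrite big1 // => k _; exact: (h k).2.
Qed.

(** The martingale property of the Ito integral, tested against [Z]. *)
Lemma ito_orth (j : 'I_d) (H : R -> T -> R) (Is It : T -> R) (Z : T -> R) :
  (forall r w, 0 <= r -> `|H r w| <= C) -> ito j H s Is -> ito j H t It ->
  measurable_wrt (F s) Z -> sqint P Z ->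
  Ex P (fun w => Z w * (It w - Is w)) = 0.
Proof.
move=> HC hs ht mZ sqZ; have [sqI h] := ito_increment HC hs ht.
pose Y w := It w - Is w.
apply/eqP; rewrite -normr_eq0 eq_le normr_ge0 andbT.
apply: (@le_add_eps _ _ _ (Ex P (fun w => Z w ^+ 2) + 1)).
  by rewrite addr_ge0 // Ex_sqr_ge0.
move=> e e0; have e2 : 0 < e ^+ 2 by rewrite exprn_gt0.
have [K [hK hn _]] := h _ e2.
have sqK := step_int_sqint hF hB K j.
have -> : Ex P (fun w => Z w * (It w - Is w)) =
  - Ex P (fun w => Z w * (step_int B K j w - (It w - Is w))).
  under [in RHS]eq_fun do rewrite mulrBr.
  rewrite ExB; [|exact: sqint_mul|exact: sqint_mul].
  by rewrite (step_orth j hK mZ sqZ) sub0r opprK.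
rewrite normrN (le_trans (Ex_young e0 sqZ (sqintB sqK sqI))) //.
have h1 : e^-1 * Ex P (fun w => (step_int B K j w - (It w - Is w)) ^+ 2) <= e.
  by rewrite ler_pdivrMl // -expr2.
have := Ex_sqr_ge0 P Z => h2.
have := mulr_ge0 h2 (ltW e0); lra.
Qed.

Lemma sqr_sum_le (m : nat) (x : 'I_m -> R) :
  (\sum_j x j) ^+ 2 <= m%:R * \sum_j x j ^+ 2.
Proof.
rewrite expr2 big_distrl /=.
have -> : m%:R * \sum_j x j ^+ 2 = \sum_j \sum_l 2^-1 * (x j ^+ 2 + x l ^+ 2).
  have E j : \sum_l 2^-1 * (x j ^+ 2 + x l ^+ 2) =
      2^-1 * (m%:R * x j ^+ 2 + \sum_l x l ^+ 2).
    by rewrite -mulr_sumr big_split /= sumr_const card_ord mulr_natl.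
  under [RHS]eq_bigr => j _ do rewrite E.
  rewrite -mulr_sumr big_split /= sumr_const card_ord -mulr_sumr -[_ *+ m]mulr_natl.
  by field.
apply: ler_sum => j _; rewrite big_distrr /=; apply: ler_sum => l _.
have := sqr_ge0 (x j - x l); nra.
Qed.

(** Integrals against distinct components of the Brownian motion are
    orthogonal, so the isometry gives the sum of the energies of all entries,
    which is the squared Frobenius norm integrated over time and chance. *)
Lemma ito_energy (m : nat) (H : 'I_m -> 'I_d -> R -> T -> R)
    (Is It : 'I_m -> 'I_d -> T -> R) (Gam : R -> R) :
  (forall i j r w, 0 <= r -> `|H i j r w| <= C) ->
  (forall i j, ito j (H i j) s (Is i j)) -> (forall i j, ito j (H i j) t (It i j)) ->
  (forall r w, s < r <= t -> \sum_i \sum_j H i j r w ^+ 2 <= Gam r) ->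
  leb.-integrable `]s, t] (EFin \o Gam) ->
  \sum_i Ex P (fun w => (\sum_j (It i j w - Is i j w)) ^+ 2) <=
  \int[leb]_(r in `]s, t]) Gam r.
Proof.
move=> HC hs ht HG iG.
pose G := \int[leb]_(r in `]s, t]) Gam r.
pose c i j := window s t (H i j).
have jc i j : jmeas (c i j).
  by have [pH _ _ _] := ht i j; exact: (jmeas_window hF).
have mG : measurable_fun setT (Gam \_ `]s, t]).
  apply/(measurable_restrictT _ _).1 => //.
  by move/measurable_int/measurable_EFinP : iG.
have sumc : (\sum_i \sum_j E2 P (c i j) <= G%:E)%E.
  have -> : G%:E = (\int[leb \x P]_z (((Gam \_ `]s, t]) z.1)%:E))%E.
    rewrite fubini_tonelli1.
    - rewrite /fubini_F /=.
      under eq_integral => r _ do rewrite integral_cst //= probability_setT mule1.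
      rewrite /G /Rintegral fineK; last exact: integrable_fin_num.
      by rewrite integral_mkcond; apply: eq_integral => r _; rewrite restrict_EFin.
    - by apply/measurable_EFinP; exact: (jmeas_time (T := T) mG).
    - move=> z; rewrite lee_fin patchE; case: ifPn => //; rewrite inE /= in_itv /= => h.
      apply: le_trans (HG z.1 z.2 h); apply: sumr_ge0 => i _; apply: sumr_ge0 => j _.
      exact: sqr_ge0.
  under eq_bigr => i _.
    rewrite -ge0_integral_sum //; last 2 first.
    - by move=> j; exact: (jmeas_sqr (jc i j)).
    - by move=> j z _; rewrite lee_fin sqr_ge0.
    over.
  rewrite -ge0_integral_sum //; last 2 first.
  - by move=> i; apply: emeasurable_sum => j; exact: (jmeas_sqr (jc i j)).
  - by move=> i z _; apply: sume_ge0 => j _; rewrite lee_fin sqr_ge0.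
  apply: ge0_le_integral => //.
  - move=> z _; apply: sume_ge0 => i _; apply: sume_ge0 => j _; rewrite lee_fin; exact: sqr_ge0.
  - apply: emeasurable_sum => i; apply: emeasurable_sum => j; exact: (jmeas_sqr (jc i j)).
  - by apply/measurable_EFinP; exact: (jmeas_time (T := T) mG).
  - move=> z _.
    under eq_bigr => i _ do rewrite sumEFin.
    rewrite sumEFin lee_fin patchE memitvE in_itv /= /c /window.
    case: ifP => h; first exact: HG.
    by rewrite big1 // => i _; rewrite big1 // => j _; rewrite expr0n.
have G0 : 0 <= G.
  rewrite -lee_fin; apply: le_trans sumc; apply: sume_ge0 => i _; apply: sume_ge0 => j _.
  exact: E2_ge0.
have cfin i j : E2 P (c i j) \is a fin_num.
  rewrite ge0_fin_numE ?E2_ge0 // (le_lt_trans _ (ltry G)) //; apply: le_trans sumc.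
  rewrite (bigD1 i) //= (bigD1 j) //= -addeA leeDl //.
  by apply: adde_ge0; apply: sume_ge0 => *; [|apply: sume_ge0 => *]; exact: E2_ge0.
pose cr i j := fine (E2 P (c i j)).
have sumcr : \sum_i \sum_j cr i j <= G.
  rewrite -lee_fin -sumEFin; apply: le_trans sumc; apply: le_of_eq.
  apply: eq_bigr => i _; rewrite -sumEFin; apply: eq_bigr => j _.
  by rewrite /cr fineK.
(* The terms that vanish with e, collected for e <= 1. *)
pose D : R := 4 * m%:R * d%:R + 2 * m%:R * d%:R ^+ 2.
have D0 : 0 <= D by rewrite addr_ge0 // !mulr_ge0 // exprn_ge0.
suff main e : 0 < e -> e <= 1 ->
    \sum_i Ex P (fun w => (\sum_j (It i j w - Is i j w)) ^+ 2) <=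
    (1 + e) * ((1 + e) * G) + D * e.
  apply: (@le_add_eps _ _ _ (3 * G + D)); first by rewrite addr_ge0 // mulr_ge0.
  move=> e e0; pose e' := Num.min e 1.
  have e'0 : 0 < e' by rewrite lt_min e0 ltr01.
  have e'1 : e' <= 1 by rewrite ge_min lexx orbT.
  have e'e : e' <= e by rewrite ge_min lexx.
  apply: (le_trans (main e' e'0 e'1)).
  apply: (@le_trans _ _ (G + (3 * G + D) * e')); last first.
    by rewrite lerD2l ler_wpM2l // addr_ge0 // mulr_ge0.
  have : e' * (e' * G) <= e' * G.
    by rewrite ler_pM2l // -[leRHS]mul1r ler_wpM2r.
  lra.
move=> e0 e1.
have e2 : 0 < e ^+ 2 by rewrite exprn_gt0.
have ex i j := (ito_increment (HC i j) (hs i j) (ht i j)).2 _ e2.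
have sqI i j := (ito_increment (HC i j) (hs i j) (ht i j)).1.
pose K i j := sval (cid (ex i j)).
have KP i j : Ex P (fun w => (step_int B (K i j) j w - (It i j w - Is i j w)) ^+ 2) <= e ^+ 2 /\
    (E2 P (fun r w => step_val (K i j) r w - window s t (H i j) r w)%R <= (e ^+ 2)%:E)%E.
  by rewrite /K; case: cid => /= k [].
have ee : (1 + e^-1) * e ^+ 2 <= 2 * e.
  have -> : (1 + e^-1) * e ^+ 2 = e * e + e by field; rewrite gt_eqF.
  have : e * e <= e * 1 by rewrite ler_pM2l.
  lra.
have ei0 : 0 <= 1 + e^-1 by rewrite addr_ge0 // invr_ge0 ltW.
have energyK i j : Ex P (fun w => step_int B (K i j) j w ^+ 2) <= (1 + e) * cr i j + 2 * e.
  rewrite -lee_fin -(E2_step hF hB).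
  have jd := jmeasB (jmeas_step hF (K i j)) (jc i j).
  have -> : step_val (K i j) = (fun r w => c i j r w + (step_val (K i j) r w - c i j r w)).
    by apply/funext => r; apply/funext => w; rewrite addrC subrK.
  apply: (le_trans (E2D P e0 (jc i j) jd)).
  rewrite [leRHS]EFinD [in leRHS]EFinM [in leRHS]/cr fineK //; apply: leeD => //.
  apply: (@le_trans _ _ ((1 + e^-1)%:E * (e ^+ 2)%:E)%E); last by rewrite -EFinM lee_fin.
  by apply: lee_wpmul2l; [rewrite lee_fin|exact: (KP i j).2].
have sqK i j := step_int_sqint hF hB (K i j) j.
apply: (@le_trans _ _ (\sum_i ((1 + e) * \sum_j ((1 + e) * cr i j + 2 * e) +
  (2 * d%:R ^+ 2 * e)))).
  apply: ler_sum => i _.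
  pose S w := \sum_j step_int B (K i j) j w.
  pose V w := \sum_j ((It i j w - Is i j w) - step_int B (K i j) j w).
  have sqS : sqint P S by apply: sqint_sum => j.
  have sqV : sqint P V by apply: sqint_sum => j; exact: sqintB.
  have -> : (fun w => (\sum_j (It i j w - Is i j w)) ^+ 2) = (fun w => (S w + V w) ^+ 2).
    apply/funext => w; congr (_ ^+ 2); rewrite /S /V -big_split /=.
    by apply: eq_bigr => j _; ring.
  apply: (le_trans (Ex_sqrD e0 sqS sqV)); apply: lerD.
    rewrite ler_pM2l ?addr_gt0 //.
    have -> : Ex P (fun w => S w ^+ 2) = \sum_j Ex P (fun w => step_int B (K i j) j w ^+ 2).
      have -> : (fun w => S w ^+ 2) = (fun w => \sum_j \sum_l
          step_int B (K i j) j w * step_int B (K i l) l w).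
        apply/funext => w; rewrite expr2 /S big_distrl /=.
        by apply: eq_bigr => j _; rewrite big_distrr.
      have ijl j l : integ P (fun w => step_int B (K i j) j w * step_int B (K i l) l w).
        exact: sqint_mul.
      rewrite Ex_sum; last by move=> j; exact: integ_sum.
      apply: eq_bigr => j _; rewrite Ex_sum // (bigD1 j) //= big1 ?addr0 => [|l lj].
        by congr Ex; apply/funext => w; rewrite expr2.
      by rewrite (step_isometry hF hB) eq_sym (negbTE lj) mul0r.
    by apply: ler_sum => j _; exact: energyK.
  have VE : Ex P (fun w => V w ^+ 2) <= d%:R ^+ 2 * e ^+ 2.
    have sqd j : sqint P (fun w => (It i j w - Is i j w) - step_int B (K i j) j w).
      exact: sqintB.
    have isum : integ P (fun w => \sum_j ((It i j w - Is i j w) - step_int B (K i j) j w) ^+ 2).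
      by apply: integ_sum => j; exact: (sqd j).2.
    apply: (@le_trans _ _ (Ex P (fun w => d%:R *
        \sum_j ((It i j w - Is i j w) - step_int B (K i j) j w) ^+ 2))).
      apply: Ex_le; [exact: sqV.2|exact: integZ|].
      by move=> w; exact: sqr_sum_le.
    rewrite (ExZ _ isum) Ex_sum; last by move=> j; exact: (sqd j).2.
    rewrite [d%:R ^+ 2]expr2 -mulrA ler_wpM2l //.
    apply: (@le_trans _ _ (\sum_(j < d) e ^+ 2)).
      apply: ler_sum => j _; apply: le_trans (KP i j).1.
      apply: le_of_eq; congr Ex; apply/funext => w.
      by rewrite -sqrrN opprB.
    by rewrite sumr_const card_ord -[_ *+ d]mulr_natl.
  apply: (le_trans (ler_wpM2l ei0 VE)).
  have := ler_wpM2l (sqr_ge0 (d%:R : R)) ee; lra.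
rewrite big_split /= -mulr_sumr sumr_const card_ord -[_ *+ m]mulr_natl.
have -> : \sum_i \sum_j ((1 + e) * cr i j + 2 * e) =
  (1 + e) * \sum_i \sum_j cr i j + m%:R * (d%:R * (2 * e)).
  under eq_bigr => i _ do rewrite big_split /= -mulr_sumr sumr_const card_ord -[_ *+ d]mulr_natl.
  by rewrite big_split /= -mulr_sumr sumr_const card_ord -[_ *+ m]mulr_natl.
have h1 : (1 + e) * ((1 + e) * \sum_i \sum_j cr i j) <= (1 + e) * ((1 + e) * G).
  by rewrite ler_pM2l ?addr_gt0 // ler_pM2l ?addr_gt0.
have h2 : e * (m%:R * d%:R * e) <= 1 * (m%:R * d%:R * e).
  by rewrite ler_wpM2r // mulr_ge0 ?mulr_ge0 // ltW.
rewrite /D mulrDr; lra.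
Qed.

End ItoIncrement.

(** * Smooth functions on Euclidean space *)

Section EuclideanGeometry.
Context {R : realType} {d : nat}.
Implicit Types (x y v u : 'cV[R]_d) (g : 'cV[R]_d -> R).

Definition dotv u v : R := \sum_i u i 0 * v i 0.

Lemma enorm_sqr v : enorm v ^+ 2 = \sum_i v i 0 ^+ 2.
Proof. by rewrite /enorm sqr_sqrtr // sumr_ge0 // => i _; exact: sqr_ge0. Qed.

Lemma enorm_ge0 v : 0 <= enorm v.
Proof. exact: sqrtr_ge0. Qed.

Lemma enorm_eq0 v : enorm v = 0 -> forall i, v i 0 = 0.
Proof.
move=> h i; have : \sum_i v i 0 ^+ 2 = 0 by rewrite -enorm_sqr h expr0n.
move=> /eqP; rewrite psumr_eq0 => [|k _]; last exact: sqr_ge0.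
by move=> /allP/(_ i (mem_index_enum _)); rewrite sqrf_eq0 => /eqP.
Qed.

Lemma cauchy_schwarz u v : dotv u v <= enorm u * enorm v.
Proof.
have [u0|un0] := eqVneq (enorm u) 0.
  by rewrite u0 mul0r /dotv big1 // => i _; rewrite (enorm_eq0 u0) mul0r.
have [v0|vn0] := eqVneq (enorm v) 0.
  by rewrite v0 mulr0 /dotv big1 // => i _; rewrite (enorm_eq0 v0) mulr0.
set a := enorm u in un0 *; set b := enorm v in vn0 *.
have a0 : 0 < a by rewrite lt_neqAle eq_sym un0 enorm_ge0.
have b0 : 0 < b by rewrite lt_neqAle eq_sym vn0 enorm_ge0.
have : 0 <= \sum_i (b * u i 0 - a * v i 0) ^+ 2.
  by apply: sumr_ge0 => i _; exact: sqr_ge0.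
have -> : \sum_i (b * u i 0 - a * v i 0) ^+ 2 =
   b ^+ 2 * \sum_i u i 0 ^+ 2 + a ^+ 2 * \sum_i v i 0 ^+ 2 - 2 * a * b * dotv u v.
  rewrite /dotv !mulr_sumr -big_split -sumrB /=; apply: eq_bigr => i _; ring.
rewrite -!enorm_sqr -/a -/b.
have -> : b ^+ 2 * a ^+ 2 + a ^+ 2 * b ^+ 2 - 2 * a * b * dotv u v =
  2 * a * b * (a * b - dotv u v) by ring.
by rewrite pmulr_rge0 ?subr_ge0 // !mulr_gt0.
Qed.

Lemma enormD u v : enorm (u + v) <= enorm u + enorm v.
Proof.
rewrite -(ler_pXn2r (n := 2)) ?nnegrE ?addr_ge0 ?enorm_ge0 //.
rewrite sqrrD !enorm_sqr.
have -> : \sum_i (u + v) i 0 ^+ 2 =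
    \sum_i u i 0 ^+ 2 + (dotv u v) *+ 2 + \sum_i v i 0 ^+ 2.
  rewrite /dotv -mulr_natl mulr_sumr -!big_split /=; apply: eq_bigr => i _.
  by rewrite mxE; ring.
by rewrite lerD2r lerD2l lerMn2r cauchy_schwarz.
Qed.

Lemma enormZ c v : enorm (c *: v) = `|c| * enorm v.
Proof.
rewrite /enorm; under eq_bigr => i _ do rewrite mxE exprMn.
by rewrite -mulr_sumr sqrtrM ?sqr_ge0 // sqrtr_sqr.
Qed.

Lemma enorm0 : enorm (0 : 'cV[R]_d) = 0.
Proof. by rewrite /enorm big1 ?sqrtr0 // => i _; rewrite mxE expr0n. Qed.

Lemma enorm_sum n (F : 'I_n -> 'cV[R]_d) :
  enorm (\sum_i F i) <= \sum_i enorm (F i).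
Proof.
elim/big_ind2: _ => [|x1 x2 y1 y2 h1 h2|//]; first by rewrite enorm0.
by apply: (le_trans (enormD _ _)); exact: lerD.
Qed.

Lemma enorm_coord v i : `|v i 0| <= enorm v.
Proof.
rewrite -(ler_pXn2r (n := 2)) ?nnegrE ?enorm_ge0 //.
rewrite (real_normK (num_real _)) enorm_sqr (bigD1 i) //= lerDl.
by apply: sumr_ge0 => j _; exact: sqr_ge0.
Qed.

Lemma enorm_le_norm v : enorm v <= Num.sqrt d%:R * `|v|.
Proof.
rewrite -(ler_pXn2r (n := 2)) ?nnegrE ?enorm_ge0 ?mulr_ge0 ?sqrtr_ge0 //.
rewrite enorm_sqr exprMn sqr_sqrtr //.
apply: (@le_trans _ _ (\sum_(i < d) `|v| ^+ 2)); last first.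
  by rewrite sumr_const card_ord -[_ *+ d]mulr_natl.
apply: ler_sum => i _; rewrite -(real_normK (num_real (v i 0))).
apply: lerXn2r; rewrite ?nnegrE //.
rewrite [leRHS]mx_normrE.
exact: (le_bigmax _ (fun ij : 'I_d * 'I_1 => `|v ij.1 ij.2|) (i, 0)).
Qed.

Lemma directional_derivative g x v : differentiable g x ->
  'D_v g x = dotv (grad g x) v.
Proof.
move=> dg; rewrite deriveE //.
have -> : v = \sum_i v i 0 *: delta_mx i 0.
  by rewrite [LHS]matrix_sum_delta; apply: eq_bigr => i _; rewrite big_ord1.
rewrite linear_sum /dotv; apply: eq_bigr => i _.
rewrite linearZ /= -deriveE // [RHS]mulrC mxE; congr (_ * _).
rewrite summxE (bigD1 i) //= !mxE !eqxx mulr1 big1 ?addr0 // => k ki.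
by rewrite !mxE eq_sym (negbTE ki) mulr0.
Qed.

Lemma line_derivative g x v (tau : R) : differentiable g (x + tau *: v) ->
  is_derive tau 1 (fun r => g (x + r *: v)) (dotv (grad g (x + tau *: v)) v).
Proof.
move=> dg.
have E : (fun h : R => h^-1 *: (((fun r => g (x + r *: v)) \o shift tau) (h *: (1 : R))
      - g (x + tau *: v))) =
    (fun h : R => h^-1 *: ((g \o shift (x + tau *: v)) (h *: v) - g (x + tau *: v))).
  apply/funext => h /=; congr (_ *: (g _ - _)).
  by rewrite [h *: 1]mulr1 scalerDl [RHS]addrC addrA addrAC.
apply: DeriveDef; rewrite /derivable /derive E.
  exact: diff_derivable.
by rewrite -directional_derivative.
Qed.

Section Descent.
Variables (L : R) (g : 'cV[R]_d -> R).
Hypothesis L0 : 0 <= L.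
Hypothesis gL : L_smooth L g.

(** Along the segment from [x] to [y], the slope exceeds the initial one at most
    linearly. *)
Lemma descent x y :
  g y <= g x + dotv (grad g x) (y - x) + L / 2 * enorm (y - x) ^+ 2.
Proof.
have [dg lg] := gL.
set v := y - x; set c := dotv (grad g x) v; set q := enorm v ^+ 2.
pose u (tau : R) := g (x + tau *: v).
pose p : R -> R := c *: id + (L / 2 * q) *: (id ^+ 2 : R -> R).
have dp (tau : R) : is_derive tau 1 p (c + L * q * tau).
  have hc : is_derive tau 1 (c *: (id : R -> R)) (c *: 1) by exact: is_deriveZ.
  have hq : is_derive tau 1 ((id : R -> R) ^+ 2) (2%:R * tau ^+ 1 *: 1) by exact: is_deriveX.
  have := is_deriveD hc (is_deriveZ (L / 2 * q) hq).
  by congr is_derive; rewrite /GRing.scale /= !mulr1 expr1; field.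
(* Along the segment, w is g minus its quadratic model, and it decreases. *)
pose w := u - p.
have du (tau : R) : is_derive tau 1 u (dotv (grad g (x + tau *: v)) v).
  exact: line_derivative.
have dw (tau : R) : is_derive tau 1 w
   (dotv (grad g (x + tau *: v)) v - (c + L * q * tau)).
  exact: (is_deriveB (du tau) (dp tau)).
have ws : w 1 <= w 0.
  have h1 (tau : R) : tau \in `]0, 1[%R -> derivable w tau 1.
    by move=> _; have [] := dw tau.
  have h2 (tau : R) : tau \in `]0, 1[%R -> w^`()%classic tau <= 0.
    rewrite in_itv /= => /andP[t0 t1]; rewrite derive1E; have [_ ->] := dw tau.
    rewrite opprD addrA subr_le0.
    have -> : dotv (grad g (x + tau *: v)) v - c = dotv (grad g (x + tau *: v) - grad g x) v.
      rewrite /c /dotv -sumrB; apply: eq_bigr => i _.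
      by rewrite -mulrBl; congr (_ * _); rewrite !mxE.
    apply: (le_trans (cauchy_schwarz _ _)).
    have := lg (x + tau *: v) x; rewrite addrAC subrr add0r enormZ gtr0_norm // => h.
    rewrite /q expr2 -!mulrA [_ * tau]mulrC mulrCA !mulrA.
    apply: ler_wpM2r; first exact: enorm_ge0.
    by apply: (le_trans h); apply: le_of_eq; ring.
  have h3 : {within `[0, 1], continuous w}.
    apply: continuous_subspaceT => tau; apply/differentiable_continuous/derivable1_diffP.
    by have [] := dw tau.
  by apply: (ler0_derive1_le_cc h1 h2 h3); rewrite ?in_itv /= ?lexx ?ler01.
have w1 : w 1 = g y - (c + L / 2 * q).
  have -> : y = x + 1 *: v by rewrite scale1r /v addrC subrK.
  by rewrite /w /u /p !fctE; congr (_ - _); rewrite /GRing.scale /= expr1n !mulr1.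
have w0 : w 0 = g x.
  have -> : g x = g (x + 0 *: v) by rewrite scale0r addr0.
  rewrite /w /u /p !fctE -[RHS]subr0; congr (_ - _).
  by rewrite /GRing.scale /= expr0n !mulr0 addr0.
by move: ws; rewrite w1 w0; lra.
Qed.

Lemma L_smooth_continuous : continuous g.
Proof. by move=> x; apply: differentiable_continuous; have [] := gL. Qed.

Lemma partial_lipschitz i x y : `|partial i g x - partial i g y| <= L * enorm (x - y).
Proof.
have [_ lg] := gL; apply: le_trans (lg x y).
by have := enorm_coord (grad g x - grad g y) i; rewrite !mxE.
Qed.

Lemma partial_continuous i : continuous (partial i g).
Proof.
move=> x; have FF : Filter (nbhs x) by exact: nbhs_filter.
apply/cvgrPdist_le => e e0.
pose D := L * Num.sqrt d%:R + 1.
have D0 : 0 < D by rewrite ltr_wpDl // mulr_ge0 // sqrtr_ge0.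
have eD : 0 < e / D by rewrite divr_gt0.
have : nbhs x (ball x (e / D)) by exact: nbhsx_ballx.
apply: filterS => y; rewrite -ball_normE /= => xy.
apply: (le_trans (partial_lipschitz i x y)).
apply: (@le_trans _ _ (L * (Num.sqrt d%:R * `|x - y|))).
  by rewrite ler_wpM2l // enorm_le_norm.
apply: (@le_trans _ _ (D * `|x - y|)).
  by rewrite mulrA ler_wpM2r // lerDl.
by rewrite -ler_pdivlMl // mulrC ltW.
Qed.

Lemma grad_sqr_le x y :
  enorm (grad g x) ^+ 2 <= 2 * enorm (grad g y) ^+ 2 + 2 * L ^+ 2 * enorm (x - y) ^+ 2.
Proof.
have [_ lg] := gL.
have h : enorm (grad g x) <= enorm (grad g y) + L * enorm (x - y).
  have -> : grad g x = grad g y + (grad g x - grad g y) by rewrite addrC subrK.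
  by apply: (le_trans (enormD _ _)); rewrite lerD2l.
have a0 := enorm_ge0 (grad g x); have b0 := enorm_ge0 (grad g y).
have c0 := mulr_ge0 L0 (enorm_ge0 (x - y)).
rewrite -mulrA -exprMn.
apply: (@le_trans _ _ ((enorm (grad g y) + L * enorm (x - y)) ^+ 2)).
  by apply: lerXn2r; rewrite ?nnegrE ?addr_ge0.
have := sqr_ge0 (enorm (grad g y) - L * enorm (x - y)); nra.
Qed.

End Descent.

Section Average.
Context {N : nat}.
Variables (fs : 'I_N -> 'cV[R]_d -> R) (L : R).
Hypotheses (N0 : (0 < N)%N) (hL : forall i, L_smooth L (fs i)).

Let favgE : favg fs = N%:R^-1 *: (\sum_i fs i).
Proof. by apply/funext => x; rewrite /favg !fctE fct_sumE. Qed.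

Lemma favg_differentiable x : differentiable (favg fs) x.
Proof.
rewrite favgE; apply: differentiableZ; apply: differentiable_sum => i.
by have [] := hL i.
Qed.

Lemma grad_favg x : grad (favg fs) x = N%:R^-1 *: \sum_i grad (fs i) x.
Proof.
apply/matrixP => k l; rewrite ord1 !mxE /partial favgE.
have df i : derivable (fs i) x (delta_mx k 0).
  by apply: diff_derivable; have [] := hL i.
rewrite deriveZ; last exact: derivable_sum.
rewrite derive_sum // summxE; congr (_ * _).
by apply: eq_bigr => i _; rewrite mxE.
Qed.

Lemma favg_smooth : L_smooth L (favg fs).
Proof.
split=> [x|x y]; first exact: favg_differentiable.
rewrite !grad_favg -scalerBr -sumrB enormZ.
have N1 : 0 < N%:R :> R by rewrite ltr0n.
rewrite gtr0_norm ?invr_gt0 // ler_pdivrMl //.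
apply: (le_trans (enorm_sum _)).
apply: (@le_trans _ _ (\sum_(i < N) L * enorm (x - y))).
  by apply: ler_sum => i _; have [_] := hL i; exact.
by rewrite sumr_const card_ord -[_ *+ N]mulr_natl.
Qed.

End Average.

Section SpectralBound.
Variable sigma : 'cV[R]_d -> 'M[R]_d.
Hypothesis hsup : has_ubound (volatility_norms sigma).

(** [A i i] is a coordinate of the image of the unit vector [e_i]. *)
Lemma spectral_diag (A : 'M[R]_d) i : A i i <= spectral_norm A.
Proof.
have eE : enorm (delta_mx i 0 : 'cV[R]_d) = 1.
  rewrite /enorm (bigD1 i) //= mxE !eqxx expr1n big1 ?addr0 ?sqrtr1 // => k ki.
  by rewrite mxE (negbTE ki) expr0n.
apply: (@le_trans _ _ (enorm (A *m delta_mx i 0))).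
  apply: le_trans (enorm_coord _ i); apply: le_trans (ler_norm _).
  rewrite mxE (bigD1 i) //= mxE !eqxx mulr1 big1 ?addr0 // => k ki.
  by rewrite mxE (negbTE ki) mulr0.
apply: ub_le_sup; last by exists (delta_mx i 0) => //=; rewrite eE.
exists (\sum_j enorm (col j A)) => _ [v /= v1 <-].
have -> : A *m v = \sum_j v j 0 *: col j A.
  apply/matrixP => k l; rewrite ord1 mxE summxE; apply: eq_bigr => j _.
  by rewrite !mxE mulrC.
apply: (le_trans (enorm_sum _)); apply: ler_sum => j _.
rewrite enormZ -[leRHS]mul1r ler_wpM2r ?enorm_ge0 //.
exact: le_trans (enorm_coord v j) v1.
Qed.

Lemma row_sqr_le x i : \sum_j sigma x i j ^+ 2 <= sigma_star2 sigma.
Proof.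
have -> : \sum_j sigma x i j ^+ 2 = (sigma x *m (sigma x)^T) i i.
  by rewrite mxE; apply: eq_bigr => j _; rewrite mxE expr2.
apply: (le_trans (spectral_diag _ i)).
by apply: ub_le_sup => //; exists x.
Qed.

(** The dimension enters the bound here: the trace of [sigma sigma^T] is
    estimated by [d] times its spectral norm. *)
Lemma frobenius_le x :
  \sum_i \sum_j sigma x i j ^+ 2 <= d%:R * sigma_star2 sigma.
Proof.
apply: (@le_trans _ _ (\sum_(i < d) sigma_star2 sigma)).
  by apply: ler_sum => i _; exact: row_sqr_le.
by rewrite sumr_const card_ord -[_ *+ d]mulr_natl.
Qed.

End SpectralBound.
End EuclideanGeometry.

(** * Continuity and joint measurability *)

Section HalfLineFunctions.
Context {R : realType}.

Lemma C1_nonneg_continuous (g : R -> R) : C1_nonneg g ->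
  {within `[0, +oo[, continuous g}.
Proof.
move=> [g' [_ hg]]; apply/subspace_continuousP => t /=.
rewrite in_itv /= andbT => t0.
have [W EW] : exists W : set_system R, W = within `[0, +oo[ t^' by eexists.
have h := hg t t0; rewrite -EW in h.
have FW : Filter (nbhs W) by rewrite EW; exact: within_filter.
have hid : (s - t) @[s --> W] --> (0 : R).
  rewrite -(subrr t); apply: cvgB; last exact: cvg_cst.
  by rewrite EW => A hA; apply: cvg_within; apply: cvg_within.
have hg2 : g s @[s --> W] --> g t.
  have : (g t + (g s - g t) / (s - t) * (s - t)) @[s --> W] --> g t + g' t * 0.
    by apply: cvgD; [exact: cvg_cst|exact: cvgM].
  rewrite mulr0 addr0; apply: cvg_trans; apply: near_eq_cvg.
  rewrite EW /within /= /dnbhs /within /=.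
  apply: (@filterE _ (nbhs t)) => s st _.
  by rewrite divfK ?subr_eq0 // addrC subrK.
move=> A /= At.
rewrite EW in hg2.
have h2 : nbhs t (fun s => s != t -> `[0, +oo[%classic s -> A (g s)) := hg2 A At.
change (nbhs t (fun s => `[0, +oo[%classic s -> A (g s))).
apply: (@filterS _ (nbhs t) _ _ _ _ h2) => s hs s0.
have [->|st] := eqVneq s t; first exact: nbhs_singleton.
by apply: hs.
Qed.

(** Freezing a half-line function before time 0 makes it continuous on the
    whole line, which spares all one-sided arguments afterwards. *)
Lemma continuous_freeze (U : topologicalType) (g : R -> U) :
  {within `[0, +oo[, continuous g} ->
  continuous (fun r : R => g (Num.max 0 r)).
Proof.
move=> /subspace_continuousP cg x.
have mx0 : 0 <= Num.max 0 x by rewrite le_max lexx.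
have cm : continuous (fun r : R => Num.max 0 r).
  by move=> y; apply: continuous_max; [exact: cvg_cst|exact: cvg_id].
have hx : `[0, +oo[%classic (Num.max 0 x) by rewrite /= in_itv /= mx0.
move=> A hA.
have h1 : nbhs (Num.max 0 x) (fun y => `[0, +oo[%classic y -> A (g y)) :=
  cg (Num.max 0 x) hx A hA.
change (nbhs x (fun y => A (g (Num.max 0 y)))).
apply: (@filterS _ (nbhs x) _ _ _ _ (cm x _ h1)) => y; apply.
by rewrite /= in_itv /= le_max lexx.
Qed.

End HalfLineFunctions.

Section MeasurableApproximation.
Context {R : realType} {d' : measure_display} {T : measurableType d'}.

Lemma cvg_of_rate (V : normedModType R) (u : nat -> V) (l : V) (c : R) :
  (forall n, `|u n - l| <= c * n.+1%:R^-1) -> u n @[n --> \oo] --> l.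
Proof.
move=> h; apply/cvgrPdist_le => e e0.
have hc : c * n.+1%:R^-1 @[n --> \oo] --> (0 : R).
  by rewrite -(mulr0 c); apply: cvgM; [exact: cvg_cst|exact: cvg_harmonic].
have /cvgrPdist_le/(_ _ e0) := hc.
apply: filterS => n; rewrite sub0r normrN => hn.
by rewrite distrC (le_trans (h n)) // (le_trans (ler_norm _)).
Qed.

Lemma measurable_floor_eq e (S : measurableType e) (g : S -> R) (k : int) : measurable_fun setT g ->
  measurable [set w | Num.floor (g w) = k].
Proof.
move=> mg.
have -> : [set w | Num.floor (g w) = k] = g @^-1` `[k%:~R, (k + 1)%:~R[.
  apply/seteqP; split => w /=; rewrite in_itv /=.
    by move=> <-; exact: floor_itv.
  by rewrite -floor_eq => /eqP.
by rewrite -[X in measurable X]setTI; apply: mg.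
Qed.

Lemma floor_approx (x : R) (n : nat) :
  `|(Num.floor (x * n.+1%:R))%:~R / n.+1%:R - x| <= n.+1%:R^-1.
Proof.
have n0 : 0 < n.+1%:R :> R by rewrite ltr0n.
have /andP[h1 h2] := floor_itv (x * n.+1%:R).
rewrite intrD in h2.
rewrite ler_norml; apply/andP; split.
  rewrite lerBrDr ler_pdivlMr //.
  have -> : (- n.+1%:R^-1 + x) * n.+1%:R = x * n.+1%:R - 1.
    by rewrite mulrDl mulNr mulVf ?gt_eqF // addrC.
  lra.
rewrite lerBlDr ler_pdivrMr //.
have -> : (n.+1%:R^-1 + x) * n.+1%:R = 1 + x * n.+1%:R by rewrite mulrDl mulVf ?gt_eqF.
lra.
Qed.

(** Rounding the vector to finer and finer countable grids gives measurable
    approximations. *)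
Lemma measurable_vec_comp d (h : 'cV[R]_d -> R) (Y : T -> 'cV[R]_d) :
  continuous h -> (forall i, measurable_fun setT (fun w => Y w i 0)) ->
  measurable_fun setT (fun w => h (Y w)).
Proof.
move=> ch mY.
pose Q n (k : {ffun 'I_d -> int}) : 'cV[R]_d := \col_i ((k i)%:~R / n.+1%:R).
pose K n w : {ffun 'I_d -> int} := [ffun i => Num.floor (Y w i 0 * n.+1%:R)].
apply: (measurable_fun_cvg (h := fun n w => h (Q n (K n w)))).
- move=> n _ E mE; rewrite setTI.
  have -> : (fun w => h (Q n (K n w))) @^-1` E =
     \bigcup_k ([set w | K n w = k] `&` [set w | E (h (Q n k))]).
    apply/seteqP; split => w /=; first by move=> hE; exists (K n w).
    by move=> [k _ [/= -> ]].
  apply: countable_bigcupT_measurable => // k.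
  apply: measurableI.
    have -> : [set w | K n w = k] =
       \bigcap_(i in [set: 'I_d]) [set w | Num.floor (Y w i 0 * n.+1%:R) = k i].
      apply/seteqP; split => w /=.
        by move=> <- i _ /=; rewrite ffunE.
      by move=> hk; apply/ffunP => i; rewrite ffunE; exact: hk.
    apply: fin_bigcap_measurable => // i _.
    by apply: measurable_floor_eq; exact: measurable_funM.
  have [hE|hE] := pselect (E (h (Q n k))).
    by have -> : [set w : T | E (h (Q n k))] = setT by apply/seteqP; split.
  by have -> : [set w : T | E (h (Q n k))] = set0 by apply/seteqP; split.
- move=> w _; have : Q n (K n w) @[n --> \oo] --> Y w.
    apply: (@cvg_of_rate _ _ _ 1) => n; rewrite mul1r [leLHS]mx_normrE.
    apply/bigmax_leP; split => [|[i j] _] /=; first by rewrite invr_ge0.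
    by rewrite ord1 !mxE ffunE; exact: floor_approx.
  by move=> /(cvg_comp _ _); apply; exact: ch.
Qed.

(** Freezing the process on finer and finer grids of times gives jointly
    measurable approximations. *)
Lemma jmeas_continuous (Y : R -> T -> R) :
  (forall r, measurable_fun setT (Y r)) -> (forall w, continuous (Y ^~ w)) ->
  jmeas Y.
Proof.
move=> mY cY.
pose q n (k : int) : R := k%:~R / n.+1%:R.
pose K n (r : R) : int := Num.floor (r * n.+1%:R).
apply: (measurable_fun_cvg (h := fun n (z : measurableTypeR R * T) => Y (q n (K n z.1)) z.2)).
- move=> n _ E mE; rewrite setTI.
  have -> : (fun z : measurableTypeR R * T => Y (q n (K n z.1)) z.2) @^-1` E =
     \bigcup_k ([set r | K n r = k] `*` (Y (q n k) @^-1` E)).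
    apply/seteqP; split => z /=; first by move=> hE; exists (K n z.1).
    by move=> [k _ [/= -> ]].
  apply: countable_bigcupT_measurable => // k.
  apply: measurableX; last by rewrite -[X in measurable X]setTI; exact: mY.
  have mid : measurable_fun setT (fun r : R => r * n.+1%:R) by exact: measurable_funM.
  exact: (measurable_floor_eq k mid).
- move=> [r w] _ /=; have : q n (K n r) @[n --> \oo] --> r.
    by apply: (@cvg_of_rate _ _ _ 1) => n; rewrite mul1r; exact: floor_approx.
  by move=> hq; exact: (cvg_comp _ _ hq (cY w r)).
Qed.

End MeasurableApproximation.

(** * Integrals over bounded time intervals *)

Section IntervalIntegral.
Context {R : realType}.
Local Notation leb := (@lebesgue_measure R).
Implicit Types (s t m c : R) (u v : R -> R).

(** Half-open intervals, so that consecutive integrals add up without any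
    boundary term. *)
Definition Int s t u : R := \int[leb]_(r in `]s, t]) u r.
Definition iint s t u := leb.-integrable `]s, t] (EFin \o u).

Lemma measurable_oc s t : measurable (`]s, t]%classic : set (measurableTypeR R)).
Proof. exact: measurable_itv. Qed.

Lemma lebesgue_oc s t : s <= t -> leb `]s, t]%classic = (t - s)%:E.
Proof.
move=> st; rewrite lebesgue_measure_itv /= lte_fin; case: ltP => h; first by rewrite EFinB.
have -> : t = s by apply/eqP; rewrite eq_le h st.
by rewrite subrr.
Qed.

Lemma iint_sub s t s' t' u : s <= s' -> t' <= t -> iint s t u -> iint s' t' u.
Proof.
move=> ss tt; apply: integrableS => //.
move=> r /=; rewrite !in_itv /= => /andP[h1 h2].
by rewrite (le_lt_trans ss h1) (le_trans h2 tt).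
Qed.

Lemma iint_bounded s t M u : measurable_fun setT u ->
  (forall r, s < r <= t -> `|u r| <= M) -> iint s t u.
Proof.
move=> mu bu; apply: measurable_bounded_integrable => //.
- rewrite /= lebesgue_measure_itv /=; case: ifP => _; last exact: ltry.
  by rewrite -EFinB ltry.
- exact: measurable_funTS.
- exists M; split; first exact: num_real.
  move=> x Mx r /=; rewrite in_itv /= => h.
  by apply: (le_trans (bu r h)); exact: ltW.
Qed.

Lemma continuous_bounded s t u : continuous u ->
  exists M : R, forall r, s < r <= t -> `|u r| <= M.
Proof.
move=> cu.
have : compact (u @` `[s, t]).
  by apply: continuous_compact; [exact: continuous_subspaceT|exact: segment_compact].
move=> /compact_bounded [M [_ hM]]; exists (M + 1) => r /andP[h1 h2].
by apply: (hM (M + 1)); [rewrite ltrDl|exists r => //=; rewrite in_itv /= h2 ltW].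
Qed.

Lemma iint_continuous s t u : continuous u -> iint s t u.
Proof.
move=> cu; have [M hM] := continuous_bounded s t cu.
by apply: (@iint_bounded _ _ M) => //; exact: continuous_measurable_fun.
Qed.

Lemma iintM s t M v u : measurable_fun setT v ->
  (forall r, s < r <= t -> `|v r| <= M) -> iint s t u ->
  iint s t (fun r => v r * u r).
Proof.
move=> mv bv iu.
have mvI : measurable_fun (`]s, t]%classic : set (measurableTypeR R)) v.
  exact: measurable_funTS.
have bvI : [bounded v r | r in `]s, t]%classic].
  exists M; split; first exact: num_real.
  move=> x Mx r /=; rewrite in_itv /= => h.
  by apply: (le_trans (bv r h)); exact: ltW.
have := @integrableMr _ (measurableTypeR R) R leb `]s, t] (measurable_oc s t) v (EFin \o u) mvI bvI iu.
by apply: eq_integrable => // r _; rewrite /= EFinM.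
Qed.

Lemma iintD s t u v : iint s t u -> iint s t v -> iint s t (fun r => u r + v r).
Proof. by move=> iu iv; have := integrableD (measurable_oc s t) iu iv. Qed.

Lemma iintZ s t c u : iint s t u -> iint s t (fun r => c * u r).
Proof. by move=> iu; have := integrableZl (measurable_oc s t) c iu. Qed.

Lemma iint_cst s t c : iint s t (fun=> c).
Proof. by apply: (@iint_bounded _ _ `|c|). Qed.

Lemma iint_sum s t n (u : 'I_n -> R -> R) : (forall i, iint s t (u i)) ->
  iint s t (fun r => \sum_i u i r).
Proof.
move=> iu; have := integrable_sum (mu := leb) (measurable_oc s t) (index_enum 'I_n)
  (P := xpredT) (h := fun i => EFin \o u i) (fun i _ => iu i).
by apply: eq_integrable => // r _; rewrite /= sumEFin.
Qed.

Lemma IntD s t u v : iint s t u -> iint s t v ->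
  Int s t (fun r => u r + v r) = Int s t u + Int s t v.
Proof. by move=> iu iv; rewrite /Int RintegralD. Qed.

Lemma IntB s t u v : iint s t u -> iint s t v ->
  Int s t (fun r => u r - v r) = Int s t u - Int s t v.
Proof. by move=> iu iv; rewrite /Int RintegralB. Qed.

Lemma IntZ s t c u : iint s t u -> Int s t (fun r => c * u r) = c * Int s t u.
Proof. by move=> iu; rewrite /Int RintegralZl. Qed.

Lemma Int_sum s t n (u : 'I_n -> R -> R) : (forall i, iint s t (u i)) ->
  Int s t (fun r => \sum_i u i r) = \sum_i Int s t (u i).
Proof.
move=> iu; apply: EFin_inj.
rewrite -sumEFin /Int /Rintegral fineK; last first.
  by apply: integrable_fin_num; [exact: measurable_itv|exact: iint_sum].
under eq_integral => r _ do rewrite -sumEFin.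
rewrite integral_sum //; apply: eq_bigr => i _.
by rewrite fineK //; exact: (integrable_fin_num (measurable_oc s t) (iu i)).
Qed.

Lemma Int_cst s t c : s <= t -> Int s t (fun=> c) = c * (t - s).
Proof. by move=> st; rewrite /Int Rintegral_cst //= lebesgue_oc. Qed.

Lemma Int_le s t u v : iint s t u -> iint s t v ->
  (forall r, s < r <= t -> u r <= v r) -> Int s t u <= Int s t v.
Proof.
move=> iu iv uv; apply: le_Rintegral => // r /=; rewrite in_itv; exact: uv.
Qed.

Lemma Int_ge0 s t u : (forall r, s < r <= t -> 0 <= u r) -> 0 <= Int s t u.
Proof.
by move=> u0; apply: Rintegral_ge0 => r /=; rewrite in_itv; exact: u0.
Qed.

Lemma eq_Int s t u v : (forall r, s < r <= t -> u r = v r) -> Int s t u = Int s t v.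
Proof.
move=> uv; apply: eq_Rintegral => r /set_mem /=; rewrite in_itv; exact: uv.
Qed.

Lemma eq_iint s t u v : (forall r, s < r <= t -> u r = v r) -> iint s t u -> iint s t v.
Proof.
move=> uv; apply: eq_integrable => // r /set_mem /=; rewrite in_itv /= => h.
by rewrite uv.
Qed.

Lemma Int_split s m t u : s <= m -> m <= t -> iint s t u ->
  Int s t u = Int s m u + Int m t u.
Proof.
move=> sm mt iu; have := @Rintegral_itvB _ u (BRight s) (BRight t) m iu.
by rewrite !bnd_simp => /(_ sm mt) h; rewrite /Int -h addrC subrK.
Qed.

Lemma Int_closed t u : iint 0 t u -> \int[leb]_(r in `[0, t]) u r = Int 0 t u.
Proof. by move=> iu; rewrite /Int Rintegral_itv_obnd_cbnd. Qed.

(** Cauchy-Schwarz: the integral of the squared deviation from the mean is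
    nonnegative. *)
Lemma Int_sqr_le s t u : s <= t -> iint s t u -> iint s t (fun r => u r ^+ 2) ->
  Int s t u ^+ 2 <= (t - s) * Int s t (fun r => u r ^+ 2).
Proof.
rewrite le_eqVlt => /predU1P[<- _ _|st iu iu2].
  rewrite subrr mul0r /Int set_itv_ge ?Rintegral_set0 ?expr0n //.
  by rewrite bnd_simp ltxx.
have ts : 0 < t - s by rewrite subr_gt0.
pose I1 := Int s t u; pose c := I1 / (t - s).
have : 0 <= Int s t (fun r => u r ^+ 2 + (- (2 * c) * u r + c ^+ 2)).
  apply: Int_ge0 => r _.
  have -> : u r ^+ 2 + (- (2 * c) * u r + c ^+ 2) = (u r - c) ^+ 2 by ring.
  exact: sqr_ge0.
have i1 := iintZ (- (2 * c)) iu; have i2 := iint_cst s t (c ^+ 2).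
rewrite (IntD iu2 (iintD i1 i2)) (IntD i1 i2) (IntZ _ iu) Int_cst; last exact: ltW.
rewrite -/I1; set I2 := Int s t (fun r => _).
have -> : - (2 * c) * I1 + c ^+ 2 * (t - s) = - (I1 ^+ 2 / (t - s)).
  by rewrite /c; field; rewrite gt_eqF.
by rewrite subr_ge0 ler_pdivrMr // mulrC.
Qed.

End IntervalIntegral.

Section ProcessIntegral.
Context {R : realType} {dT : measure_display} {T : measurableType dT}.
Variable P : probability T R.
Local Notation leb := (@lebesgue_measure R).

Lemma ge0_measurable_Int (s t : R) (u : R -> T -> R) : jmeas u ->
  (forall r w, 0 <= u r w) ->
  measurable_fun setT (fun w => \int[leb]_(r in `]s, t]) (u r w)%:E)%E.
Proof.
move=> ju u0.
have jv : measurable_fun setT (fun z : measurableTypeR R * T =>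
    (u z.1 z.2 * \1_(`]s, t] : set R) z.1)%:E).
  apply/measurable_EFinP; apply: (jmeasM (u := u) (v := fun r _ => \1_(`]s, t] : set R) r)) => //.
  by apply: jmeas_time; exact: measurable_indic.
have := measurable_fun_fubini_tonelli_G (m1 := leb) _ jv.
rewrite /fubini_G /= => h.
have {h} : measurable_fun setT (fun w => \int[leb]_r (u r w * \1_(`]s, t] : set R) r)%:E)%E.
  by apply: h => z; rewrite lee_fin mulr_ge0.
apply: eq_measurable_fun => w _; rewrite [RHS]integral_mkcond.
apply: eq_integral => r _; rewrite patchE indicE.
by case: (_ \in _); rewrite ?mulr1 ?mulr0.
Qed.

(** [u] is the difference of the nonnegative processes [|u| + u] and [|u|]. *)
Lemma measurable_Int (s t : R) (u : R -> T -> R) : jmeas u ->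
  (forall w, iint s t (fun r => u r w)) ->
  measurable_fun setT (fun w => Int s t (fun r => u r w)).
Proof.
move=> ju iu.
have pos (v : R -> T -> R) : jmeas v -> (forall r w, 0 <= v r w) ->
    measurable_fun setT (fun w => Int s t (fun r => v r w)).
  move=> jv v0; apply: (measurableT_comp (fine_measurable measurableT)).
  exact: ge0_measurable_Int.
have jp : jmeas (fun r w => `|u r w| + u r w).
  by apply: jmeasD => //; exact: measurableT_comp.
have jn : jmeas (fun r w => `|u r w|) by exact: measurableT_comp.
have -> : (fun w => Int s t (fun r => u r w)) =
  (fun w => Int s t (fun r => `|u r w| + u r w) - Int s t (fun r => `|u r w|)).
  apply/funext => w.
  have ia : iint s t (fun r => `|u r w|) by exact: (integrable_norm (iu w)).
  by rewrite (IntD ia (iu w)); ring.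
apply: measurable_funB; apply: pos => //.
by move=> r w; rewrite -lerBlDr sub0r -normrN ler_norm.
Qed.

(** Tonelli for expectations of time integrals of nonnegative processes. *)
Lemma Ex_Int (s t K : R) (u : R -> T -> R) : s <= t -> jmeas u ->
  (forall r w, 0 <= u r w) -> (forall w, iint s t (fun r => u r w)) ->
  (forall r, s < r <= t -> integ P (u r) /\ Ex P (u r) <= K) ->
  integ P (fun w => Int s t (fun r => u r w)) /\
  Ex P (fun w => Int s t (fun r => u r w)) <= K * (t - s).
Proof.
move=> st ju u0 iu hK.
have IE w : (Int s t (fun r => u r w))%:E = (\int[leb]_(r in `]s, t]) (u r w)%:E)%E.
  by rewrite /Int /Rintegral fineK //; exact: (integrable_fin_num (measurable_oc s t) (iu w)).
have mI := measurable_Int ju iu.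
have key : (\int[P]_w (Int s t (fun r => u r w))%:E <= (K * (t - s))%:E)%E.
  have jv : measurable_fun setT (fun z : measurableTypeR R * T =>
      (u z.1 z.2 * \1_(`]s, t] : set R) z.1)%:E).
    apply/measurable_EFinP; apply: (jmeasM (u := u) (v := fun r _ => \1_(`]s, t] : set R) r)) => //.
    by apply: jmeas_time; exact: measurable_indic.
  have v0 (z : measurableTypeR R * T) : (0 <= (u z.1 z.2 * \1_(`]s, t] : set R) z.1)%:E)%E.
    by rewrite lee_fin mulr_ge0.
  have -> : (\int[P]_w (Int s t (fun r => u r w))%:E =
      \int[P]_w \int[leb]_r (u r w * \1_(`]s, t] : set R) r)%:E)%E.
    apply: eq_integral => w _; rewrite IE integral_mkcond.
    apply: eq_integral => r _; rewrite patchE indicE.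
    by case: (_ \in _); rewrite ?mulr1 ?mulr0.
  have := fubini_tonelli (m1 := leb) (m2 := P) _ jv v0; rewrite /fubini_F /fubini_G /= => <-.
  apply: (@le_trans _ _ (\int[leb]_(r in `]s, t]) K%:E)%E); last first.
    by rewrite integral_cst //= lebesgue_oc.
  rewrite [leRHS]integral_mkcond; apply: ge0_le_integral => //.
  - by move=> r _; apply: integral_ge0 => w _; exact: (v0 (r, w)).
  - exact: (measurable_fun_fubini_tonelli_F _ jv v0).
  - by apply/(measurable_restrictT _ _).1 => //; exact: measurable_oc.
  - move=> r _; rewrite patchE.
    under eq_integral => w _ do rewrite indicE.
    rewrite memitvE in_itv /=; case: ifP => h.
      under eq_integral => w _ do rewrite mulr1.
      by have [iu1 Ku] := hK r h; rewrite -EFin_Ex // lee_fin.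
    under eq_integral => w _ do rewrite mulr0.
    by rewrite integral0.
have iI : integ P (fun w => Int s t (fun r => u r w)).
  apply/integrableP; split; first exact/measurable_EFinP.
  apply: le_lt_trans (ltry (K * (t - s))); apply: le_trans key.
  apply: le_of_eq; apply: eq_integral => w _ /=.
  by rewrite ger0_norm // Int_ge0.
by split => //; rewrite -lee_fin EFin_Ex.
Qed.

End ProcessIntegral.

Section ClampedIntegral.
Context {R : realType}.

Lemma continuous_clamp (s t : R) : continuous (fun r : R => Num.max s (Num.min r t)).
Proof.
move=> y; apply: (@continuous_max _ _ (fun=> s) (fun r => Num.min r t)); first exact: cvg_cst.
by apply: continuous_min; [exact: cvg_id|exact: cvg_cst].
Qed.

Lemma continuous_primitive (s t : R) (u : R -> R) : s <= t -> iint s t u ->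
  continuous (fun r => Int s (Num.max s (Num.min r t)) u).
Proof.
move=> st iu x.
have iu' : (@lebesgue_measure R).-integrable `[s, t] (EFin \o u).
  apply/integrableP; have /integrableP[mu fin] := iu; split.
    exact/emeasurable_fun_itv_obnd_cbndP.
  rewrite -integral_itv_obnd_cbnd //; apply: measurableT_comp => //.
have := parameterized_integral_continuous st iu'.
move=> /subspace_continuousP hc.
have cm := @continuous_clamp s t.
have inI r : `[s, t]%classic (Num.max s (Num.min r t)).
  by rewrite /= in_itv /= le_max lexx /= ge_max st ge_min lexx orbT.
have E r : `[s, t]%classic r ->
    (\int[@lebesgue_measure R]_(x in `[s, r]) u x) = Int s r u.
  rewrite /= in_itv /= => /andP[sr rt]; rewrite /Int Rintegral_itv_obnd_cbnd //.
  exact: (iint_sub (lexx s) rt iu).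
move=> A hA; rewrite -E // in hA.
have h1 : nbhs (Num.max s (Num.min x t))
   (fun y => `[s, t]%classic y -> A (\int[@lebesgue_measure R]_(x in `[s, y]) u x)) :=
  hc _ (inI x) A hA.
change (nbhs x (fun y => A (Int s (Num.max s (Num.min y t)) u))).
apply: (@filterS _ (nbhs x) _ _ _ _ (cm x _ h1)) => y hy.
by rewrite -E //; apply: hy; exact: inI.
Qed.

End ClampedIntegral.

(** * Moments of the dynamics and the one-step bound *)

Section Dynamics.
Context {R : realType} {dT : measure_display} {T : measurableType dT}.
Variables (P : probability T R) (d : nat).
Variables (f : 'cV[R]_d -> R) (L : R) (psi : R -> R) (x0 : 'cV[R]_d).
Hypotheses (L0 : 0 <= L) (fL : L_smooth L f).
Hypotheses (mpsi : measurable_fun setT psi) (psi01 : forall r, 0 <= psi r <= 1).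
Variable Y : R -> T -> 'cV[R]_d.
Hypothesis mY : forall r i, measurable_fun setT (fun w => Y r w i 0).
Hypothesis cY : forall w, continuous (Y ^~ w).
Hypothesis Y0 : forall w, Y 0 w = x0.

Definition slope i r w := partial i f (Y r w).
Definition drift_int i s r w := Int s r (fun u => psi u * slope i u w).
(** The martingale part of the increment of the [i]-th coordinate. *)
Definition noise i s r w := Y r w i 0 - Y s w i 0 + drift_int i s r w.
Definition dist0 r w := enorm (Y r w - x0) ^+ 2.
Definition slope2 r w := enorm (grad f (Y r w)) ^+ 2.

Let psi_abs r s t : s < r <= t -> `|psi r| <= 1.
Proof. by move=> _; have /andP[h1 h2] := psi01 r; rewrite ger0_norm. Qed.

Lemma coord_path i w : continuous (fun r => Y r w i 0).
Proof.
move=> r; apply: (@continuous_comp _ _ _ (Y ^~ w) (fun v : 'cV[R]_d => v i 0)).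
  exact: cY.
exact: coord_continuous.
Qed.

Lemma slope_path i w : continuous (fun r => slope i r w).
Proof.
move=> r; apply: (@continuous_comp _ _ _ (Y ^~ w) (partial i f)); first exact: cY.
exact: (partial_continuous L0 fL).
Qed.

Lemma slope_meas i r : measurable_fun setT (slope i r).
Proof. by apply: measurable_vec_comp => //; exact: (partial_continuous L0 fL). Qed.

Lemma jmeas_coord i : jmeas (fun r w => Y r w i 0).
Proof. by apply: jmeas_continuous => [r|w]; [exact: mY|exact: coord_path]. Qed.

Lemma jmeas_slope i : jmeas (slope i).
Proof. by apply: jmeas_continuous => [r|w]; [exact: slope_meas|exact: slope_path]. Qed.

Lemma jmeas_sum n (u : 'I_n -> R -> T -> R) : (forall i, jmeas (u i)) ->
  jmeas (fun r w => \sum_i u i r w).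
Proof. by move=> ju; apply: measurable_sum => i; exact: ju. Qed.

Lemma dist0E r w : dist0 r w = \sum_i (Y r w i 0 - x0 i 0) ^+ 2.
Proof. by rewrite /dist0 enorm_sqr; apply: eq_bigr => i _; rewrite !mxE. Qed.

Lemma slope2E r w : slope2 r w = \sum_i slope i r w ^+ 2.
Proof. by rewrite /slope2 enorm_sqr; apply: eq_bigr => i _; rewrite !mxE. Qed.

Lemma continuous_sum n (u : 'I_n -> R -> R) : (forall i, continuous (u i)) ->
  continuous (fun r => \sum_i u i r).
Proof.
move=> cu r; elim: (index_enum _) => [|i l IH].
  by under eq_fun do rewrite big_nil; rewrite ?big_nil; exact: cvg_cst.
under eq_fun do rewrite big_cons; rewrite ?big_cons.
by apply: cvgD; [exact: cu|exact: IH].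
Qed.

Lemma continuous_sqr (u : R -> R) : continuous u -> continuous (fun r => u r ^+ 2).
Proof. by move=> cu r; under eq_fun do rewrite expr2; apply: cvgM; exact: cu. Qed.

Lemma dist0_path w : continuous (fun r => dist0 r w).
Proof.
under eq_fun do rewrite dist0E; apply: continuous_sum => i; apply: continuous_sqr => r.
by apply: cvgB; [exact: coord_path|exact: cvg_cst].
Qed.

Lemma slope2_path w : continuous (fun r => slope2 r w).
Proof.
under eq_fun do rewrite slope2E; apply: continuous_sum => i; apply: continuous_sqr.
exact: slope_path.
Qed.

Lemma dist0_meas r : measurable_fun setT (dist0 r).
Proof.
rewrite (_ : dist0 r = fun w => \sum_i (Y r w i 0 - x0 i 0) ^+ 2).
  by apply: measurable_sum => i; apply: measurable_funX; apply: measurable_funB.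
by apply/funext => w; exact: dist0E.
Qed.

Lemma slope2_meas r : measurable_fun setT (slope2 r).
Proof.
rewrite (_ : slope2 r = fun w => \sum_i slope i r w ^+ 2).
  by apply: measurable_sum => i; apply: measurable_funX; exact: slope_meas.
by apply/funext => w; exact: slope2E.
Qed.

Lemma jmeas_slope2 : jmeas slope2.
Proof. by apply: jmeas_continuous => [r|w]; [exact: slope2_meas|exact: slope2_path]. Qed.

Lemma dist0_ge0 r w : 0 <= dist0 r w.
Proof. exact: sqr_ge0. Qed.

Lemma slope2_le r w : slope2 r w <= 2 * enorm (grad f x0) ^+ 2 + 2 * L ^+ 2 * dist0 r w.
Proof. exact: grad_sqr_le. Qed.

Lemma iint_drift i s r w : iint s r (fun u => psi u * slope i u w).
Proof.
apply: (@iintM _ _ _ 1) => //; first by move=> u; exact: psi_abs.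
by apply: iint_continuous; exact: slope_path.
Qed.

Lemma drift_meas i s r : measurable_fun setT (drift_int i s r).
Proof.
apply: (measurable_Int (u := fun u w => psi u * slope i u w)); last first.
  by move=> w; exact: iint_drift.
by apply: (jmeasM (jmeas_time mpsi) (jmeas_slope i)).
Qed.

Lemma noise_meas i s r : measurable_fun setT (noise i s r).
Proof. by apply: measurable_funD; [exact: measurable_funB|exact: drift_meas]. Qed.

(** Cauchy-Schwarz in time, with [psi <= 1]. *)
Lemma weighted_sqr_le s r (u : R -> R) : s <= r -> continuous u ->
  Int s r (fun v => psi v * u v) ^+ 2 <= (r - s) * Int s r (fun v => u v ^+ 2).
Proof.
move=> sr cu.
have iu : iint s r (fun v => psi v * u v).
  apply: (@iintM _ _ _ 1) => //; first by move=> v; exact: psi_abs.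
  exact: iint_continuous.
have cu2 := continuous_sqr cu.
have iu2 : iint s r (fun v => (psi v * u v) ^+ 2).
  have : iint s r (fun v => psi v ^+ 2 * u v ^+ 2).
    apply: (@iintM _ _ _ 1); first exact: measurable_funX.
      move=> v h; rewrite normrX; have := psi_abs h.
      by move=> h1; rewrite -[leRHS](expr1n _ 2) lerXn2r // nnegrE.
    exact: iint_continuous.
  by apply: eq_iint => v _; rewrite exprMn.
apply: (le_trans (Int_sqr_le sr iu iu2)).
apply: ler_wpM2l; first by rewrite subr_ge0.
apply: Int_le => //; first exact: iint_continuous.
move=> v _; rewrite exprMn -[leRHS]mul1r ler_wpM2r ?sqr_ge0 //.
have /andP[h1 h2] := psi01 v.
by rewrite -[leRHS](expr1n _ 2) lerXn2r // nnegrE.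
Qed.

Lemma drift_sqr_le s r w : s <= r ->
  \sum_i drift_int i s r w ^+ 2 <= (r - s) * Int s r (fun u => slope2 u w).
Proof.
move=> sr.
have -> : Int s r (fun u => slope2 u w) = \sum_i Int s r (fun u => slope i u w ^+ 2).
  rewrite -Int_sum; first by apply: eq_Int => u _; exact: slope2E.
  by move=> i; apply: iint_continuous; apply: continuous_sqr; exact: slope_path.
rewrite mulr_sumr; apply: ler_sum => i _.
by apply: weighted_sqr_le => //; exact: slope_path.
Qed.

Lemma drift_sqr_le_dist s r t w : s <= r -> r <= t ->
  \sum_i drift_int i s r w ^+ 2 <=
  (t - s) * (2 * enorm (grad f x0) ^+ 2 * (t - s) +
             2 * L ^+ 2 * Int s t (fun u => dist0 u w)).
Proof.
move=> sr rt; have st := le_trans sr rt.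
apply: (le_trans (drift_sqr_le w sr)).
have id : iint s t (fun u => dist0 u w) by apply: iint_continuous; exact: dist0_path.
have is2 : iint s t (fun u => slope2 u w) by apply: iint_continuous; exact: slope2_path.
have ic := iint_cst s t (2 * enorm (grad f x0) ^+ 2).
apply: (@le_trans _ _ ((t - s) * Int s t (fun u => slope2 u w))).
  apply: ler_pM; rewrite ?subr_ge0 ?lerD2r //.
    by apply: Int_ge0 => u _; exact: sqr_ge0.
  rewrite (Int_split sr rt is2) lerDl.
  by apply: Int_ge0 => u _; exact: sqr_ge0.
apply: ler_wpM2l; first by rewrite subr_ge0.
rewrite -(Int_cst _ st) -(IntZ _ id) -IntD //; last exact: iintZ.
apply: Int_le => //; first by apply: iintD => //; exact: iintZ.
by move=> u _; exact: slope2_le.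
Qed.

Lemma noise_path i s t w : s <= t ->
  continuous (fun r => noise i s (Num.max s (Num.min r t)) w).
Proof.
move=> st r; apply: cvgD; last exact: (continuous_primitive st (iint_drift i s t w)).
apply: cvgB; last exact: cvg_cst.
by apply: (@continuous_comp _ _ _ (fun r : R => Num.max s (Num.min r t))
  (fun r => Y r w i 0)); [exact: continuous_clamp|exact: coord_path].
Qed.

Lemma jmeas_noise i s t : s <= t -> jmeas (fun r w => noise i s (Num.max s (Num.min r t)) w).
Proof.
by move=> st; apply: jmeas_continuous => [r|w]; [exact: noise_meas|exact: noise_path].
Qed.

Variable K : R.
Hypothesis noiseK : forall s r, 0 <= s -> s <= r ->
  (forall i, sqint P (noise i s r)) /\
  \sum_i Ex P (fun w => noise i s r w ^+ 2) <= K * (r - s).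

Let K0 : 0 <= K.
Proof.
have [_ ] := noiseK (lexx 0) (ler01 : 0 <= (1 : R)); rewrite subr0 mulr1.
by apply: le_trans; apply: sumr_ge0 => i _; exact: Ex_sqr_ge0.
Qed.

Lemma dist0_split s r w :
  dist0 r w <= 3 * dist0 s w + 3 * \sum_i drift_int i s r w ^+ 2 +
    3 * \sum_i noise i s r w ^+ 2.
Proof.
rewrite !dist0E !mulr_sumr -!big_split /=; apply: ler_sum => i _.
have -> : Y r w i 0 - x0 i 0 = Y s w i 0 - x0 i 0 - drift_int i s r w + noise i s r w.
  by rewrite /noise; ring.
move: (Y s w i 0 - x0 i 0) (drift_int i s r w) (noise i s r w) => a b c.
rewrite -subr_ge0.
have -> : 3 * a ^+ 2 + 3 * b ^+ 2 + 3 * c ^+ 2 - (a - b + c) ^+ 2 =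
  (a + b) ^+ 2 + (a - c) ^+ 2 + (b + c) ^+ 2 by ring.
by rewrite !addr_ge0 ?sqr_ge0.
Qed.

(** Over a time step short with respect to [L], the accumulated squared
    distance is controlled by itself with a factor below one, so it can be
    absorbed path by path, where it is finite. *)
Lemma moment_step s tau : 0 <= s -> 0 < tau -> 6 * tau ^+ 2 * L ^+ 2 <= 2^-1 ->
  integ P (dist0 s) ->
  exists K' : R, forall r, s <= r -> r <= s + tau ->
    integ P (dist0 r) /\ Ex P (dist0 r) <= K'.
Proof.
move=> s0 tau0 htau is0.
have st : s <= s + tau by rewrite lerDl ltW.
pose n2 r w := \sum_i noise i s (Num.max s (Num.min r (s + tau))) w ^+ 2.
have n2E r w : s <= r -> r <= s + tau -> n2 r w = \sum_i noise i s r w ^+ 2.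
  by move=> sr rt; rewrite /n2 min_l // max_r.
have jn2 : jmeas n2.
  apply: jmeas_sum => i; apply: measurable_funX; exact: jmeas_noise.
have clamp r : s <= Num.max s (Num.min r (s + tau)) <= s + tau.
  by rewrite le_max lexx /= ge_max st ge_min lexx orbT.
have in2 r : integ P (n2 r) /\ Ex P (n2 r) <= K * tau.
  have /andP[h1 h2] := clamp r; have [sq hE] := noiseK s0 h1.
  split; first by apply: integ_sum => i; exact: (sq i).2.
  rewrite Ex_sum; last by move=> i; exact: (sq i).2.
  by apply: (le_trans hE); rewrite ler_wpM2l // lerBlDl.
have cn2 w : continuous (fun r => n2 r w).
  by apply: continuous_sum => i; apply: continuous_sqr; exact: noise_path.
have in2w w : iint s (s + tau) (fun r => n2 r w) by exact: iint_continuous.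
have n20 r w : 0 <= n2 r w by apply: sumr_ge0 => i _; exact: sqr_ge0.
have [iI EI] := Ex_Int st jn2 n20 in2w (fun r _ => in2 r).
set g0 := enorm (grad f x0) ^+ 2.
pose V w := 6 * tau * dist0 s w + 12 * tau ^+ 3 * g0 + 6 * Int s (s + tau) (fun r => n2 r w).
have iV : integ P V.
  by apply: integD; [apply: integD; [exact: integZ|exact: integ_cst]|exact: integZ].
have tauE : s + tau - s = tau by rewrite addrAC subrr add0r.
have driftW r w : s <= r -> r <= s + tau -> \sum_i drift_int i s r w ^+ 2 <=
    tau * (2 * g0 * tau + 2 * L ^+ 2 * Int s (s + tau) (fun u => dist0 u w)).
  by move=> sr rt; have := drift_sqr_le_dist w sr rt; rewrite tauE.
have WV w : Int s (s + tau) (fun u => dist0 u w) <= V w.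
  pose W := Int s (s + tau) (fun u => dist0 u w).
  pose c := 3 * dist0 s w + 3 * (tau * (2 * g0 * tau + 2 * L ^+ 2 * W)).
  have id : iint s (s + tau) (fun u => dist0 u w) by apply: iint_continuous; exact: dist0_path.
  have : W <= Int s (s + tau) (fun u => c + 3 * n2 u w).
    apply: Int_le => //; first by apply: iintD; [exact: iint_cst|exact: iintZ].
    move=> u /andP[/ltW su ut]; rewrite n2E //.
    apply: (le_trans (dist0_split s u w)); rewrite lerD2r lerD2l ler_pM2l //.
    exact: driftW.
  rewrite IntD ?Int_cst //; [|exact: iint_cst|exact: iintZ].
  rewrite (IntZ _ (in2w w)) tauE /V /c /W {c W}.
  have W0 : 0 <= Int s (s + tau) (fun u => dist0 u w) by apply: Int_ge0 => u _; exact: dist0_ge0.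
  have := ler_wpM2r W0 htau.
  move: (Int s (s + tau) (fun u => dist0 u w)) W0 (Int s (s + tau) (fun r => n2 r w)) (dist0 s w) => W W0 I q h1 h2.
  have E1 : (3 * q + 3 * (tau * (2 * g0 * tau + 2 * L ^+ 2 * W))) * tau =
    3 * tau * q + 6 * tau ^+ 3 * g0 + tau * (6 * tau * L ^+ 2 * W) by ring.
  have E2 : tau * (6 * tau * L ^+ 2 * W) = 6 * tau ^+ 2 * L ^+ 2 * W by ring.
  rewrite E1 E2 in h2.
  have E3 : 6 * tau * q = 2 * (3 * tau * q) by ring.
  have E4 : 12 * tau ^+ 3 * g0 = 2 * (6 * tau ^+ 3 * g0) by ring.
  rewrite E3 E4; lra.
exists (3 * Ex P (dist0 s) + 3 * (tau * (2 * g0 * tau + 2 * L ^+ 2 * Ex P V)) + 3 * (K * tau)).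
move=> r sr rt.
pose U w := 3 * dist0 s w + (3 * (tau * (2 * g0 * tau)) + 3 * (tau * (2 * L ^+ 2)) * V w) + 3 * n2 r w.
have i1 := integZ 3 is0; have i2 := integ_cst P (3 * (tau * (2 * g0 * tau))).
have i3 := integZ (3 * (tau * (2 * L ^+ 2))) iV; have i4 := integZ 3 (in2 r).1.
have iU : integ P U by apply: integD => //; apply: integD => //; exact: integD.
have qU w : dist0 r w <= U w.
  apply: (le_trans (dist0_split s r w)); rewrite /U n2E // lerD2r lerD2l.
  have h1 := driftW r w sr rt; have h2 := WV w.
  have E1 : 3 * (tau * (2 * g0 * tau)) + 3 * (tau * (2 * L ^+ 2)) * V w =
    3 * (tau * (2 * g0 * tau + 2 * L ^+ 2 * V w)) by ring.
  rewrite E1 ler_pM2l //; apply: (le_trans h1).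
  by rewrite ler_pM2l // lerD2l ler_wpM2l // mulr_ge0 // sqr_ge0.
have iq : integ P (dist0 r).
  apply: (integ_le (dist0_meas r) _ iU) => w'.
  by rewrite ger0_norm ?dist0_ge0.
split => //; apply: (le_trans (Ex_le iq iU qU)).
rewrite /U (ExD (integD i1 (integD i2 i3)) i4) (ExD i1 (integD i2 i3)) (ExD i2 i3).
rewrite (ExZ _ is0) (ExZ _ iV) (ExZ _ (in2 r).1) Ex_cst.
have := (in2 r).2; move: (Ex P (n2 r)) (Ex P V) (Ex P (dist0 s)) => a b c ha.
have -> : 3 * (tau * (2 * g0 * tau + 2 * L ^+ 2 * b)) =
  3 * (tau * (2 * g0 * tau)) + 3 * (tau * (2 * L ^+ 2)) * b by ring.
lra.
Qed.

(** The admissible length of a step depends on [L] only, so finitely many steps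
    reach any horizon. *)
Lemma moment_bound t : exists K' : R, forall r, 0 <= r -> r <= t ->
  integ P (dist0 r) /\ Ex P (dist0 r) <= K'.
Proof.
pose tau := (4 * (L + 1))^-1.
have L1 : 0 < L + 1 by rewrite ltr_wpDl.
have tau0 : 0 < tau by rewrite invr_gt0 mulr_gt0.
have htau : 6 * tau ^+ 2 * L ^+ 2 <= 2^-1.
  have h : tau * L <= 4^-1.
    rewrite /tau invfM -mulrA ler_piMr // ler_pdivrMl // mulr1; lra.
  have h0 : 0 <= tau * L by rewrite mulr_ge0 // ltW.
  have -> : 6 * tau ^+ 2 * L ^+ 2 = 6 * (tau * L) ^+ 2 by ring.
  nra.
have main n : exists K' : R, forall r, 0 <= r -> r <= n%:R * tau ->
    integ P (dist0 r) /\ Ex P (dist0 r) <= K'.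
  elim: n => [|n [K1 h1]].
    exists 0 => r r0; rewrite mul0r => r0'.
    have -> : r = 0 by apply/eqP; rewrite eq_le r0 r0'.
    have -> : dist0 0 = fun=> 0.
      by apply/funext => w; rewrite /dist0 Y0 subrr enorm0 expr0n.
    by split; [exact: integ_cst|rewrite Ex_cst].
  have nt0 : 0 <= n%:R * tau by rewrite mulr_ge0 // ltW.
  have [K2 h2] := moment_step nt0 tau0 htau (h1 _ nt0 (lexx _)).1.
  exists (Num.max K1 K2) => r r0 rn; have [rle|/ltW rge] := leP r (n%:R * tau).
    by have [i1 e1] := h1 r r0 rle; split => //; rewrite le_max e1.
  have [|i1 e1] := h2 r rge; last by split => //; rewrite le_max e1 orbT.
  by apply: (le_trans rn); rewrite -natr1 mulrDl mul1r.
have [K' h] := main (Num.bound `|t / tau|).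
exists K' => r r0 rt; apply: h => //; apply: (le_trans rt).
rewrite -ler_pdivrMr //; apply: (le_trans (ler_norm _)); apply: ltW.
exact: archi_boundP.
Qed.

Section Horizon.
Variables (t Kq : R).
Hypothesis t0 : 0 <= t.
Hypothesis hq : forall r, 0 <= r -> r <= t -> integ P (dist0 r) /\ Ex P (dist0 r) <= Kq.
Let g0 := enorm (grad f x0) ^+ 2.
Let Kg := 2 * g0 + 2 * L ^+ 2 * Kq.
Let K2 := 2 * K + 2 * (Kg * t).

Let Kq0 : 0 <= Kq.
Proof.
have [_ h] := hq (lexx 0) t0; apply: le_trans h.
by apply: Ex_ge0 => w; exact: dist0_ge0.
Qed.

Let Kg0 : 0 <= Kg.
Proof.
apply: addr_ge0; first by apply: mulr_ge0 => //; exact: sqr_ge0.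
by apply: mulr_ge0; [apply: mulr_ge0 => //; exact: sqr_ge0|exact: Kq0].
Qed.

Let K20 : 0 <= K2.
Proof.
have hK : 0 <= K := K0; have hg : 0 <= Kg * t := mulr_ge0 Kg0 t0.
by rewrite /K2; lra.
Qed.

Lemma slope2_moment r : 0 <= r -> r <= t ->
  integ P (slope2 r) /\ Ex P (slope2 r) <= Kg.
Proof.
move=> r0 rt; have [iq eq] := hq r0 rt.
have i1 := integ_cst P (2 * g0); have i2 := integZ (2 * L ^+ 2) iq.
have iU := integD i1 i2.
have is2 : integ P (slope2 r).
  apply: (integ_le (slope2_meas r) _ iU) => w.
  by rewrite (ger0_norm (sqr_ge0 _ : 0 <= slope2 r w)); exact: slope2_le.
split => //; apply: (@le_trans _ _ (Ex P (fun w => 2 * g0 + 2 * L ^+ 2 * dist0 r w))).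
  by apply: Ex_le => // w; exact: slope2_le.
rewrite (ExD i1 i2) Ex_cst (ExZ _ iq) lerD2l ler_wpM2l //.
by rewrite mulr_ge0 // sqr_ge0.
Qed.

Lemma sqint_of_sum (V : T -> R) (u : 'I_d -> T -> R) :
  (forall i, measurable_fun setT (u i)) -> integ P V ->
  (forall w, \sum_i u i w ^+ 2 <= V w) ->
  (forall i, sqint P (u i)) /\ \sum_i Ex P (fun w => u i w ^+ 2) <= Ex P V.
Proof.
move=> mu iV uV.
have sq i : sqint P (u i).
  split => //; apply: (integ_le _ _ iV); first exact: measurable_funX.
  move=> w; rewrite ger0_norm ?sqr_ge0 //; apply: le_trans (uV w).
  by rewrite (bigD1 i) //= lerDl; apply: sumr_ge0 => j _; exact: sqr_ge0.
split => //; rewrite -Ex_sum; last by move=> i; exact: (sq i).2.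
by apply: Ex_le => //; apply: integ_sum => i; exact: (sq i).2.
Qed.

Lemma slope_sqint i r : 0 <= r -> r <= t -> sqint P (slope i r).
Proof.
move=> r0 rt; have [is2 _] := slope2_moment r0 rt.
have [h _] := sqint_of_sum (fun i => slope_meas i r) is2
  (fun w => le_of_eq (esym (slope2E r w))).
exact: h.
Qed.

Lemma drift_moment s r : 0 <= s -> s <= r -> r <= t ->
  (forall i, sqint P (drift_int i s r)) /\
  \sum_i Ex P (fun w => drift_int i s r w ^+ 2) <= Kg * (r - s) ^+ 2.
Proof.
move=> s0 sr rt.
have is2 w : iint s r (fun u => slope2 u w) by apply: iint_continuous; exact: slope2_path.
have [iI EI] := Ex_Int (K := Kg) sr jmeas_slope2 (fun u w => sqr_ge0 _) is2
  (fun u hu => slope2_moment (le_trans s0 (ltW (andP hu).1)) (le_trans (andP hu).2 rt)).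
have [sq hE] := sqint_of_sum (fun i => drift_meas i s r) (integZ (r - s) iI)
  (fun w => drift_sqr_le w sr).
split => //; apply: (le_trans hE); rewrite (ExZ _ iI).
have -> : Kg * (r - s) ^+ 2 = (r - s) * (Kg * (r - s)) by ring.
by rewrite ler_wpM2l // subr_ge0.
Qed.

Let coordE i s r w : Y r w i 0 - Y s w i 0 = noise i s r w - drift_int i s r w.
Proof. by rewrite /noise addrK. Qed.

Lemma coord_moment s r : 0 <= s -> s <= r -> r <= t ->
  (forall i, sqint P (fun w => Y r w i 0 - Y s w i 0)) /\
  \sum_i Ex P (fun w => (Y r w i 0 - Y s w i 0) ^+ 2) <= K2 * (r - s).
Proof.
move=> s0 sr rt; have [sqn en] := noiseK s0 sr; have [sqa ea] := drift_moment s0 sr rt.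
have E i : (fun w => Y r w i 0 - Y s w i 0) = (fun w => noise i s r w - drift_int i s r w).
  by apply/funext => w; exact: coordE.
split=> [i|]; first by rewrite E; exact: sqintB.
apply: (@le_trans _ _ (\sum_i (2 * Ex P (fun w => noise i s r w ^+ 2) +
    2 * Ex P (fun w => drift_int i s r w ^+ 2)))).
  apply: ler_sum => i _.
  have i1 := integZ 2 (sqn i).2; have i2 := integZ 2 (sqa i).2.
  rewrite -(ExZ _ (sqn i).2) -(ExZ _ (sqa i).2) -ExD //; apply: Ex_le.
  - have -> : (fun w => (Y r w i 0 - Y s w i 0) ^+ 2) =
      (fun w => (noise i s r w - drift_int i s r w) ^+ 2).
      by apply/funext => w; rewrite coordE.
    exact: (sqintB (sqn i) (sqa i)).2.
  - exact: integD.
  - move=> w; rewrite coordE; have := sqr_ge0 (noise i s r w + drift_int i s r w).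
    by move: (noise i s r w) (drift_int i s r w) => a b; nra.
rewrite big_split /= -!mulr_sumr /K2.
have h : (r - s) ^+ 2 <= t * (r - s).
  rewrite expr2 ler_wpM2r ?subr_ge0 //; lra.
have := ler_wpM2l Kg0 h.
have -> : (2 * K + 2 * (Kg * t)) * (r - s) = 2 * (K * (r - s)) + 2 * (Kg * (t * (r - s))) by ring.
by move=> h3; apply: lerD; rewrite ler_pM2l //; exact: le_trans h3.
Qed.

(** The error made by freezing the gradient at the left end of a step. *)
Definition gap i s r w := Int s r psi * slope i s w - drift_int i s r w.

Lemma gap_moment s r : 0 <= s -> s <= r -> r <= t ->
  (forall i, sqint P (gap i s r)) /\
  \sum_i Ex P (fun w => gap i s r w ^+ 2) <= L ^+ 2 * K2 * (r - s) ^+ 3.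
Proof.
move=> s0 sr rt.
pose v u w := \sum_i (Y u w i 0 - Y s w i 0) ^+ 2.
have jv : jmeas v.
  apply: jmeas_sum => i; apply: measurable_funX.
  apply: (jmeasB (jmeas_coord i) (v := fun _ w => Y s w i 0)).
  exact: jmeas_var.
have cv w : continuous (fun u => v u w).
  apply: continuous_sum => i; apply: continuous_sqr => u.
  by apply: cvgB; [exact: coord_path|exact: cvg_cst].
have iv w : iint s r (fun u => v u w) by exact: iint_continuous.
have v0 u w : 0 <= v u w by apply: sumr_ge0 => i _; exact: sqr_ge0.
have ev u : s < u <= r -> integ P (v u) /\ Ex P (v u) <= K2 * (r - s).
  move=> /andP[/ltW su ur]; have [sq e] := coord_moment s0 su (le_trans ur rt).
  split; first by apply: integ_sum => i; exact: (sq i).2.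
  rewrite Ex_sum; last by move=> i; exact: (sq i).2.
  by apply: (le_trans e); rewrite ler_wpM2l // lerD2r.
have [iI EI] := Ex_Int sr jv v0 iv ev.
have gapE i w : gap i s r w = Int s r (fun u => psi u * (slope i s w - slope i u w)).
  have ip : iint s r psi by apply: (@iint_bounded _ _ _ 1) => // u; exact: psi_abs.
  rewrite /gap /drift_int mulrC -(IntZ _ ip) -IntB; [|exact: iintZ|exact: iint_drift].
  by apply: eq_Int => u _; ring.
have le w : \sum_i gap i s r w ^+ 2 <= (r - s) * (L ^+ 2) * Int s r (fun u => v u w).
  have cs i : continuous (fun u => slope i s w - slope i u w).
    by move=> u; apply: cvgB; [exact: cvg_cst|exact: slope_path].
  apply: (@le_trans _ _ (\sum_i (r - s) * Int s r (fun u => (slope i s w - slope i u w) ^+ 2))).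
    by apply: ler_sum => i _; rewrite gapE; exact: weighted_sqr_le.
  have ics i : iint s r (fun u => (slope i s w - slope i u w) ^+ 2).
    by apply: iint_continuous; exact: continuous_sqr.
  rewrite -mulr_sumr -mulrA ler_wpM2l ?subr_ge0 // -Int_sum // -(IntZ _ (iv w)).
  apply: Int_le; [exact: iint_sum|exact: iintZ|move=> u _].
  have -> : \sum_i (slope i s w - slope i u w) ^+ 2 = enorm (grad f (Y s w) - grad f (Y u w)) ^+ 2.
    by rewrite enorm_sqr; apply: eq_bigr => i _; rewrite !mxE.
  have -> : v u w = enorm (Y s w - Y u w) ^+ 2.
    by rewrite enorm_sqr; apply: eq_bigr => i _; rewrite !mxE -sqrrN opprB.
  rewrite -exprMn; apply: lerXn2r; rewrite ?nnegrE ?mulr_ge0 ?enorm_ge0 //.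
  by have [_] := fL; exact.
have mg i : measurable_fun setT (gap i s r).
  apply: measurable_funB; last exact: drift_meas.
  by apply: measurable_funM => //; exact: slope_meas.
have [sq hE] := sqint_of_sum mg (integZ ((r - s) * L ^+ 2) iI) le.
split => //; apply: (le_trans hE); rewrite (ExZ _ iI).
have h : 0 <= (r - s) * L ^+ 2 by rewrite mulr_ge0 ?subr_ge0 ?sqr_ge0.
by apply: (le_trans (ler_wpM2l h EI)); apply: le_of_eq; ring.
Qed.

Variables (fstar mu : R) (Bd : R -> R -> R).
Hypothesis f_min : forall y, fstar <= f y.
Hypothesis f_PL : forall y, enorm (grad f y) ^+ 2 >= 2 * mu * (f y - fstar).
Hypothesis noiseBd : forall s r, 0 <= s -> s <= r ->
  \sum_i Ex P (fun w => noise i s r w ^+ 2) <= Bd s r.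
Hypothesis BdK : forall s r, 0 <= s -> s <= r -> Bd s r <= K * (r - s).
Hypothesis noise_orth : forall i s r, 0 <= s -> s <= r -> sqint P (slope i s) ->
  Ex P (fun w => slope i s w * noise i s r w) = 0.

Definition excess r w := f (Y r w) - fstar.

Lemma excess_ge0 r w : 0 <= excess r w.
Proof. by rewrite subr_ge0. Qed.

Lemma excess_meas r : measurable_fun setT (excess r).
Proof.
apply: measurable_funB => //; apply: measurable_vec_comp => //.
exact: (L_smooth_continuous fL).
Qed.

Lemma excess_integ r : 0 <= r -> r <= t -> integ P (excess r).
Proof.
move=> r0 rt; have [iq _] := hq r0 rt.
have iU := integD (integ_cst P (f x0 - fstar + g0)) (integZ (1 + L / 2) iq).
apply: (integ_le (excess_meas r) _ iU) => w; rewrite ger0_norm ?excess_ge0 //.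
have := descent fL x0 (Y r w); rewrite /excess /dist0.
have := cauchy_schwarz (grad f x0) (Y r w - x0).
have : enorm (grad f x0) * enorm (Y r w - x0) <= g0 + enorm (Y r w - x0) ^+ 2.
  rewrite /g0; have := sqr_ge0 (enorm (grad f x0) - enorm (Y r w - x0)).
  have := enorm_ge0 (grad f x0); have := enorm_ge0 (Y r w - x0).
  by move: (enorm (grad f x0)) (enorm (Y r w - x0)) => a b; nra.
move: (dotv _ _) (enorm _ * _) (enorm (Y r w - x0) ^+ 2) => a b c h1 h2 h3.
lra.
Qed.

Let R0 := Num.sqrt t.
Definition step_error : R := (Kg + L ^+ 2 * K2) / 2 + L / 2 * (K + Kg * (1 + R0)).

Lemma step_error_ge0 : 0 <= step_error.
Proof.
have hK : 0 <= K := K0; have hR : 0 <= R0 := sqrtr_ge0 t.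
apply: addr_ge0; apply: mulr_ge0; rewrite ?invr_ge0 //.
- by apply: addr_ge0 => //; apply: mulr_ge0 => //; exact: sqr_ge0.
- by rewrite mulr_ge0 ?invr_ge0.
- by apply: addr_ge0 => //; apply: mulr_ge0 => //; exact: addr_ge0.
Qed.

(** One step of the scheme: what the Ito formula would give, up to an error of
    order 3/2 in the length of the step. *)
Lemma one_step s r : 0 <= s -> s < r -> r <= t ->
  Ex P (excess r) <= (1 - 2 * mu * Int s r psi) * Ex P (excess s) +
    L / 2 * Bd s r + step_error * Num.sqrt (r - s) ^+ 3.
Proof.
move=> s0 ltsr rt; have sr := ltW ltsr; have st := le_trans sr rt.
have r0 := le_trans s0 sr.
set rho := Num.sqrt (r - s).
have rho0 : 0 < rho by rewrite sqrtr_gt0 subr_gt0.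
have rho2 : r - s = rho ^+ 2 by rewrite sqr_sqrtr // subr_ge0.
have rhoR : rho <= R0 by rewrite ler_wsqrtr //; lra.
have [sqn en] := noiseK s0 sr; have [sqa ea] := drift_moment s0 sr rt.
have [sqg eg] := gap_moment s0 sr rt; have [sqc ec] := coord_moment s0 sr rt.
have sqs i := slope_sqint i s0 st.
have [is2 es2] := slope2_moment s0 st.
pose Phi := Int s r psi.
have Phi0 : 0 <= Phi by apply: Int_ge0 => u _; have /andP[] := psi01 u.
pose up w := excess s w + (\sum_i slope i s w * noise i s r w +
  (\sum_i slope i s w * gap i s r w + (- Phi * slope2 s w +
   L / 2 * \sum_i (Y r w i 0 - Y s w i 0) ^+ 2))).
have le_up w : excess r w <= up w.
  have := descent fL (Y s w) (Y r w); rewrite enorm_sqr => h.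
  rewrite /excess /up /excess -addrA [- fstar + _]addrC addrA lerD2r.
  apply: (le_trans h); rewrite -!addrA lerD2l !addrA.
  apply: le_of_eq; congr (_ + _ * _).
    rewrite slope2E mulr_sumr -!big_split /=; apply: eq_bigr => i _.
    by rewrite !mxE coordE /gap -/Phi /slope; ring.
  by apply: eq_bigr => i _; rewrite !mxE.
have ie := excess_integ s0 st; have ier := excess_integ r0 rt.
have i1 i : integ P (fun w => slope i s w * noise i s r w) by exact: sqint_mul.
have i2 i : integ P (fun w => slope i s w * gap i s r w) by exact: sqint_mul.
have i3 := integZ (- Phi) is2.
have ic : integ P (fun w => \sum_i (Y r w i 0 - Y s w i 0) ^+ 2).
  by apply: integ_sum => i; exact: (sqc i).2.
have i4 := integZ (L / 2) ic.
have I34 := integD i3 i4.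
have I234 := integD (integ_sum (index_enum 'I_d) i2) I34.
have I1234 := integD (integ_sum (index_enum 'I_d) i1) I234.
have iU := integD ie I1234.
apply: (le_trans (Ex_le ier iU le_up)).
rewrite /up (ExD ie I1234) (ExD (integ_sum _ i1) I234) (ExD (integ_sum _ i2) I34) (ExD i3 i4).
rewrite (ExZ _ is2) (ExZ _ ic) !Ex_sum //; last by move=> i; exact: (sqc i).2.
rewrite big1 ?add0r; last by move=> i _; exact: noise_orth.
(* In both error bounds the free weight, rho^3 here and rho below, is chosen
   so that all terms are of order rho^3. *)
have b1 : \sum_i Ex P (fun w => slope i s w * gap i s r w) <=
    (Kg + L ^+ 2 * K2) / 2 * rho ^+ 3.
  have r3 : 0 < rho ^+ 3 by rewrite exprn_gt0.
  apply: (@le_trans _ _ (\sum_i (rho ^+ 3 * Ex P (fun w => slope i s w ^+ 2) +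
     (rho ^+ 3)^-1 * Ex P (fun w => gap i s r w ^+ 2)) / 2)).
    apply: ler_sum => i _; apply: (le_trans (ler_norm _)).
    exact: (Ex_young r3 (sqs i) (sqg i)).
  rewrite -mulr_suml big_split /= -!mulr_sumr.
  have e1 : \sum_i Ex P (fun w => slope i s w ^+ 2) <= Kg.
    rewrite -Ex_sum; last by move=> i; exact: (sqs i).2.
    apply: le_trans es2; apply: le_of_eq; congr Ex.
    by apply/funext => w; rewrite slope2E.
  have e2 : (rho ^+ 3)^-1 * \sum_i Ex P (fun w => gap i s r w ^+ 2) <= L ^+ 2 * K2 * rho ^+ 3.
    rewrite ler_pdivrMl //; apply: (le_trans eg); rewrite rho2.
    by apply: le_of_eq; ring.
  have e3 := ler_wpM2l (ltW r3) e1.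
  move: e2 e3; move: (\sum_i Ex P _) (_ * \sum_i Ex P _) => a b e2 e3.
  have -> : (Kg + L ^+ 2 * K2) / 2 * rho ^+ 3 = (rho ^+ 3 * Kg + L ^+ 2 * K2 * rho ^+ 3) / 2 by ring.
  by rewrite ler_pM2r ?invr_gt0 //; exact: lerD.
have b2 : \sum_i Ex P (fun w => (Y r w i 0 - Y s w i 0) ^+ 2) <=
    Bd s r + (K + Kg * (1 + R0)) * rho ^+ 3.
  apply: (@le_trans _ _ (\sum_i ((1 + rho) * Ex P (fun w => noise i s r w ^+ 2) +
    (1 + rho^-1) * Ex P (fun w => drift_int i s r w ^+ 2)))).
    apply: ler_sum => i _.
    have := Ex_sqrD rho0 (sqn i) (sqintZ (-1) (sqa i)).
    have -> : (fun w => (noise i s r w + -1 * drift_int i s r w) ^+ 2) =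
      (fun w => (Y r w i 0 - Y s w i 0) ^+ 2).
      by apply/funext => w; rewrite coordE mulN1r.
    have -> // : (fun w => (-1 * drift_int i s r w) ^+ 2) = (fun w => drift_int i s r w ^+ 2).
    by apply/funext => w; rewrite mulN1r sqrrN.
  rewrite big_split /= -!mulr_sumr.
  have n1 := noiseBd s0 sr; have n2 := BdK s0 sr.
  have B0 : 0 <= Bd s r.
    by apply: le_trans n1; apply: sumr_ge0 => i _; exact: Ex_sqr_ge0.
  have h1 : (1 + rho) * \sum_i Ex P (fun w => noise i s r w ^+ 2) <= Bd s r + K * rho ^+ 3.
    apply: (le_trans (ler_wpM2l (addr_ge0 ler01 (ltW rho0)) n1)).
    rewrite mulrDl mul1r lerD2l; apply: (le_trans (ler_wpM2l (ltW rho0) n2)).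
    by rewrite rho2; apply: le_of_eq; ring.
  have ri : 0 <= 1 + rho^-1 by rewrite addr_ge0 // invr_ge0 ltW.
  have h2 : (1 + rho^-1) * \sum_i Ex P (fun w => drift_int i s r w ^+ 2) <=
      Kg * (1 + R0) * rho ^+ 3.
    apply: (le_trans (ler_wpM2l ri ea)); rewrite rho2.
    have -> : (1 + rho^-1) * (Kg * (rho ^+ 2) ^+ 2) = Kg * rho ^+ 3 * (1 + rho).
      by field; rewrite gt_eqF.
    have -> : Kg * (1 + R0) * rho ^+ 3 = Kg * rho ^+ 3 * (1 + R0) by ring.
    by rewrite ler_wpM2l ?lerD2l // mulr_ge0 // exprn_ge0 // ltW.
  by apply: (le_trans (lerD h1 h2)); apply: le_of_eq; ring.
have b3 : - Phi * Ex P (slope2 s) <= - (2 * mu * Phi) * Ex P (excess s).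
  rewrite !mulNr lerN2 [2 * mu * Phi]mulrC -mulrA ler_wpM2l //.
  rewrite -(ExZ _ ie); apply: Ex_le => //; first exact: integZ.
  by move=> w; exact: f_PL.
have L2 : 0 <= L / 2 by rewrite divr_ge0.
have b4 := ler_wpM2l L2 b2.
rewrite /step_error -/Phi.
move: b1 b3 b4.
move: (\sum_i Ex P _) (- Phi * _) (L / 2 * \sum_i Ex P _) => a b c b1 b3 b4.
have -> : (1 - 2 * mu * Phi) * Ex P (excess s) + L / 2 * Bd s r +
   ((Kg + L ^+ 2 * K2) / 2 + L / 2 * (K + Kg * (1 + R0))) * rho ^+ 3 =
  Ex P (excess s) + ((Kg + L ^+ 2 * K2) / 2 * rho ^+ 3 + (- (2 * mu * Phi) * Ex P (excess s) +
   L / 2 * (Bd s r + (K + Kg * (1 + R0)) * rho ^+ 3))) by ring.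
by rewrite lerD2l; apply: lerD => //; exact: lerD.
Qed.

End Horizon.

End Dynamics.

(** * Summation of the one-step bounds *)

Section Gronwall.
Context {R : realType}.
Variables (t a C K3 : R) (E psi beta : R -> R).
Hypotheses (t0 : 0 <= t) (a0 : 0 <= a) (C0 : 0 <= C) (K30 : 0 <= K3).
Hypotheses (mpsi : measurable_fun setT psi) (psi01 : forall r, 0 <= psi r <= 1).
Hypotheses (ibeta : iint 0 t beta) (beta0 : forall r, 0 <= beta r).
Hypothesis E0 : forall r, 0 <= r -> r <= t -> 0 <= E r.
Hypothesis E_step : forall s r, 0 <= s -> s < r -> r <= t ->
  E r <= (1 - a * Int s r psi) * E s + C * Int s r beta + K3 * Num.sqrt (r - s) ^+ 3.
Local Notation phi r := (Int 0 r psi).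
Let W u := beta u * expR (a * phi u).

Let ipsi s r : iint s r psi.
Proof.
apply: (@iint_bounded _ _ _ 1) => // u _.
by have /andP[h1 h2] := psi01 u; rewrite ger0_norm.
Qed.

Let phi_split s r : 0 <= s -> s <= r -> phi r = phi s + Int s r psi.
Proof. by move=> s0 sr; rewrite (Int_split s0 sr). Qed.

Let psi_Int s r : s <= r -> 0 <= Int s r psi <= r - s.
Proof.
move=> sr; apply/andP; split.
  by apply: Int_ge0 => u _; have /andP[] := psi01 u.
rewrite -[leRHS]mul1r -(Int_cst _ sr); apply: Int_le => //; first exact: iint_cst.
by move=> u _; have /andP[] := psi01 u.
Qed.

Let phi_mono s r : 0 <= s -> s <= r -> phi s <= phi r.
Proof.
by move=> s0 sr; rewrite (phi_split s0 sr) lerDl; have /andP[] := psi_Int sr.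
Qed.

Lemma iint_weight c : iint 0 t (fun u => expR (a * phi u + c) * beta u).
Proof.
pose v u := expR (a * Int 0 (Num.max 0 (Num.min u t)) psi + c).
have vE u : 0 < u <= t -> v u = expR (a * phi u + c).
  by move=> /andP[h1 h2]; rewrite /v (min_l h2) (max_r (ltW h1)).
have cv : continuous v.
  move=> u; apply: (@continuous_comp _ _ _ (fun u => a * Int 0 (Num.max 0 (Num.min u t)) psi + c) expR).
    apply: cvgD; last exact: cvg_cst.
    by apply: cvgM; [exact: cvg_cst|exact: continuous_primitive].
  exact: continuous_expR.
have : iint 0 t (fun u => v u * beta u).
  have [M hM] := continuous_bounded 0 t cv.
  apply: (@iintM _ _ _ M) => //; exact: continuous_measurable_fun.
by apply: eq_iint => u hu; rewrite vE.
Qed.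

Let iW : iint 0 t W.
Proof.
have := iint_weight 0; apply: eq_iint => u _.
by rewrite addr0 mulrC.
Qed.

(** Freezing the exponential weight over a step of length at most [del] costs a
    factor tending to 1. *)
Lemma weight_step s r del : 0 <= s -> s <= r -> r <= t -> r - s <= del ->
  expR (a * phi r) * Int s r beta <= expR (a * del) * Int s r W.
Proof.
move=> s0 sr rt rsd.
have ib := iint_sub s0 rt ibeta; have iw := iint_sub s0 rt iW.
rewrite -(IntZ _ ib) -(IntZ _ iw); apply: Int_le; [exact: iintZ|exact: iintZ|].
move=> u /andP[/ltW su ur]; rewrite /W mulrCA mulrC ler_wpM2l //.
rewrite -expRD ler_expR -mulrDr ler_wpM2l //.
rewrite (phi_split (le_trans s0 su) ur) addrC lerD2r.
have /andP[_ h] := psi_Int ur; apply: (le_trans h); apply: le_trans rsd.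
by rewrite lerD2l lerN2.
Qed.

(** The integrating factor [expR (a * phi)] absorbs the decay of each step,
    since [1 - x <= expR (- x)]; the weighted bounds then telescope. *)
Lemma gronwall_partition n (del := t / n.+1%:R) :
  expR (a * phi t) * E t <=
  E 0 + C * expR (a * del) * Int 0 t W + expR (a * phi t) * K3 * t * Num.sqrt del.
Proof.
have n0 : 0 < n.+1%:R :> R by rewrite ltr0n.
have [t00|tn0] := eqVneq t 0.
  rewrite t00 /Int !set_itv_ge ?bnd_simp ?ltxx // !Rintegral_set0 !mulr0 expR0 mul1r.
  by rewrite mul0r !addr0.
have tp : 0 < t by rewrite lt_neqAle eq_sym tn0.
have del0 : 0 < del by rewrite divr_gt0.
have ndel : n.+1%:R * del = t by rewrite /del mulrC divfK // gt_eqF.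
have main k : (k <= n.+1)%N -> expR (a * phi (k%:R * del)) * E (k%:R * del) <=
    E 0 + C * expR (a * del) * Int 0 (k%:R * del) W +
    k%:R * (expR (a * phi t) * K3 * Num.sqrt del ^+ 3).
  elim: k => [_|k IH kn].
    rewrite !mul0r /Int !set_itv_ge ?bnd_simp ?ltxx // !Rintegral_set0 !mulr0 expR0 mul1r.
    by rewrite !addr0.
  set s := k%:R * del; set r := k.+1%:R * del.
  have s0 : 0 <= s by rewrite mulr_ge0 // ltW.
  have rs : r = s + del by rewrite /r -natr1 mulrDl mul1r.
  have sr : s < r by rewrite rs ltrDl.
  have rt : r <= t by rewrite -ndel ler_pM2r // ler_nat.
  have st : s <= t := le_trans (ltW sr) rt.
  have rsd : r - s = del by rewrite rs addrAC subrr add0r.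
  have := E_step s0 sr rt; rewrite rsd => h.
  have h0 := IH (ltnW kn).
  have Es : 0 <= E s by exact: E0.
  have hexp : 1 - a * Int s r psi <= expR (- (a * Int s r psi)) by exact: expR_ge1Dx.
  have h1 : expR (a * phi r) * ((1 - a * Int s r psi) * E s) <= expR (a * phi s) * E s.
    have e1 : expR (a * phi r) * (1 - a * Int s r psi) <= expR (a * phi s).
      rewrite (phi_split s0 (ltW sr)) [a * (_ + _)]mulrDr expRD -mulrA.
      rewrite -[leRHS]mulr1 ler_wpM2l ?expR_ge0 //.
      apply: (le_trans (ler_wpM2l (expR_ge0 _) hexp)).
      by rewrite expRN divff // gt_eqF // expR_gt0.
    by rewrite mulrA (ler_wpM2r Es e1).
  have hd : r - s <= del by rewrite rsd.
  have h2 := weight_step s0 (ltW sr) rt hd.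
  have h3 : expR (a * phi r) <= expR (a * phi t).
    by rewrite ler_expR ler_wpM2l // phi_mono // (le_trans s0 (ltW sr)).
  have iw := iint_sub (lexx 0) rt iW.
  rewrite (Int_split s0 (ltW sr) iw).
  have hh := ler_wpM2l (expR_ge0 (a * phi r)) h.
  have h4 := ler_wpM2l C0 h2.
  have q0 : 0 <= K3 * Num.sqrt del ^+ 3 by rewrite mulr_ge0 // exprn_ge0 // sqrtr_ge0.
  have h5 := ler_wpM2r q0 h3.
  move: hh h1 h4 h5 h0.
  rewrite -natr1.
  move: (expR (a * phi r)) (expR (a * phi t)) (expR (a * phi s)) (expR (a * del)) => er et es ed.
  move: (E r) (E s) (Int s r beta) (Int s r W) (Int 0 s W) (Int s r psi) (Num.sqrt del ^+ 3).
  move=> Er Es' ib jw js ip q hh h1 h4 h5 h0.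
  have e1 : er * ((1 - a * ip) * Es' + C * ib + K3 * q) =
    er * ((1 - a * ip) * Es') + C * (er * ib) + er * (K3 * q) by ring.
  rewrite e1 in hh.
  have e2 : C * ed * (js + jw) = C * ed * js + C * (ed * jw) by ring.
  have e3 : (k%:R + 1) * (et * K3 * q) = k%:R * (et * K3 * q) + et * (K3 * q) by ring.
  rewrite e2 e3; apply: (le_trans hh); clear e1 e2 e3 hh.
  move: (er * ((1 - a * ip) * Es')) (C * (er * ib)) (er * (K3 * q)) h1 h4 h5 => p1 p2 p3.
  move: (C * (ed * jw)) (et * (K3 * q)) => p4 p5 h1 h4 h5.
  move: (es * Es') h0 h1 => p6; move: (C * ed * js) (k%:R * _) => p7 p8 h0 h1.
  have -> : E 0 + (p7 + p4) + (p8 + p5) = (E 0 + p7 + p8) + p4 + p5 by ring.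
  by apply: lerD => //; apply: lerD => //; exact: le_trans h1 h0.
have := main n.+1 (leqnn _); rewrite ndel => h; apply: (le_trans h); rewrite lerD2l.
apply: le_of_eq.
have -> : Num.sqrt del ^+ 3 = del * Num.sqrt del.
  by rewrite exprSr sqr_sqrtr // ltW.
have -> : n.+1%:R * (expR (a * phi t) * K3 * (del * Num.sqrt del)) =
  expR (a * phi t) * K3 * (n.+1%:R * del) * Num.sqrt del by ring.
by rewrite ndel.
Qed.

(** The [n] errors, each of order [n] to the power [-3/2], vanish in the limit. *)
Lemma gronwall_limit :
  E t <= expR (- (a * phi t)) * E 0 +
    C * Int 0 t (fun r => beta r * expR (- (a * (phi t - phi r)))).
Proof.
have J0 : 0 <= Int 0 t W.
  by apply: Int_ge0 => u _; rewrite mulr_ge0 // expR_ge0.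
have lim : expR (a * phi t) * E t <= E 0 + C * Int 0 t W.
  have cd : t / n.+1%:R @[n --> \oo] --> (0 : R).
    by rewrite -(mulr0 t); apply: cvgM; [exact: cvg_cst|exact: cvg_harmonic].
  have c1 : expR (a * (t / n.+1%:R)) @[n --> \oo] --> (1 : R).
    have h : a * (t / n.+1%:R) @[n --> \oo] --> a * 0 by apply: cvgM => //; exact: cvg_cst.
    rewrite -[X in _ --> X](expR0 R) -(mulr0 a).
    exact: (cvg_comp _ _ h (@continuous_expR R (a * 0))).
  have c2 : Num.sqrt (t / n.+1%:R) @[n --> \oo] --> (0 : R).
    rewrite -[X in _ --> X](sqrtr0 R).
    exact: (cvg_comp _ _ cd (@sqrt_continuous R 0)).
  have cv : E 0 + C * expR (a * (t / n.+1%:R)) * Int 0 t W +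
      expR (a * phi t) * K3 * t * Num.sqrt (t / n.+1%:R) @[n --> \oo] -->
      E 0 + C * 1 * Int 0 t W + expR (a * phi t) * K3 * t * 0.
    apply: cvgD; last by apply: cvgM => //; exact: cvg_cst.
    apply: cvgD; first exact: cvg_cst.
    apply: cvgM; last exact: cvg_cst.
    by apply: cvgM => //; exact: cvg_cst.
  rewrite mulr1 mulr0 addr0 in cv.
  rewrite -(cvg_lim _ cv) //; apply: limr_ge; first by apply/cvg_ex; eexists; exact: cv.
  by apply: nearW => n; exact: gronwall_partition.
have -> : E t = expR (- (a * phi t)) * (expR (a * phi t) * E t).
  by rewrite mulrA -expRD addrC subrr expR0 mul1r.
apply: (le_trans (ler_wpM2l (expR_ge0 _) lim)).
rewrite mulrDr lerD2l mulrCA ler_wpM2l // -(IntZ _ iW).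
apply: le_of_eq; apply: eq_Int => u _.
rewrite /W mulrCA -expRD; congr (_ * expR _); ring.
Qed.

End Gronwall.

(** * The rate along a solution *)

Section RegularVersion.
Context {R : realType} {dT : measure_display} {T : measurableType dT}.
Variables (P : probability T R) (d : nat).

(** The solution is frozen before time 0 and replaced by a constant on the null
    event where a path is discontinuous or starts elsewhere. *)
Lemma regular_version (X : R -> T -> 'cV[R]_d) (x0 : 'cV[R]_d) :
  (forall r i, 0 <= r -> measurable_fun setT (fun w => X r w i 0)) ->
  ae_continuous_paths P X -> {ae P, forall w, X 0 w = x0} ->
  exists Y : R -> T -> 'cV[R]_d,
  [/\ forall r i, measurable_fun setT (fun w => Y r w i 0),
      forall w, continuous (Y ^~ w), forall w, Y 0 w = x0 &
      {ae P, forall w, forall r, 0 <= r -> Y r w = X r w}].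
Proof.
move=> mX cX X0; have [N [mN N0 hN]] := filterI cX X0.
have hout w : ~ N w -> {within `[0, +oo[, continuous (X ^~ w)} /\ X 0 w = x0.
  by move=> Nw; have := contra_not (hN w) Nw; rewrite /setC /= => /contrapT.
pose Y r w := if w \in N then x0 else X (Num.max 0 r) w.
exists Y; split.
- move=> r i.
  have -> : (fun w => Y r w i 0) = (fun w => if w \in N then x0 i 0 else X (Num.max 0 r) w i 0).
    by apply/funext => w; rewrite /Y; case: ifP.
  apply: measurable_fun_ifT => //; last by apply: mX; rewrite le_max lexx.
  apply: (measurable_fun_bool true); rewrite setTI /preimage /=.
  suff -> : [set w | (w \in N) = true] = N by [].
  apply/seteqP; split => w /=; first by move=> /set_mem.
  by move=> Nw; rewrite mem_set.
- move=> w; rewrite /Y; have [wN|wN] := boolP (w \in N); first by move=> r; exact: cvg_cst.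
  have [cw _] := hout w (fun h => negP wN (mem_set h)).
  exact: (continuous_freeze cw).
- move=> w; rewrite /Y maxxx; case: ifPn => // wN.
  by have [_] := hout w (fun h => negP wN (mem_set h)).
- exists N; split => // w hw; apply: contrapT => wN; apply: hw => r r0.
  by rewrite /Y (max_r r0); case: ifPn => // /set_mem.
Qed.

End RegularVersion.

Section Rate.
Context {R : realType} {dT : measure_display} {T : measurableType dT}.
Variables (P : probability T R) (d : nat).
Variables (F : R -> set_system T) (B : R -> T -> 'cV[R]_d).
Hypotheses (hF : filtration F) (hB : brownian_motion P F B).
Variables (f : 'cV[R]_d -> R) (L mu h fstar S : R) (x0 : 'cV[R]_d).
Variables (sigma : 'cV[R]_d -> 'M[R]_d) (psi b : R -> R) (X : R -> T -> 'cV[R]_d).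
Hypotheses (L0 : 0 <= L) (fL : L_smooth L f).
Hypotheses (f_min : forall y, fstar <= f y) (mu0 : 0 <= mu).
Hypothesis f_PL : forall y, enorm (grad f y) ^+ 2 >= 2 * mu * (f y - fstar).
Hypotheses (h0 : 0 <= h) (hpsi : adjustment_function psi) (hb : batch_size_function b).
Hypothesis sigmaS : forall x, \sum_i \sum_j sigma x i j ^+ 2 <= S.
Hypothesis hX : sde_solution P F B (fun t x => - (psi t *: grad f x))
  (fun t x => (psi t * Num.sqrt (h / b t)) *: sigma x) x0 X.
Local Notation leb := (@lebesgue_measure R).

Let S0 : 0 <= S.
Proof.
by apply: le_trans (sigmaS x0); apply: sumr_ge0 => i _; apply: sumr_ge0 => j _; exact: sqr_ge0.
Qed.

Let psip r := psi (Num.max 0 r).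
Let bp r := b (Num.max 0 r).
Let beta r := psip r ^+ 2 / bp r.

Let psipE r : 0 <= r -> psip r = psi r.
Proof. by move=> r0; rewrite /psip max_r. Qed.

Let bpE r : 0 <= r -> bp r = b r.
Proof. by move=> r0; rewrite /bp max_r. Qed.

Let psip01 r : 0 <= psip r <= 1.
Proof. by have [_ h1 _ _] := hpsi; apply: h1; rewrite le_max lexx. Qed.

Let bp1 r : 1 <= bp r.
Proof. by have [_] := hb; apply; rewrite le_max lexx. Qed.

Let cpsip : continuous psip.
Proof.
by have [h1 _ _ _] := hpsi; apply: continuous_freeze; exact: C1_nonneg_continuous.
Qed.

Let mpsip : measurable_fun setT psip.
Proof. exact: continuous_measurable_fun. Qed.

Let cbeta : continuous beta.
Proof.
move=> r; apply: cvgM; first by apply: continuous_sqr.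
apply: cvgV; first by rewrite gt_eqF // (lt_le_trans ltr01).
by have [h1 _] := hb; apply: continuous_freeze; exact: C1_nonneg_continuous.
Qed.

Let beta01 r : 0 <= beta r <= 1.
Proof.
have b0 : 0 < bp r by apply: lt_le_trans (bp1 r).
have /andP[p0 p1] := psip01 r.
rewrite /beta divr_ge0 ?sqr_ge0 ?(ltW b0) //= ler_pdivrMr // mul1r (le_trans _ (bp1 r)) //.
by rewrite expr_le1.
Qed.

Let ibeta s r : iint s r beta.
Proof. exact: iint_continuous. Qed.

Let vol i j r w := ((psi r * Num.sqrt (h / b r)) *: sigma (X r w)) i j.

Let vol_sqr r w : 0 <= r -> \sum_i \sum_j vol i j r w ^+ 2 <= h * S * beta r.
Proof.
move=> r0.
have b0 : 0 < b r by rewrite -bpE // (lt_le_trans ltr01).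
have E i j : vol i j r w ^+ 2 = h * beta r * sigma (X r w) i j ^+ 2.
  rewrite /vol mxE !exprMn sqr_sqrtr; last by rewrite divr_ge0 // ltW.
  by rewrite /beta psipE // bpE //; ring.
under eq_bigr => i _ do under eq_bigr => j _ do rewrite E.
under eq_bigr => i _ do rewrite -mulr_sumr.
rewrite -mulr_sumr [h * S * _]mulrAC ler_wpM2l // mulr_ge0 //.
by have /andP[] := beta01 r.
Qed.

Let vol_bounded i j r w : 0 <= r -> `|vol i j r w| <= Num.sqrt (h * S).
Proof.
move=> r0; rewrite -sqrtr_sqr ler_wsqrtr //.
apply: (@le_trans _ _ (\sum_i \sum_j vol i j r w ^+ 2)).
  rewrite (bigD1 i) //= (bigD1 j) //= -addrA lerDl.
  by apply: addr_ge0; apply: sumr_ge0 => k _; [|apply: sumr_ge0 => l _]; exact: sqr_ge0.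
apply: (le_trans (vol_sqr w r0)); rewrite -[leRHS]mulr1 ler_wpM2l ?mulr_ge0 //.
by have /andP[] := beta01 r.
Qed.

(** The one-step bounds are proved along a version [Y] of [X] with continuous
    paths. The integral equation identifies its noise almost surely with the
    increments of the Ito integrals, so orthogonality and energy carry over. *)
Lemma rate_of_solution t : 0 <= t ->
  ('E_P[fun w => (f (X t w) - fstar)%R] <=
   (expR (- (2 * mu * phi psi t)) * (f x0 - fstar) + L / 2 * (h * S) *
    \int[lebesgue_measure]_(s in `[0%R, t])
       (psi s ^+ 2 / b s * expR (- (2 * mu * (phi psi t - phi psi s)))))%:E)%E.
Proof.
move=> t0; have [aX cX X0 _ [I [hI hXI]]] := hX.
have mX r i (r0 : 0 <= r) : measurable_fun setT (fun w => X r w i 0).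
  by apply: (measurable_wrt_measurable hF r0); exact: aX.
have [Y [mY cY Y0 YX]] := regular_version mX cX X0.
pose nz := noise f psip Y.
have id i s r w : iint s r (fun u => psip u * slope f Y i u w).
  exact: (iint_drift L0 fL mpsip psip01 cY).
have coordE i r : 0 <= r -> {ae P, forall w,
    Y r w i 0 = x0 i 0 - drift_int f psip Y i 0 r w + \sum_j I i j r w}.
  move=> r0; apply: filterS2 YX (hXI r r0 i) => w hw hx.
  rewrite hw // hx; congr (_ + _ + _).
  have -> : - drift_int f psip Y i 0 r w = Int 0 r (fun u => -1 * (psip u * slope f Y i u w)).
    by rewrite (IntZ _ (id i 0 r w)) mulN1r.
  rewrite -(Int_closed (iintZ (-1) (id i 0 r w))).
  apply: eq_Rintegral => u /set_mem /=; rewrite in_itv /= => /andP[u0 _].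
  by rewrite !mxE psipE // /slope hw // mulN1r.
have noiseE i s r : 0 <= s -> s <= r -> {ae P, forall w,
    \sum_j (I i j r w - I i j s w) = nz i s r w}.
  move=> s0 sr; apply: filterS2 (coordE i s s0) (coordE i r (le_trans s0 sr)) => w hs hr.
  rewrite /nz /noise hs hr sumrB /drift_int (Int_split s0 sr (id i 0 r w)).
  by move: (Int 0 s _) (Int s r _) => p q; ring.
have mnz i s r : measurable_fun setT (nz i s r) by exact: (noise_meas L0 fL mpsip psip01 mY cY).
have C0 : 0 <= Num.sqrt (h * S) := sqrtr_ge0 _.
have sqI i j s r : 0 <= s -> s <= r -> sqint P (fun w => I i j r w - I i j s w).
  move=> s0 sr; have r0 := le_trans s0 sr.
  exact: (ito_increment hF hB C0 s0 sr (fun u w => @vol_bounded i j u w) (hI i j s s0) (hI i j r r0)).1.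
have sqM i s r : 0 <= s -> s <= r -> sqint P (fun w => \sum_j (I i j r w - I i j s w)).
  by move=> s0 sr; apply: sqint_sum => j; exact: sqI.
have sqn i s r : 0 <= s -> s <= r -> sqint P (nz i s r).
  by move=> s0 sr; apply: (sqint_ae (mnz i s r) (noiseE i s r s0 sr)); exact: sqM.
pose Bd s r := h * S * Int s r beta.
have noiseBd s r : 0 <= s -> s <= r -> \sum_i Ex P (fun w => nz i s r w ^+ 2) <= Bd s r.
  move=> s0 sr; have r0 := le_trans s0 sr.
  have -> : Bd s r = Int s r (fun u => h * S * beta u) by rewrite (IntZ _ (ibeta s r)).
  have := ito_energy hF hB C0 s0 sr (fun i j u w => @vol_bounded i j u w)
    (fun i j => hI i j s s0) (fun i j => hI i j r r0)
    (fun u w hu => vol_sqr w (le_trans s0 (ltW (andP hu).1))) (iintZ (h * S) (ibeta s r)).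
  apply: le_trans; apply: le_of_eq; apply: eq_bigr => i _.
  apply: Ex_ae.
  - exact: measurable_funX.
  - by apply: measurable_funX; exact: (sqM i s r s0 sr).1.
  - by apply: filterS (noiseE i s r s0 sr) => w ->.
have BdK s r : 0 <= s -> s <= r -> Bd s r <= h * S * (r - s).
  move=> s0 sr; rewrite ler_wpM2l ?mulr_ge0 // -[leRHS]mul1r -(Int_cst _ sr).
  by apply: Int_le => // [|u _]; [exact: iint_cst|have /andP[] := beta01 u].
have noiseK s r : 0 <= s -> s <= r -> (forall i, sqint P (nz i s r)) /\
    \sum_i Ex P (fun w => nz i s r w ^+ 2) <= h * S * (r - s).
  by move=> s0 sr; split => [i|]; [exact: sqn|exact: le_trans (noiseBd s r s0 sr) (BdK s r s0 sr)].
have noise_orth i s r : 0 <= s -> s <= r -> sqint P (slope f Y i s) ->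
    Ex P (fun w => slope f Y i s w * nz i s r w) = 0.
  move=> s0 sr sqs; have r0 := le_trans s0 sr.
  pose Z w := partial i f (X s w).
  have mZ : measurable_wrt (F s) Z.
    apply/(measurable_wrtP hF _ s0).
    apply: (measurable_vec_comp (T := g_sigma_algebraType (F s))).
      exact: (partial_continuous L0 fL).
    by move=> k; apply/(measurable_wrtP hF _ s0); exact: aX.
  have mZT := measurable_wrt_measurable hF s0 mZ.
  have sqZ : sqint P Z.
    by apply: (sqint_ae mZT _ sqs); apply: filterS YX => w hw; rewrite /slope hw.
  have -> : Ex P (fun w => slope f Y i s w * nz i s r w) =
      Ex P (fun w => \sum_j Z w * (I i j r w - I i j s w)).
    apply: Ex_ae.
    - by apply: measurable_funM => //; exact: sqs.1.
    - by apply: measurable_sum => j; apply: measurable_funM => //; exact: (sqI i j s r s0 sr).1.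
    - apply: filterS2 YX (noiseE i s r s0 sr) => w hw <-.
      by rewrite -mulr_sumr /slope hw.
  rewrite Ex_sum; last by move=> j; apply: sqint_mul => //; exact: sqI.
  rewrite big1 // => j _.
  exact: (ito_orth hF hB C0 s0 sr (fun u w => @vol_bounded i j u w) (hI i j s s0) (hI i j r r0)).
have [Kq hq] := moment_bound L0 fL mpsip psip01 mY cY Y0 noiseK t.
pose E r := Ex P (excess f Y fstar r).
have E0 r : 0 <= r -> r <= t -> 0 <= E r.
  by move=> _ _; apply: Ex_ge0 => w; exact: excess_ge0.
have E00 : E 0 = f x0 - fstar.
  rewrite /E -[RHS](Ex_cst P); congr Ex; apply/funext => w; by rewrite /excess Y0.
pose K3 := step_error f L x0 (h * S) t Kq.
have E_step s r : 0 <= s -> s < r -> r <= t -> E r <= (1 - 2 * mu * Int s r psip) * E s +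
    L / 2 * (h * S) * Int s r beta + K3 * Num.sqrt (r - s) ^+ 3.
  move=> s0 sr rt; rewrite -[L / 2 * (h * S) * _]mulrA.
  exact: (one_step L0 fL mpsip psip01 mY cY noiseK t0 hq f_min f_PL noiseBd BdK noise_orth s0 sr rt).
have C1 : 0 <= L / 2 * (h * S) by rewrite !mulr_ge0 // invr_ge0.
have a0 : 0 <= 2 * mu by rewrite mulr_ge0.
have K30 : 0 <= K3 := step_error_ge0 L0 noiseK t0 hq.
have main := gronwall_limit t0 a0 C1 K30 mpsip psip01 (ibeta 0 t) (fun r => (andP (beta01 r)).1) E0 E_step.
have phiE r : 0 <= r -> phi psi r = Int 0 r psip.
  move=> r0; rewrite /phi -Int_closed; last exact: iint_continuous.
  by apply: eq_Rintegral => u /set_mem /=; rewrite in_itv /= => /andP[u0 _]; rewrite psipE.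
have iE : integ P (excess f Y fstar t) := excess_integ fL mY hq f_min t0 (lexx t).
have -> : ('E_P[fun w => (f (X t w) - fstar)%R] = (E t)%:E)%E.
  rewrite unlock /E EFin_Ex //; apply: ae_eq_integral => //.
  - apply/measurable_EFinP; apply: measurable_funB => //.
    by apply: measurable_vec_comp => //; [exact: (L_smooth_continuous fL)|move=> i; exact: mX].
  - by apply/measurable_EFinP; exact: integ_meas iE.
  - by apply: filterS YX => w hw _; rewrite /excess hw.
rewrite lee_fin; apply: (le_trans main); rewrite E00 (phiE t t0) lerD2l.
apply: le_of_eq; apply: (congr1 (fun z => L / 2 * (h * S) * z)).
rewrite -Int_closed; last first.
  have := iint_weight (2 * mu) t0 mpsip psip01 (ibeta 0 t) (- (2 * mu * Int 0 t psip)).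
  apply: eq_iint => u _; rewrite mulrC; congr (_ * expR _); ring.
apply: eq_Rintegral => u /set_mem /=; rewrite in_itv /= => /andP[u0 _].
by rewrite /beta psipE // bpE // phiE.
Qed.

End Rate.

Theorem theorem3 (R : realType) (d N : nat) (hN : (0 < N)%N)
  (fs : 'I_N -> 'cV[R]_d -> R) (L mu h : R) (xstar x0 : 'cV[R]_d)
  (sigma : 'cV[R]_d -> 'M[R]_d) (psi b : R -> R)
  (dT : measure_display) (T : measurableType dT) (P : probability T R)
  (F : R -> set_system T) (B X : R -> T -> 'cV[R]_d)
  (hC3 : forall i, Ck 3 (fs i))
  (hthird : forall i, bounded_third_derivative (fs i))
  (hsmooth : forall i, L_smooth L (fs i))
  (hmin : global_minimizer (favg fs) xstar)
  (hsigma : is_sigma_MB fs sigma)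
  (hsup : has_ubound (volatility_norms sigma))
  (hmu : 0 < mu)
  (hPL : polyak_lojasiewicz mu (favg fs) xstar)
  (hh : 0 < h)
  (hpsi : adjustment_function psi)
  (hb : batch_size_function b)
  (hF : filtration F)
  (hB : brownian_motion P F B)
  (hX : mb_pgf_solution P fs sigma psi b h F B x0 X) :
  forall t : R, 0 <= t ->
    ('E_P[fun w => (favg fs (X t w) - favg fs xstar)%R] <=
     (expR (- (2 * mu * phi psi t)) * (favg fs x0 - favg fs xstar)
      + h * d%:R * L * sigma_star2 sigma / 2 *
        \int[lebesgue_measure]_(s in `[0%R, t])
          (psi s ^+ 2 / b s *
           expR (- (2 * mu * (phi psi t - phi psi s)))))%:E)%E.
Proof.
move=> t t0.
have fL := favg_smooth hN hsmooth.
(* In dimension zero smoothness does not force L >= 0, but there every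
   gradient vanishes and L may be replaced by 0. *)
pose L' := if (0 < d)%N then L else 0.
have L'0 : 0 <= L'.
  rewrite /L'; case: ifP => // d0; have [_ /(_ (delta_mx (Ordinal d0) 0) 0)] := fL.
  rewrite subr0; have -> : enorm (delta_mx (Ordinal d0) 0 : 'cV[R]_d) = 1.
    rewrite /enorm (bigD1 (Ordinal d0)) //= mxE !eqxx expr1n big1 ?addr0 ?sqrtr1 // => i i0.
    by rewrite mxE (negbTE i0) expr0n.
  by rewrite mulr1; apply: le_trans; exact: enorm_ge0.
have dL : d%:R * L = d%:R * L' :> R.
  by rewrite /L'; case: posnP => // ->; rewrite !mul0r.
have fL' : L_smooth L' (favg fs).
  have [df lf] := fL; split => // x y; rewrite /L'; case: posnP => // d0.
  rewrite mul0r /enorm big1 ?sqrtr0 // => i _.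
  by have := ltn_ord i; rewrite [X in (_ < X)%N]d0.
have := rate_of_solution hF hB L'0 fL' hmin (ltW hmu) hPL (ltW hh) hpsi hb (frobenius_le hsup) hX t0.
have -> // : L' / 2 * (h * (d%:R * sigma_star2 sigma)) = h * d%:R * L * sigma_star2 sigma / 2.
have -> : L' / 2 * (h * (d%:R * sigma_star2 sigma)) = h * (d%:R * L') * sigma_star2 sigma / 2 by ring.
by rewrite -dL !mulrA.
Qed.
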